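(* Let $X$, $Y_1$, $Y_2$ be locally compact Hausdorff spaces and let $\mu_1:Y_1\to X$ and $\mu_2:Y_2\to X$ be proper continuous maps. The maps $\mu_1$ and $\mu_2$ satisfy the Beck-Chevalley condition for operator modules if and only if $\displaystyle\max_{x\in X}\,\min_{i=1,2}\,\#\mu_i^{-1}(x)<\infty$.
   Context: For a $C^*$-algebra $A$, a (nondegenerate, right) operator $A$-module is, concretely, a norm-closed linear subspace $E\subseteq \mathrm{B}(H)$, where $H$ is a Hilbert space on which $A$ is represented as bounded operators, such that $EA=E$; it carries the operator space structure inherited from $\mathrm{B}(H)$. $\mathrm{OM}(A)$ is the category of operator $A$-modules with completely bounded $A$-linear maps as morphisms. A map $t$ of operator spaces is completely bounded if $\sup_n\|\mathrm{id}_{M_n}\otimes t\|<\infty$. Thus an isomorphism in $\mathrm{OM}(A)$ is an $A$-linear bijection that is completely bounded with completely bounded inverse. Haagerup tensor product: for a right operator $A$-module $E$ and a left operator $A$-module $B$, the Haagerup seminorm of $F\in M_n\otimes(E\otimes_A B)$ is $\inf\|D\|\,\|G\|$ over all $m\in\mathbb N$, $D\in M_{n,m}\otimes E$, $G\in M_{m,n}\otimes B$ with $F=D\odot G$, where $(d\otimes e)\odot(g\otimes b)=dg\otimes(e\otimes b)$. $E\otimes^{\mathrm h}_A B$ is the separated completion of $E\otimes_A B$ for the $n=1$ seminorm, with the operator space structure given by these seminorms. For a continuous map $\mu:Y\to X$ of locally compact Hausdorff spaces, $C_0(X)$ acts on $C_0(Y)$ through the pullback homomorphism $\mu^*:C_0(X)\to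 M(C_0(Y))$. Define functors $\mu_*:\mathrm{OM}(C_0(Y))\to\mathrm{OM}(C_0(X))$, $\mu_*E=E\otimes^{\mathrm h}_{C_0(Y)}C_0(Y)$ with $C_0(Y)$ regarded as a $C_0(Y)$-$C_0(X)$-bimodule (so $\mu_*E\cong E$ with $C_0(X)$ acting through $\mu^*$), and $\mu^*:\mathrm{OM}(C_0(X))\to\mathrm{OM}(C_0(Y))$, $\mu^*F=F\otimes^{\mathrm h}_{C_0(X)}C_0(Y)$ with $C_0(Y)$ regarded as a $C_0(X)$-$C_0(Y)$-bimodule. When $\mu$ is proper, $\mu^*$ is left adjoint to $\mu_*$, with counit $\mu^*\mu_*E\to E$, $e\otimes b\mapsto eb$. Let $Y_1\times_X Y_2=\{(y_1,y_2):\mu_1(y_1)=\mu_2(y_2)\}$ with coordinate projections $\pi_i:Y_1\times_XY_2\to Y_i$, so that $\mu_1\pi_1=\mu_2\pi_2$. The base-change map is the natural transformation $\mu_2^*\mu_{1*}\to\pi_{2*}\pi_1^*$ of functors $\mathrm{OM}(C_0(Y_1))\to\mathrm{OM}(C_0(Y_2))$ given by the composite $$\mu_2^*\mu_{1*}\to\mu_2^*\mu_{1*}\pi_{1*}\pi_1^*\cong\mu_2^*\mu_{2*}\pi_{2*}\pi_1^*\to\pi_{2*}\pi_1^*$$ of the unit of the adjunction $\pi_1^*\dashv\pi_{1*}$ and the counit of $\mu_2^*\dashv\mu_{2*}$. Explicitly, for $E\in\mathrm{OM}(C_0(Y_1))$ it is the map $E\otimes^{\mathrm h}_{C_0(X)}C_0(Y_2)\to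 E\otimes^{\mathrm h}_{C_0(Y_1)}C_0(Y_1\times_XY_2)$ determined by $eb\otimes c\mapsto e\otimes \pi_1^*(b)\pi_2^*(c)$ for $e\in E$, $b\in C_0(Y_1)$, $c\in C_0(Y_2)$. The maps $\mu_1,\mu_2$ satisfy the Beck-Chevalley condition for operator modules if the base-change map is a natural isomorphism. $\#S\in\{0,1,2,\dots,\infty\}$ denotes cardinality, and $\max_{x\in X}$ is understood as a supremum in $[0,\infty]$. *)

(* Defs.v *)
(** MathComp-Analysis, over an arbitrary [R : realType].

    Operator modules over C_0(X), the Haagerup tensor product over C_0(X), and
    the base-change map attached to a pair of proper maps. *)

From HB Require Import structures.
From mathcomp Require Import all_boot all_order all_algebra.
From mathcomp Require Import generic_quotient complex.
From mathcomp Require Import all_classical all_reals topology normedtype sequences.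
From mathcomp Require Import counting_measure.
From mathcomp Require Import ring lra.

Set Implicit Arguments.
Unset Strict Implicit.
Unset Printing Implicit Defensive.

Import Order.TTheory GRing.Theory Num.Theory.
Import numFieldNormedType.Exports.
Local Open Scope classical_set_scope.
Local Open Scope ring_scope.

(** [R[i]] packed as a [numClosedFieldType]: it is through [numFieldType] that the
    complex numbers get their usual topology. *)
Definition Cplx (R : realType) : numClosedFieldType := R[i].

(** The modulus as an element of [R]; [`|z|] itself lives in [R[i]] ([cmodE]). *)
Definition cmod (R : realType) (z : Cplx R) : R := ComplexField.Normc.normc z.

Section Cmod.
Context {R : realType}.
Implicit Types z w : Cplx R.

Lemma cmodE z : `|z| = (cmod z)%:C%C.
Proof. by []. Qed.

Lemma cmod_ge0 z : 0 <= cmod z.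
Proof. by case: z => a b; exact: Num.Theory.sqrtr_ge0. Qed.

Lemma cmodD z w : cmod (z + w) <= cmod z + cmod w.
Proof. exact: le_normcD. Qed.

Lemma cmodM z w : cmod (z * w) = cmod z * cmod w.
Proof. exact: ComplexField.Normc.normcM. Qed.

Lemma cmod0 : cmod (0 : Cplx R) = 0.
Proof. exact: ComplexField.Normc.normc0. Qed.

Lemma cmod1 : cmod (1 : Cplx R) = 1.
Proof. exact: ComplexField.Normc.normc1. Qed.

Lemma cmodN z : cmod (- z) = cmod z.
Proof. exact: normcN. Qed.

Lemma cmodR (r : R) : cmod (r%:C%C : Cplx R) = `|r|.
Proof. by rewrite /cmod /= expr0n /= addr0 sqrtr_sqr. Qed.

Lemma cmodJ z : cmod (Num.conj z) = cmod z.
Proof.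
have : `|Num.conj z| = `|z| by exact: norm_conjC.
by rewrite !cmodE => -[].
Qed.

Lemma cmod_continuous : continuous (@cmod R).
Proof.
move=> z; apply/(@cvgrPdist_lt _ R^o _ (nbhs z) _) => e e0.
have e0' : 0 < (e%:C%C : Cplx R) by rewrite ltcR.
have := @nbhsx_ballx _ (Cplx R) z _ e0'.
rewrite -ball_normE; apply: filterS => w /=; rewrite cmodE ltcR => le; apply: le_lt_trans le.
have h1 := cmodD (z - w) w; have h2 := cmodD (w - z) z.
rewrite !subrK in h1 h2; rewrite -(opprB z w) cmodN in h2.
by rewrite ler_norml; apply/andP; split; lra.
Qed.

Lemma conj_continuous : continuous (Num.conj : Cplx R -> Cplx R).
Proof.
move=> z; apply/(@cvgrPdist_lt _ (Cplx R)^o _ (nbhs z) _) => e e0.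
have := @nbhsx_ballx _ (Cplx R) z _ e0.
rewrite -ball_normE; by apply: filterS => w /=; rewrite -rmorphB /= norm_conjC.
Qed.

End Cmod.

Section RealAux.
Context {R : realType}.

Lemma sup_le_nneg (S : set R) (M : R) : 0 <= M -> ubound S M -> sup S <= M.
Proof.
move=> M0 SM; have [->|/set0P S0] := eqVneq S set0; first by rewrite sup0.
exact: ge_sup.
Qed.

Lemma sup_nneg (S : set R) : (forall x, S x -> 0 <= x) -> 0 <= sup S.
Proof.
move=> S0; have [->|/set0P [x Sx]] := eqVneq S set0; first by rewrite sup0.
have [ubS|nub] := pselect (has_ubound S); last by rewrite sup_out // => -[].
by apply: le_trans (S0 _ Sx) _; exact: ub_le_sup.
Qed.

Lemma cauchy_schwarz n (a b : 'I_n -> R) :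
  (\sum_i a i * b i) ^+ 2 <= (\sum_i a i ^+ 2) * (\sum_i b i ^+ 2).
Proof.
set P := \sum_i _ * _; set A := \sum_i a i ^+ 2; set B := \sum_i b i ^+ 2.
have B0 : 0 <= B by apply: sumr_ge0 => i _; exact: sqr_ge0.
have [B00|Bn0] := eqVneq B 0.
  have b0 i : b i = 0.
    move/eqP: B00; rewrite psumr_eq0; last by move=> j _; exact: sqr_ge0.
    by move=> /allP /(_ i (mem_index_enum _)) /=; rewrite sqrf_eq0 => /eqP.
  rewrite B00 /P big1 ?expr0n ?mulr0 //= => i _; by rewrite b0 mulr0.
have Bp : 0 < B by rewrite lt_neqAle eq_sym Bn0.
have : 0 <= \sum_i (B * a i - P * b i) ^+ 2 by apply: sumr_ge0 => i _; exact: sqr_ge0.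
have -> : \sum_i (B * a i - P * b i) ^+ 2 = B * (A * B - P ^+ 2).
  transitivity (\sum_i (B ^+ 2 * a i ^+ 2 + - (2 * B * P) * (a i * b i) +
      P ^+ 2 * b i ^+ 2)); first by apply: eq_bigr => i _; ring.
  by rewrite !big_split /= -!mulr_sumr -/A -/B -/P; ring.
by rewrite pmulr_rge0 // subr_ge0.
Qed.

Lemma minkowski2 n (a b : 'I_n -> R) :
  Num.sqrt (\sum_i (a i + b i) ^+ 2) <=
  Num.sqrt (\sum_i a i ^+ 2) + Num.sqrt (\sum_i b i ^+ 2).
Proof.
have s0 (c : 'I_n -> R) : 0 <= \sum_i c i ^+ 2.
  by apply: sumr_ge0 => i _; exact: sqr_ge0.
rewrite -(@ler_sqr R) ?nnegrE ?addr_ge0 ?sqrtr_ge0 // sqrrD !sqr_sqrtr //.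
under eq_bigr => i _ do rewrite sqrrD.
rewrite big_split /= big_split /= lerD2r lerD2l sumrMnl lerMn2r /=.
rewrite -sqrtrM //; apply: le_trans (ler_norm _) _; rewrite -sqrtr_sqr.
by rewrite ler_sqrt ?cauchy_schwarz // mulr_ge0.
Qed.

Lemma cs2 (a b c d : R) :
  (a * c + b * d) ^+ 2 <= (a ^+ 2 + b ^+ 2) * (c ^+ 2 + d ^+ 2).
Proof. have := sqr_ge0 (a * d - b * c); nra. Qed.

End RealAux.

(** [V^n] carries the l^2-norm built from the norm [N] of [V], and
    [opnorm T] is the norm of [T : V^n -> V^m] for these norms; when [V] is a
    Hilbert space this is the norm of M_{m,n}(B(V)) = B(V^n, V^m). *)
Section RowNorm.
Context {R : realType} {V : lmodType (Cplx R)} (N : V -> R).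
Local Notation C := (Cplx R).

Definition vnorm n (xi : 'I_n -> V) : R := Num.sqrt (\sum_i N (xi i) ^+ 2).

Definition mxapp m n (T : 'I_m -> 'I_n -> V -> V) (xi : 'I_n -> V) : 'I_m -> V :=
  fun i => \sum_j T i j (xi j).

Definition opnorm m n (T : 'I_m -> 'I_n -> V -> V) : R :=
  sup [set r | exists2 xi, vnorm xi <= 1 & r = vnorm (mxapp T xi)].

Definition bounded_linear (T : V -> V) : Prop :=
  linear T /\ exists M, forall x, N (T x) <= M * N x.

Hypothesis N0 : forall x, 0 <= N x.
Hypothesis ND : forall x y, N (x + y) <= N x + N y.
Hypothesis NZ : forall (a : C) x, N (a *: x) = cmod a * N x.

Lemma vnorm_ge0 n (xi : 'I_n -> V) : 0 <= vnorm xi.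
Proof. exact: sqrtr_ge0. Qed.

Lemma vnorm_sqr n (xi : 'I_n -> V) : vnorm xi ^+ 2 = \sum_i N (xi i) ^+ 2.
Proof. by rewrite sqr_sqrtr // sumr_ge0 // => i _; exact: sqr_ge0. Qed.

Lemma vnormD n (xi eta : 'I_n -> V) :
  vnorm (fun i => xi i + eta i) <= vnorm xi + vnorm eta.
Proof.
apply: le_trans (minkowski2 _ _); rewrite ler_sqrt; last first.
  by apply: sumr_ge0 => i _; exact: sqr_ge0.
by apply: ler_sum => i _; rewrite ler_sqr ?nnegrE ?addr_ge0.
Qed.

Lemma vnormZ n a (xi : 'I_n -> V) :
  vnorm (fun i => a *: xi i) = cmod a * vnorm xi.
Proof.
rewrite /vnorm; under eq_bigr => i _ do rewrite NZ exprMn.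
by rewrite -mulr_sumr sqrtrM ?sqr_ge0 // sqrtr_sqr ger0_norm // cmod_ge0.
Qed.

Lemma N00 : N 0 = 0.
Proof. by rewrite -(scale0r 0) NZ cmod0 mul0r. Qed.

Lemma Nsum n (xi : 'I_n -> V) : N (\sum_i xi i) <= \sum_i N (xi i).
Proof.
elim/big_ind2: _ => [|x1 x2 y1 y2 h1 h2|//]; first by rewrite N00.
by apply: le_trans (ND _ _) _; exact: lerD.
Qed.

Lemma N_le_vnorm n (xi : 'I_n -> V) i : N (xi i) <= vnorm xi.
Proof.
rewrite -(@ler_sqr R) ?nnegrE ?vnorm_ge0 // vnorm_sqr (bigD1 i) //= lerDl.
by apply: sumr_ge0 => j _; exact: sqr_ge0.
Qed.

Lemma vnorm_le_sum n (xi : 'I_n -> V) : vnorm xi <= \sum_i N (xi i).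
Proof.
have s0 (I : finType) (P : pred I) (f : I -> R) :
  (forall i, 0 <= f i) -> 0 <= \sum_(i | P i) f i by move=> f0; apply: sumr_ge0.
rewrite -(@ler_sqr R) ?nnegrE ?vnorm_ge0 ?s0 // vnorm_sqr.
rewrite expr2 mulr_suml; apply: ler_sum => i _.
rewrite expr2; apply: ler_wpM2l => //.
by rewrite (bigD1 i) //= lerDl s0.
Qed.

Lemma mxapp_bound m n (T : 'I_m -> 'I_n -> V -> V) (B : 'I_m -> 'I_n -> R) :
  (forall i j, 0 <= B i j) -> (forall i j x, N (T i j x) <= B i j * N x) ->
  forall xi, vnorm (mxapp T xi) <= (\sum_i \sum_j B i j) * vnorm xi.
Proof.
move=> B0 TB xi; apply: le_trans (vnorm_le_sum _) _.
rewrite mulr_suml; apply: ler_sum => i _; apply: le_trans (Nsum _) _.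
rewrite mulr_suml; apply: ler_sum => j _; apply: le_trans (TB _ _ _) _.
by apply: ler_wpM2l => //; exact: N_le_vnorm.
Qed.

Lemma opnorm_le m n (T : 'I_m -> 'I_n -> V -> V) M : 0 <= M ->
  (forall xi, vnorm (mxapp T xi) <= M * vnorm xi) -> opnorm T <= M.
Proof.
move=> M0 TM; apply: sup_le_nneg => // r [xi xi1 ->].
by apply: le_trans (TM _) _; rewrite ler_piMr.
Qed.

Lemma opnorm_ge0 m n (T : 'I_m -> 'I_n -> V -> V) : 0 <= opnorm T.
Proof. by apply: sup_nneg => r [xi _ ->]; exact: vnorm_ge0. Qed.

Lemma le_opnorm m n (T : 'I_m -> 'I_n -> V -> V) :
  (forall i j, bounded_linear (T i j)) ->
  forall xi, vnorm (mxapp T xi) <= opnorm T * vnorm xi.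
Proof.
move=> Tb.
have [M [M0 TM]] : exists M, 0 <= M /\
    forall xi, vnorm (mxapp T xi) <= M * vnorm xi.
  have /choice [B HB] : forall ij : 'I_m * 'I_n, exists B, 0 <= B /\
      forall x, N (T ij.1 ij.2 x) <= B * N x.
    move=> [i j]; have [_ [B HB]] := Tb i j; exists `|B|; split=> // x.
    by apply: le_trans (HB x) _; apply: ler_wpM2r => //; exact: ler_norm.
  exists (\sum_i \sum_j B (i, j)); split.
    by apply: sumr_ge0 => i _; apply: sumr_ge0 => j _; case: (HB (i, j)).
  apply: (@mxapp_bound _ _ T (fun i j => B (i, j))) => [i j|i j x].
    by case: (HB (i, j)).
  by case: (HB (i, j)).
have appZ a xi : mxapp T (fun j => a *: xi j) = fun i => a *: mxapp T xi i.
  apply/funext => i; rewrite /mxapp scaler_sumr; apply: eq_bigr => j _.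
  have [lT _] := Tb i j; have := lT a (xi j) 0; rewrite addr0 => ->.
  have -> : T i j 0 = 0; last by rewrite addr0.
  by have := lT (-1) 0 0; rewrite scaler0 addr0 scaleN1r addNr.
move=> xi; have [x0|xn0] := eqVneq (vnorm xi) 0.
  by have := TM xi; rewrite x0 !mulr0.
have xp : 0 < vnorm xi by rewrite lt_neqAle eq_sym xn0 vnorm_ge0.
pose a : C := ((vnorm xi)^-1)%:C%C.
have ca : cmod a = (vnorm xi)^-1 by rewrite cmodR ger0_norm // invr_ge0 ltW.
rewrite -ler_pdivrMr // mulrC -ca -vnormZ -appZ; apply: ub_le_sup.
  exists M => r [eta e1 ->]; apply: le_trans (TM _) _.
  by rewrite ler_piMr.
by exists (fun j => a *: xi j); rewrite // vnormZ ca mulVf.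
Qed.

Section Block.
Variables (m m' n n' : nat).

Lemma opnorm_row (T : 'I_m -> 'I_n -> V -> V) (T' : 'I_m -> 'I_n' -> V -> V)
    (S : 'I_m -> 'I_(n + n') -> V -> V) a b :
  (forall i j, S i (lshift n' j) = T i j) ->
  (forall i j, S i (rshift n j) = T' i j) ->
  (forall i j, bounded_linear (T i j)) -> (forall i j, bounded_linear (T' i j)) ->
  opnorm T <= a -> opnorm T' <= b ->
  opnorm S <= Num.sqrt (a ^+ 2 + b ^+ 2).
Proof.
move=> ST ST' bT bT' Ta Tb; apply: opnorm_le => [|xi]; first exact: sqrtr_ge0.
have a0 : 0 <= a by apply: le_trans Ta; exact: opnorm_ge0.
have b0 : 0 <= b by apply: le_trans Tb; exact: opnorm_ge0.
pose x1 := fun j => xi (lshift n' j); pose x2 := fun j => xi (rshift n j).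
have -> : mxapp S xi = fun i => mxapp T x1 i + mxapp T' x2 i.
  apply/funext => i; rewrite /mxapp big_split_ord /=; congr (_ + _);
  by apply: eq_bigr => j _; rewrite (ST, ST').
have xE : vnorm xi ^+ 2 = vnorm x1 ^+ 2 + vnorm x2 ^+ 2.
  by rewrite !vnorm_sqr big_split_ord.
apply: le_trans (vnormD _ _) _.
have h1 := le_opnorm bT x1; have h2 := le_opnorm bT' x2.
apply: (@le_trans _ _ (a * vnorm x1 + b * vnorm x2)).
  apply: lerD; [apply: le_trans h1 _|apply: le_trans h2 _];
  by apply: ler_wpM2r => //; exact: vnorm_ge0.
rewrite -(@ler_sqr R) ?nnegrE; first last.
- by rewrite mulr_ge0 ?sqrtr_ge0 ?vnorm_ge0.
- by rewrite addr_ge0 // mulr_ge0 ?vnorm_ge0.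
rewrite exprMn sqr_sqrtr ?addr_ge0 ?sqr_ge0 // xE; exact: cs2.
Qed.

Lemma opnorm_col (T : 'I_m -> 'I_n -> V -> V) (T' : 'I_m' -> 'I_n -> V -> V)
    (S : 'I_(m + m') -> 'I_n -> V -> V) a b :
  (forall i j, S (lshift m' i) j = T i j) ->
  (forall i j, S (rshift m i) j = T' i j) ->
  (forall i j, bounded_linear (T i j)) -> (forall i j, bounded_linear (T' i j)) ->
  opnorm T <= a -> opnorm T' <= b ->
  opnorm S <= Num.sqrt (a ^+ 2 + b ^+ 2).
Proof.
move=> ST ST' bT bT' Ta Tb; apply: opnorm_le => [|xi]; first exact: sqrtr_ge0.
have a0 : 0 <= a by apply: le_trans Ta; exact: opnorm_ge0.
have b0 : 0 <= b by apply: le_trans Tb; exact: opnorm_ge0.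
have E : vnorm (mxapp S xi) ^+ 2 =
    vnorm (mxapp T xi) ^+ 2 + vnorm (mxapp T' xi) ^+ 2.
  rewrite !vnorm_sqr big_split_ord /=; congr (_ + _);
  by apply: eq_bigr => i _; congr (N _ ^+ 2); apply: eq_bigr => j _; rewrite (ST, ST').
rewrite -(@ler_sqr R) ?nnegrE ?vnorm_ge0 // ?mulr_ge0 ?sqrtr_ge0 ?vnorm_ge0 //.
rewrite E exprMn (sqr_sqrtr (addr_ge0 (sqr_ge0 a) (sqr_ge0 b))) mulrDl -!exprMn.
have h1 := le_opnorm bT xi; have h2 := le_opnorm bT' xi.
apply: lerD; rewrite ler_sqr ?nnegrE ?mulr_ge0 ?vnorm_ge0 //;
  [apply: le_trans h1 _|apply: le_trans h2 _];
  by apply: ler_wpM2r => //; exact: vnorm_ge0.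
Qed.

End Block.

Lemma opnorm_scale m n (T S : 'I_m -> 'I_n -> V -> V) a :
  (forall i j x, S i j x = a *: T i j x) ->
  (forall i j, bounded_linear (T i j)) -> opnorm S <= cmod a * opnorm T.
Proof.
move=> ST bT; apply: opnorm_le => [|xi].
  by rewrite mulr_ge0 ?cmod_ge0 ?opnorm_ge0.
have -> : mxapp S xi = fun i => a *: mxapp T xi i.
  apply/funext => i; rewrite /mxapp scaler_sumr; apply: eq_bigr => j _.
  exact: ST.
by rewrite vnormZ -mulrA ler_wpM2l ?cmod_ge0 ?le_opnorm.
Qed.

End RowNorm.

Record properMap (Y X : topologicalType) := ProperMap {
  pm_fun :> Y -> X;
  pm_continuous : continuous pm_fun;
  pm_proper : forall K : set X, compact K -> compact (pm_fun @^-1` K)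
}.

Section ContinuousFunctions.
Variable R : realType.
Local Notation C := (Cplx R).

Definition vanishes_at_infinity (X : topologicalType) (f : X -> C) : Prop :=
  forall eps : R, 0 < eps ->
    exists2 K : set X, compact K & forall x, ~ K x -> cmod (f x) < eps.

Definition is_C0 (X : topologicalType) : {pred X -> C} :=
  fun f => `[< continuous f /\ vanishes_at_infinity f >].

(** C_0(X) for [X] Hausdorff. *)
Record C0 (X : topologicalType) := MkC0 {
  C0_fun :> X -> C;
  C0P : C0_fun \in @is_C0 X
}.

HB.instance Definition _ (X : topologicalType) := [isSub of C0 X for @C0_fun X].
HB.instance Definition _ (X : topologicalType) := [Choice of C0 X by <:].

Section Closure.
Variable X : topologicalType.
Implicit Types f g : X -> C.

Lemma is_C0P f : reflect (continuous f /\ vanishes_at_infinity f) (f \in @is_C0 X).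
Proof. exact: asboolP. Qed.

Lemma is_C0_bounded f : f \in @is_C0 X ->
  exists2 M, 0 <= M & forall x, cmod (f x) <= M.
Proof.
move=> /is_C0P [fc /(_ 1 ltr01) [K cK Kf]].
have cf : continuous (@cmod R \o f).
  by move=> x; apply: continuous_comp; [exact: fc|exact: cmod_continuous].
have : compact ((@cmod R \o f) @` K).
  by apply: continuous_compact => //; exact: continuous_subspaceT.
move=> /(@compact_bounded R R^o) [M [_ /(_ (`|M| + 1))]].
rewrite (lt_le_trans _ (lerD (ler_norm M) (lexx 1))) ?ltrDl // => /(_ isT) HM.
exists (`|M| + 1) => [|x]; first by rewrite addr_ge0.
have [Kx|/Kf/ltW] := pselect (K x).
  have /= := HM (cmod (f x)) (imageP _ Kx).
  by rewrite ger0_norm ?cmod_ge0.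
by move/le_trans; apply; rewrite lerDr.
Qed.

Lemma vanishes_le f g M : 0 <= M -> (forall x, cmod (g x) <= M * cmod (f x)) ->
  vanishes_at_infinity f -> vanishes_at_infinity g.
Proof.
move=> M0 gf vf e e0; have M1 : 0 < M + 1 by rewrite ltr_wpDl.
have [K cK HK] := vf (e / (M + 1)) (divr_gt0 e0 M1); exists K => // x /HK fx.
apply: le_lt_trans (gf x) _; rewrite ltr_pdivlMr // in fx.
apply: le_lt_trans fx; rewrite mulrC ler_wpM2l ?cmod_ge0 //.
by rewrite lerDl.
Qed.

Lemma is_C0_submod : GRing.submod_closed (@is_C0 X).
Proof.
split=> [|a f g].
  apply/is_C0P; split=> [x|e e0]; first exact: cvg_cst.
  by exists set0 => [|x _]; [exact: compact0|rewrite cmod0].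
move=> /is_C0P [fc fv] /is_C0P [gc gv]; apply/is_C0P; split=> [x|].
  apply: (@cvgD _ C^o); last exact: gc.
  by apply: (@cvgM _ _ _ _ (cst a) f); [exact: cvg_cst|exact: fc].
have afv : vanishes_at_infinity (a *: f).
  apply: (@vanishes_le f _ (cmod a)) fv; first exact: cmod_ge0.
  by move=> x; rewrite -cmodM.
move=> e e0; have e2 : 0 < e / 2 by rewrite divr_gt0.
have [K cK HK] := afv _ e2; have [L cL HL] := gv _ e2.
exists (K `|` L); first exact: compactU.
move=> x /not_orP [/HK h1 /HL h2].
by apply: le_lt_trans (cmodD _ _) _; rewrite [ltRHS](splitr e) ltrD.
Qed.

Lemma is_C0_mul f g : f \in @is_C0 X -> g \in @is_C0 X ->
  (fun x => f x * g x) \in @is_C0 X.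
Proof.
move=> f0 /is_C0P [gc gv]; have [M M0 HM] := is_C0_bounded f0.
move/is_C0P : f0 => [fc _]; apply/is_C0P; split=> [x|].
  by apply: cvgM; [exact: fc|exact: gc].
by apply: (vanishes_le M0) gv => x; rewrite cmodM ler_wpM2r ?cmod_ge0.
Qed.

Lemma is_C0_conj f : f \in @is_C0 X -> (fun x => Num.conj (f x)) \in @is_C0 X.
Proof.
move=> /is_C0P [fc fv]; apply/is_C0P; split=> [x|].
  exact: (continuous_comp (fc x) (@conj_continuous _ _)).
by apply: (@vanishes_le f _ 1) fv => // x; rewrite mul1r cmodJ.
Qed.

End Closure.

HB.instance Definition _ (X : topologicalType) :=
  GRing.isSubmodClosed.Build C (X -> C) (@is_C0 X) (@is_C0_submod X).
HB.instance Definition _ (X : topologicalType) :=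
  [SubChoice_isSubLmodule of C0 X by <:].

Definition C0_mul (X : topologicalType) (f g : C0 X) : C0 X :=
  MkC0 (is_C0_mul (C0P f) (C0P g)).

Definition C0_conj (X : topologicalType) (f : C0 X) : C0 X :=
  MkC0 (is_C0_conj (C0P f)).

Lemma is_C0_pull (X Y : topologicalType) (mu : properMap Y X) (f : C0 X) :
  (fun y => f (mu y)) \in @is_C0 Y.
Proof.
have /is_C0P [fc fv] := C0P f; apply/is_C0P; split=> [y|e e0].
  exact: (continuous_comp (@pm_continuous _ _ mu y) (fc (mu y))).
have [K cK HK] := fv e e0; exists (mu @^-1` K); first exact: pm_proper.
by move=> y /HK.
Qed.

Definition C0_pull (X Y : topologicalType) (mu : properMap Y X) (f : C0 X) : C0 Y :=
  MkC0 (is_C0_pull mu f).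

End ContinuousFunctions.

Section FibreProduct.
Variables (X Y1 Y2 : topologicalType).
Hypothesis hX : hausdorff_space X.
Variables (mu1 : properMap Y1 X) (mu2 : properMap Y2 X).

(** The subspace topology of the product. *)
Definition fibre_product : topologicalType :=
  set_type [set p : Y1 * Y2 | mu1 p.1 = mu2 p.2].

Lemma fibre_productE (z : fibre_product) : mu1 (set_val z).1 = mu2 (set_val z).2.
Proof. by case: z => z Hz; exact: (set_mem Hz). Qed.

Lemma fibre_fst_continuous : continuous (fun z : fibre_product => (set_val z).1).
Proof.
move=> z; apply: (@continuous_comp _ _ _ _ (@fst Y1 Y2)); last exact: cvg_fst.
exact: initial_continuous.
Qed.

Lemma fibre_snd_continuous : continuous (fun z : fibre_product => (set_val z).2).
Proof.
move=> z; apply: (@continuous_comp _ _ _ _ (@snd Y1 Y2)); last exact: cvg_snd.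
exact: initial_continuous.
Qed.

Lemma fibre_cvg (F : set_system fibre_product) (y1 : Y1) (y2 : Y2) : ProperFilter F ->
  (fun z : fibre_product => (set_val z).1) @ F --> y1 ->
  (fun z : fibre_product => (set_val z).2) @ F --> y2 ->
  exists z : fibre_product, [/\ F --> z, (set_val z).1 = y1 & (set_val z).2 = y2].
Proof.
move=> FF c1 c2.
have e : mu1 y1 = mu2 y2.
  apply: (cvg_unique hX (F := (fun z : fibre_product => mu1 (set_val z).1) @ F)).
    exact: (cvg_comp _ _ c1 (@pm_continuous _ _ mu1 y1)).
  have -> : (fun z : fibre_product => mu1 (set_val z).1) =
            (fun z : fibre_product => mu2 (set_val z).2).
    by apply/funext => z; exact: fibre_productE.
  exact: (cvg_comp _ _ c2 (@pm_continuous _ _ mu2 y2)).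
pose z : fibre_product := exist _ (y1, y2) (mem_set e).
exists z; split=> //.
move=> A [B [[U oU <-] Uz UA]].
have : nbhs (y1, y2) U by rewrite nbhsE; exists U.
move=> [[P Q] [/= Py Qy] PQU]; apply: (filterS UA).
have h1 : F [set w | P (set_val w).1] := c1 _ Py.
have h2 : F [set w | Q (set_val w).2] := c2 _ Qy.
by apply: filterS2 h1 h2 => w Pw Qw; apply: PQU; split.
Qed.

Lemma ultra_map (T U : Type) (f : T -> U) (F : set_system T) :
  UltraFilter F -> UltraFilter (f @ F).
Proof.
move=> FU; split; first exact: fmap_proper_filter.
move=> G PG FG; rewrite eqEsubset; split=> // A GA.
have [//|nFA] := in_ultra_setVsetC (f @^-1` A) FU.
have GnA : G (~` A) by apply: FG.
by have := @filter_ex _ _ PG _ (filterI GA GnA); case=> x [].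
Qed.

Lemma fibre_fst_proper (K : set Y1) : compact K ->
  compact ((fun z : fibre_product => (set_val z).1) @^-1` K).
Proof.
move=> cK; rewrite compact_ultra => F FU FK.
pose p1 := fun z : fibre_product => (set_val z).1.
pose p2 := fun z : fibre_product => (set_val z).2.
have U1 : UltraFilter (p1 @ F) := ultra_map p1 FU.
have U2 : UltraFilter (p2 @ F) := ultra_map p2 FU.
have [y1 [Ky1 c1]] : K `&` [set p | p1 @ F --> p] !=set0.
  by move: cK; rewrite compact_ultra; apply.
have cL : compact (mu2 @^-1` (mu1 @` K)).
  apply: pm_proper; apply: continuous_compact => //.
  by apply: continuous_subspaceT; exact: pm_continuous.
have [y2 [_ c2]] : (mu2 @^-1` (mu1 @` K)) `&` [set p | p2 @ F --> p] !=set0.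
  have FL : F (p2 @^-1` (mu2 @^-1` (mu1 @` K))).
    apply: (filterS _ FK) => z Kz /=.
    by exists (p1 z) => //; exact: fibre_productE.
  by move: cL; rewrite compact_ultra; apply.
have [z [cz z1 z2]] := fibre_cvg _ c1 c2.
by exists z; split=> //=; rewrite z1.
Qed.

Lemma fibre_snd_proper (K : set Y2) : compact K ->
  compact ((fun z : fibre_product => (set_val z).2) @^-1` K).
Proof.
move=> cK; rewrite compact_ultra => F FU FK.
pose p1 := fun z : fibre_product => (set_val z).1.
pose p2 := fun z : fibre_product => (set_val z).2.
have U1 : UltraFilter (p1 @ F) := ultra_map p1 FU.
have U2 : UltraFilter (p2 @ F) := ultra_map p2 FU.
have [y2 [Ky2 c2]] : K `&` [set p | p2 @ F --> p] !=set0.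
  by move: cK; rewrite compact_ultra; apply.
have cL : compact (mu1 @^-1` (mu2 @` K)).
  apply: pm_proper; apply: continuous_compact => //.
  by apply: continuous_subspaceT; exact: pm_continuous.
have [y1 [_ c1]] : (mu1 @^-1` (mu2 @` K)) `&` [set p | p1 @ F --> p] !=set0.
  have FL : F (p1 @^-1` (mu1 @^-1` (mu2 @` K))).
    apply: (filterS _ FK) => z Kz /=.
    by exists (p2 z) => //; exact/esym/fibre_productE.
  by move: cL; rewrite compact_ultra; apply.
have [z [cz z1 z2]] := fibre_cvg _ c1 c2.
by exists z; split=> //=; rewrite z2.
Qed.

Definition fibre_fst : properMap fibre_product Y1 :=
  ProperMap fibre_fst_continuous fibre_fst_proper.
Definition fibre_snd : properMap fibre_product Y2 :=
  ProperMap fibre_snd_continuous fibre_snd_proper.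

End FibreProduct.

(** A left module presented as a setoid; [lquot] below is the quotient module. *)
Record lmodSetoid (K : nzRingType) := LmodSetoid {
  ls_car :> choiceType;
  ls_eq : ls_car -> ls_car -> Prop;
  ls_zero : ls_car;
  ls_add : ls_car -> ls_car -> ls_car;
  ls_scale : K -> ls_car -> ls_car;
  ls_refl : forall x, ls_eq x x;
  ls_sym : forall x y, ls_eq x y -> ls_eq y x;
  ls_trans : forall x y z, ls_eq x y -> ls_eq y z -> ls_eq x z;
  ls_add_eq : forall x x' y y',
    ls_eq x x' -> ls_eq y y' -> ls_eq (ls_add x y) (ls_add x' y');
  ls_scale_eq : forall a x x', ls_eq x x' -> ls_eq (ls_scale a x) (ls_scale a x');
  ls_addA : forall x y z, ls_eq (ls_add x (ls_add y z)) (ls_add (ls_add x y) z);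
  ls_addC : forall x y, ls_eq (ls_add x y) (ls_add y x);
  ls_add0 : forall x, ls_eq (ls_add ls_zero x) x;
  ls_addN : forall x, ls_eq (ls_add (ls_scale (-1) x) x) ls_zero;
  ls_scaleA : forall a b x, ls_eq (ls_scale a (ls_scale b x)) (ls_scale (a * b) x);
  ls_scale1 : forall x, ls_eq (ls_scale 1 x) x;
  ls_scaleDr : forall a x y,
    ls_eq (ls_scale a (ls_add x y)) (ls_add (ls_scale a x) (ls_scale a y));
  ls_scaleDl : forall x a b,
    ls_eq (ls_scale (a + b) x) (ls_add (ls_scale a x) (ls_scale b x))
}.

Section SetoidQuotient.
Context {K : nzRingType} (P : lmodSetoid K).

Definition ls_rel : rel P := fun x y => `[< ls_eq x y >].

Lemma ls_rel_refl : reflexive ls_rel.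
Proof. by move=> x; apply/asboolP; exact: ls_refl. Qed.
Lemma ls_rel_sym : symmetric ls_rel.
Proof. by move=> x y; apply/asboolP/asboolP => /ls_sym. Qed.
Lemma ls_rel_trans : transitive ls_rel.
Proof.
by move=> x y z /asboolP yx /asboolP xz; apply/asboolP; exact: ls_trans yx xz.
Qed.
Canonical ls_equiv := EquivRel ls_rel ls_rel_refl ls_rel_sym ls_rel_trans.

Definition lquot := {eq_quot ls_equiv}%qT.
HB.instance Definition _ := Choice.on lquot.

Definition lclass (x : P) : lquot := (\pi_lquot x)%qT.
Definition lrepr (q : lquot) : P := repr q.

Lemma lreprK q : lclass (lrepr q) = q.
Proof. exact: reprK. Qed.

Lemma lclassP x y : lclass x = lclass y <-> ls_eq x y.
Proof.
split=> [h|h]; last by apply/eqquotP/asboolP.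
by have /eqquotP/asboolP := h.
Qed.

Lemma lreprP x : ls_eq (lrepr (lclass x)) x.
Proof. by apply/lclassP; rewrite lreprK. Qed.

Definition lq_zero : lquot := lclass (ls_zero P).
Definition lq_add (q r : lquot) : lquot := lclass (ls_add (lrepr q) (lrepr r)).
Definition lq_scale a (q : lquot) : lquot := lclass (ls_scale a (lrepr q)).
Definition lq_opp (q : lquot) : lquot := lq_scale (-1) q.

Lemma lq_addE x y : lq_add (lclass x) (lclass y) = lclass (ls_add x y).
Proof. by apply/lclassP; apply: ls_add_eq; exact: lreprP. Qed.

Lemma lq_scaleE a x : lq_scale a (lclass x) = lclass (ls_scale a x).
Proof. by apply/lclassP; apply: ls_scale_eq; exact: lreprP. Qed.

Lemma lq_addA : associative lq_add.
Proof.
move=> q r s; rewrite -(lreprK q) -(lreprK r) -(lreprK s) !lq_addE.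
by apply/lclassP; exact: ls_addA.
Qed.

Lemma lq_addC : commutative lq_add.
Proof.
move=> q r; rewrite -(lreprK q) -(lreprK r) !lq_addE.
by apply/lclassP; exact: ls_addC.
Qed.

Lemma lq_add0 : left_id lq_zero lq_add.
Proof.
by move=> q; rewrite -(lreprK q) lq_addE; apply/lclassP; exact: ls_add0.
Qed.

Lemma lq_addN : left_inverse lq_zero lq_opp lq_add.
Proof.
move=> q; rewrite -(lreprK q) /lq_opp lq_scaleE lq_addE.
by apply/lclassP; exact: ls_addN.
Qed.

HB.instance Definition _ :=
  GRing.isZmodule.Build lquot lq_addA lq_addC lq_add0 lq_addN.

Lemma lq_scaleA a b q : lq_scale a (lq_scale b q) = lq_scale (a * b) q.
Proof.
by rewrite -(lreprK q) !lq_scaleE; apply/lclassP; exact: ls_scaleA.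
Qed.

Lemma lq_scale1 : left_id 1 lq_scale.
Proof.
by move=> q; rewrite -(lreprK q) lq_scaleE; apply/lclassP; exact: ls_scale1.
Qed.

Lemma lq_scaleDr : right_distributive lq_scale +%R.
Proof.
move=> a q r; rewrite -(lreprK q) -(lreprK r) [LHS](congr1 _ (lq_addE _ _)).
rewrite !lq_scaleE [RHS]lq_addE; apply/lclassP; exact: ls_scaleDr.
Qed.

Lemma lq_scaleDl q : {morph lq_scale^~ q : a b / a + b}.
Proof.
move=> a b; rewrite -(lreprK q) !lq_scaleE [RHS]lq_addE.
by apply/lclassP; exact: ls_scaleDl.
Qed.

HB.instance Definition _ := GRing.Zmodule_isLmodule.Build K lquot
  lq_scaleA lq_scale1 lq_scaleDr lq_scaleDl.

Lemma lclassD x y : lclass (ls_add x y) = lclass x + lclass y.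
Proof. by rewrite [RHS]lq_addE. Qed.

Lemma lclassZ a x : lclass (ls_scale a x) = a *: lclass x.
Proof. by rewrite [RHS]lq_scaleE. Qed.

Lemma lclass0 : lclass (ls_zero P) = 0.
Proof. by []. Qed.

End SetoidQuotient.

(** Separated completion of a seminormed space: Cauchy sequences modulo null
    sequences. *)
Section Completion.
Context {R : realType} (W : lmodType (Cplx R)) (p : W -> R).
Local Notation C := (Cplx R).

Record is_seminorm : Prop := IsSeminorm {
  sn_ge0 : forall w, 0 <= p w;
  sn_add : forall v w, p (v + w) <= p v + p w;
  sn_scale : forall (a : C) w, p (a *: w) <= cmod a * p w
}.

Definition is_cauchy : {pred nat -> W} := fun u => `[< forall eps : R, 0 < eps ->
  exists n, forall i j, (n <= i)%N -> (n <= j)%N -> p (u i - u j) < eps >].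

Record cauchySeq := CauchySeq {
  cs_fun :> nat -> W;
  csP : cs_fun \in is_cauchy
}.

HB.instance Definition _ := [isSub of cauchySeq for cs_fun].
HB.instance Definition _ := [Choice of cauchySeq by <:].

Definition cs_eq (u v : cauchySeq) : Prop := forall eps : R, 0 < eps ->
  exists n, forall i, (n <= i)%N -> p (u i - v i) < eps.

Hypothesis hp : is_seminorm.

Lemma sn_zero : p 0 = 0.
Proof.
apply/eqP; rewrite eq_le sn_ge0 // andbT.
by rewrite -(scale0r 0); apply: le_trans (sn_scale hp _ _) _; rewrite cmod0 mul0r.
Qed.

Lemma sn_opp w : p (- w) = p w.
Proof.
have le v : p (- v) <= p v.
  by rewrite -scaleN1r; apply: le_trans (sn_scale hp _ _) _; rewrite cmodN cmod1 mul1r.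
by apply/eqP; rewrite eq_le le /= -[X in p X <= _]opprK le.
Qed.

Lemma is_cauchyD u v : u \in is_cauchy -> v \in is_cauchy ->
  (fun k => u k + v k) \in is_cauchy.
Proof.
move=> /asboolP cu /asboolP cv; apply/asboolP => e e0.
have e2 : 0 < e / 2 by rewrite divr_gt0.
have [n Hn] := cu _ e2; have [m Hm] := cv _ e2.
exists (maxn n m) => i j; rewrite !geq_max => /andP[ni mi] /andP[nj mj].
rewrite opprD addrACA; apply: le_lt_trans (sn_add hp _ _) _.
by rewrite [ltRHS](splitr e) ltrD ?Hn ?Hm.
Qed.

Lemma is_cauchyZ a u : u \in is_cauchy -> (fun k => a *: u k) \in is_cauchy.
Proof.
move=> /asboolP cu; apply/asboolP => e e0.
have a1 : 0 < cmod a + 1 by rewrite ltr_wpDl ?cmod_ge0.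
have [n Hn] := cu _ (divr_gt0 e0 a1); exists n => i j ni nj.
have := Hn i j ni nj; rewrite ltr_pdivlMr // => h; apply: le_lt_trans h.
rewrite -scalerBr; apply: le_trans (sn_scale hp _ _) _.
by rewrite mulrC ler_wpM2l ?sn_ge0 // lerDl.
Qed.

Lemma is_cauchy_cst w : (fun=> w) \in is_cauchy.
Proof. by apply/asboolP => e e0; exists 0%N => i j _ _; rewrite subrr sn_zero. Qed.

Definition cs_add (u v : cauchySeq) := CauchySeq (is_cauchyD (csP u) (csP v)).
Definition cs_scale a (u : cauchySeq) := CauchySeq (is_cauchyZ a (csP u)).
Definition cs_cst w := CauchySeq (is_cauchy_cst w).

Lemma cs_eq_pw (u v : cauchySeq) : (forall k, u k = v k) -> cs_eq u v.
Proof. by move=> uv e e0; exists 0%N => i _; rewrite uv subrr sn_zero. Qed.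

Lemma cs_eq_sym u v : cs_eq u v -> cs_eq v u.
Proof.
move=> uv e /uv [n Hn]; exists n => i /Hn.
by rewrite -opprB sn_opp.
Qed.

Lemma cs_eq_trans u v w : cs_eq u v -> cs_eq v w -> cs_eq u w.
Proof.
move=> uv vw e e0; have e2 : 0 < e / 2 by rewrite divr_gt0.
have [n Hn] := uv _ e2; have [m Hm] := vw _ e2.
exists (maxn n m) => i; rewrite geq_max => /andP[ni mi].
rewrite -(subrKA (v i)); apply: le_lt_trans (sn_add hp _ _) _.
by rewrite [ltRHS](splitr e) ltrD ?Hn ?Hm.
Qed.

Lemma cs_add_eq u u' v v' :
  cs_eq u u' -> cs_eq v v' -> cs_eq (cs_add u v) (cs_add u' v').
Proof.
move=> uv vw e e0; have e2 : 0 < e / 2 by rewrite divr_gt0.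
have [n Hn] := uv _ e2; have [m Hm] := vw _ e2.
exists (maxn n m) => i; rewrite geq_max => /andP[ni mi] /=.
rewrite opprD addrACA; apply: le_lt_trans (sn_add hp _ _) _.
by rewrite [ltRHS](splitr e) ltrD ?Hn ?Hm.
Qed.

Lemma cs_scale_eq a u u' : cs_eq u u' -> cs_eq (cs_scale a u) (cs_scale a u').
Proof.
move=> uu e e0; have a1 : 0 < cmod a + 1 by rewrite ltr_wpDl ?cmod_ge0.
have [n Hn] := uu _ (divr_gt0 e0 a1); exists n => i ni /=.
have := Hn i ni; rewrite ltr_pdivlMr // => h; apply: le_lt_trans h.
rewrite -scalerBr; apply: le_trans (sn_scale hp _ _) _.
by rewrite mulrC ler_wpM2l ?sn_ge0 // lerDl.
Qed.

Definition completion_setoid : lmodSetoid C.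
Proof.
apply: (@LmodSetoid C cauchySeq cs_eq (cs_cst 0) cs_add cs_scale).
- by move=> u; exact: cs_eq_pw.
- exact: cs_eq_sym.
- exact: cs_eq_trans.
- exact: cs_add_eq.
- exact: cs_scale_eq.
- by move=> u v w; apply: cs_eq_pw => k /=; rewrite addrA.
- by move=> u v; apply: cs_eq_pw => k /=; rewrite addrC.
- by move=> u; apply: cs_eq_pw => k /=; rewrite add0r.
- by move=> u; apply: cs_eq_pw => k /=; rewrite scaleN1r addNr.
- by move=> a b u; apply: cs_eq_pw => k /=; rewrite scalerA.
- by move=> u; apply: cs_eq_pw => k /=; rewrite scale1r.
- by move=> a u v; apply: cs_eq_pw => k /=; rewrite scalerDr.
- by move=> u a b; apply: cs_eq_pw => k /=; rewrite scalerDl.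
Defined.

Definition completion : lmodType C := lquot completion_setoid.

Definition completion_class (u : cauchySeq) : completion :=
  @lclass _ completion_setoid u.

Definition completion_repr (t : completion) : cauchySeq :=
  @lrepr _ completion_setoid t.

Definition completion_in (w : W) : completion := completion_class (cs_cst w).

Section Extension.
Variables (L : W -> W) (M : R).
Hypotheses (LB : forall v w, L (v - w) = L v - L w) (LM : forall w, p (L w) <= M * p w).

Lemma is_cauchy_map u : u \in is_cauchy -> (fun k => L (u k)) \in is_cauchy.
Proof.
move=> /asboolP cu; apply/asboolP => e e0.
have a1 : 0 < `|M| + 1 by rewrite ltr_wpDl.
have [n Hn] := cu _ (divr_gt0 e0 a1); exists n => i j ni nj.
have := Hn i j ni nj; rewrite ltr_pdivlMr // => h; apply: le_lt_trans h.
rewrite -LB; apply: le_trans (LM _) _.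
rewrite mulrC ler_wpM2l ?sn_ge0 //.
by apply: le_trans (ler_norm _) _; rewrite lerDl.
Qed.

Definition completion_map (t : completion) : completion :=
  completion_class (CauchySeq (is_cauchy_map (csP (completion_repr t)))).

End Extension.

End Completion.

(** The properties of matrix norms from which the triangle inequality for the
    Haagerup seminorm follows. They are not a definition of operator spaces: they are
    proved below for C_0(Y) ([C0_matrix_norm]) and for every operator module
    ([om_matrix_norm]). *)
Record is_matrix_norm (R : realType) (V : lmodType (Cplx R))
    (N : forall m n, 'M[V]_(m, n) -> R) : Prop := IsMatrixNorm {
  mxn_ge0 : forall m n (F : 'M[V]_(m, n)), 0 <= N m n F;
  mxn_scale : forall m n a (F : 'M[V]_(m, n)),
    N m n (map_mx ( *:%R a) F) <= cmod a * N m n F;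
  mxn_row : forall m n n' (F : 'M[V]_(m, n)) (G : 'M[V]_(m, n')),
    N m (n + n')%N (row_mx F G) ^+ 2 <= N m n F ^+ 2 + N m n' G ^+ 2;
  mxn_col : forall m m' n (F : 'M[V]_(m, n)) (G : 'M[V]_(m', n)),
    N (m + m')%N n (col_mx F G) ^+ 2 <= N m n F ^+ 2 + N m' n G ^+ 2
}.

Section C0Norm.
Context {R : realType} {Y : topologicalType}.
Local Notation C := (Cplx R).

(** Supremum over [y] of the operator norm of the scalar matrix [G(y)], i.e. the norm
    of M_{m,n}(C_0(Y)). *)
Definition C0_norm m n (G : 'M[C0 R Y]_(m, n)) : R :=
  sup [set r | exists y, r = opnorm (@cmod R) (fun i j (z : C^o) => G i j y * z)].

Let cm0 (z : C^o) : 0 <= cmod (z : C). Proof. exact: cmod_ge0. Qed.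
Let cmD (z w : C^o) : cmod (z + w : C) <= cmod (z : C) + cmod (w : C).
Proof. exact: cmodD. Qed.
Let cmZ (a : C) (z : C^o) : cmod (a *: z : C) = cmod a * cmod (z : C).
Proof. exact: cmodM. Qed.

Lemma C0_fiber_bounded (g : C0 R Y) (y : Y) :
  bounded_linear (@cmod R) (fun z : C^o => g y * z).
Proof.
split; last by exists (cmod (g y)) => z; rewrite cmodM.
by move=> a z w /=; rewrite mulrDr; congr (_ + _); exact: mulrCA.
Qed.

Lemma C0_norm_ubound m n (G : 'M[C0 R Y]_(m, n)) :
  has_ubound [set r | exists y, r = opnorm (@cmod R) (fun i j (z : C^o) => G i j y * z)].
Proof.
have /choice [B HB] : forall ij : 'I_m * 'I_n, exists B, 0 <= B /\
    forall y, cmod (G ij.1 ij.2 y) <= B.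
  by move=> [i j]; have [B B0 HB] := is_C0_bounded (C0P (G i j)); exists B.
have S0 : 0 <= \sum_i \sum_j B (i, j).
  by apply: sumr_ge0 => i _; apply: sumr_ge0 => j _; case: (HB (i, j)).
exists (\sum_i \sum_j B (i, j)) => r [y ->].
apply: opnorm_le => // xi.
apply: (mxapp_bound cm0 cmD cmZ (B := fun i j => B (i, j))) => [i j|i j x].
  by case: (HB (i, j)).
by rewrite cmodM ler_wpM2r ?cmod_ge0 //; case: (HB (i, j)).
Qed.

Lemma C0_norm_ge0 m n (G : 'M[C0 R Y]_(m, n)) : 0 <= C0_norm G.
Proof. by apply: sup_nneg => r [y ->]; exact: opnorm_ge0. Qed.

Lemma opnorm_le_C0_norm m n (G : 'M[C0 R Y]_(m, n)) y :
  opnorm (@cmod R) (fun i j (z : C^o) => G i j y * z) <= C0_norm G.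
Proof. by apply: ub_le_sup; [exact: C0_norm_ubound|exists y]. Qed.

Lemma C0_norm_le m n (G : 'M[C0 R Y]_(m, n)) M : 0 <= M ->
  (forall y, opnorm (@cmod R) (fun i j (z : C^o) => G i j y * z) <= M) ->
  C0_norm G <= M.
Proof. by move=> M0 GM; apply: sup_le_nneg => // r [y ->]. Qed.

Lemma C0_norm_mulr m n (G : 'M[C0 R Y]_(m, n)) (c : C0 R Y) M : 0 <= M ->
  (forall y, cmod (c y) <= M) ->
  C0_norm (map_mx (@C0_mul R Y ^~ c) G) <= M * C0_norm G.
Proof.
move=> M0 cM; apply: C0_norm_le => [|y]; first by rewrite mulr_ge0 ?C0_norm_ge0.
apply: (@le_trans _ _ (cmod (c y) *
    opnorm (@cmod R) (fun i j (z : C^o) => G i j y * z))).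
  apply: (opnorm_scale cm0 cmD cmZ) => [i j z|i j]; last exact: C0_fiber_bounded.
  by rewrite mxE /=; change (G i j y * c y * z = c y * (G i j y * z)); ring.
apply: ler_pM; rewrite ?cmod_ge0 ?opnorm_ge0 //.
exact: opnorm_le_C0_norm.
Qed.

Lemma C0_matrix_norm : is_matrix_norm (@C0_norm).
Proof.
have sq a b : 0 <= a ^+ 2 + b ^+ 2 :> R by rewrite addr_ge0 ?sqr_ge0.
split.
- exact: C0_norm_ge0.
- move=> m n a F; apply: C0_norm_le => [|y].
    by rewrite mulr_ge0 ?C0_norm_ge0 ?cmod_ge0.
  apply: (@le_trans _ _ (cmod a *
      opnorm (@cmod R) (fun i j (z : C^o) => F i j y * z))).
    apply: (opnorm_scale cm0 cmD cmZ) => [i j z|i j]; last exact: C0_fiber_bounded.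
    by rewrite mxE /=; change (a * F i j y * z = a * (F i j y * z)); ring.
  by rewrite ler_wpM2l ?cmod_ge0 ?opnorm_le_C0_norm.
- move=> m n n' F G; rewrite -[leRHS]sqr_sqrtr // ler_sqr ?nnegrE ?C0_norm_ge0 ?sqrtr_ge0 //.
  apply: C0_norm_le => [|y]; first exact: sqrtr_ge0.
  apply: (opnorm_row cm0 cmD cmZ _ _ (fun i j => C0_fiber_bounded (F i j) y)
    (fun i j => C0_fiber_bounded (G i j) y)
    (opnorm_le_C0_norm F y) (opnorm_le_C0_norm G y)) => i j;
  by apply/funext => z; rewrite (row_mxEl, row_mxEr).
- move=> m m' n F G; rewrite -[leRHS]sqr_sqrtr // ler_sqr ?nnegrE ?C0_norm_ge0 ?sqrtr_ge0 //.
  apply: C0_norm_le => [|y]; first exact: sqrtr_ge0.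
  apply: (opnorm_col cm0 cmD cmZ _ _ (fun i j => C0_fiber_bounded (F i j) y)
    (fun i j => C0_fiber_bounded (G i j) y)
    (opnorm_le_C0_norm F y) (opnorm_le_C0_norm G y)) => i j;
  by apply/funext => z; rewrite (col_mxEu, col_mxEd).
Qed.

End C0Norm.

Section MatrixNormedModules.
Variable R : realType.
Local Notation C := (Cplx R).

(** A right C_0(X)-module with matrix norms, as bare data: what is needed to say that
    a map is a morphism of operator modules. *)
Record mnModule (X : topologicalType) := MnModule {
  mn_car :> lmodType C;
  mn_norm : forall m n, 'M[mn_car]_(m, n) -> R;
  mn_act : mn_car -> C0 R X -> mn_car
}.

(** The functor mu_* : same space, with C_0(X) acting through mu^*. *)
Definition restrict (X Y : topologicalType) (mu : properMap Y X) (V : mnModule Y) :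
    mnModule X :=
  @MnModule X V (@mn_norm Y V) (fun e a => mn_act e (C0_pull mu a)).

Definition completely_bounded (X : topologicalType) (V W : mnModule X) (t : V -> W) :=
  exists M : R, forall n (F : 'M[V]_n), mn_norm (map_mx t F) <= M * mn_norm F.

Definition module_linear (X : topologicalType) (V W : mnModule X) (t : V -> W) :=
  linear t /\ forall e a, t (mn_act e a) = mn_act (t e) a.

Definition OM_morphism (X : topologicalType) (V W : mnModule X) (t : V -> W) :=
  module_linear t /\ completely_bounded t.

Definition OM_isomorphism (X : topologicalType) (V W : mnModule X) (t : V -> W) :=
  OM_morphism t /\ exists s : W -> V, [/\ OM_morphism s, cancel t s & cancel s t].

End MatrixNormedModules.


(** nu^* V = V (x)^h_{C_0(X)} C_0(Y) for [nu : Y -> X]. *)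
Section Haagerup.
Context {R : realType} {X Y : topologicalType}.
Local Notation C := (Cplx R).
Variables (nu : properMap Y X) (V : mnModule R X).

Definition formal_sum : choiceType := seq (V * C0 R Y).

(** The congruence on formal sums of elementary tensors whose quotient is the
    algebraic balanced tensor product over C_0(X). *)
Inductive tensor_eq : formal_sum -> formal_sum -> Prop :=
| teq_refl s : tensor_eq s s
| teq_sym s t : tensor_eq s t -> tensor_eq t s
| teq_trans s t u : tensor_eq s t -> tensor_eq t u -> tensor_eq s u
| teq_cat s s' t t' :
    tensor_eq s s' -> tensor_eq t t' -> tensor_eq (s ++ t) (s' ++ t')
| teq_comm s t : tensor_eq (s ++ t) (t ++ s)
| teq_zero b : tensor_eq [:: (0, b)] [::]
| teq_addl e e' b : tensor_eq [:: (e + e', b)] [:: (e, b); (e', b)]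
| teq_addr e b b' : tensor_eq [:: (e, b + b')] [:: (e, b); (e, b')]
| teq_scale (z : C) e b : tensor_eq [:: (z *: e, b)] [:: (e, z *: b)]
| teq_bal e (a : C0 R X) b :
    tensor_eq [:: (mn_act e a, b)] [:: (e, C0_mul (C0_pull nu a) b)].



Definition fs_scale (z : C) (s : formal_sum) : formal_sum :=
  [seq (z *: x.1, x.2) | x <- s].

Lemma teq_scalel z s t : tensor_eq s t -> tensor_eq (fs_scale z s) (fs_scale z t).
Proof.
elim=> {s t} /=.
- by move=> s; exact: teq_refl.
- by move=> s t _; exact: teq_sym.
- by move=> s t u _ h1 _; exact: teq_trans h1.
- by move=> s s' t t' _ h1 _ h2; rewrite /fs_scale !map_cat; exact: teq_cat.
- by move=> s t; rewrite /fs_scale !map_cat; exact: teq_comm.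
- by move=> b; rewrite scaler0; exact: teq_zero.
- by move=> e e' b; rewrite scalerDr; exact: teq_addl.
- by move=> e b b'; exact: teq_addr.
- move=> w e b; rewrite scalerA mulrC -scalerA; exact: teq_scale.
- move=> e a b; apply: teq_trans (teq_scale _ _ _) _.
  apply: teq_trans (teq_bal _ _ _) _.
  have -> : C0_mul (C0_pull nu a) (z *: b) = z *: C0_mul (C0_pull nu a) b.
    by apply/val_inj/funext => y /=; exact: mulrCA.
  exact/teq_sym/teq_scale.
Qed.

Lemma teq_ACA s t u v : tensor_eq ((s ++ t) ++ (u ++ v)) ((s ++ u) ++ (t ++ v)).
Proof.
rewrite -!catA; apply: teq_cat; first exact: teq_refl.
by rewrite !catA; apply: teq_cat; [exact: teq_comm|exact: teq_refl].
Qed.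

Lemma teq_scaleDl z w s : tensor_eq (fs_scale (z + w) s) (fs_scale z s ++ fs_scale w s).
Proof.
elim: s => [|[e b] s IH] /=; first exact: teq_refl.
apply: (teq_trans _ (teq_ACA [:: (z *: e, b)] [:: (w *: e, b)] _ _)).
rewrite -cat1s; apply: teq_cat => //; rewrite scalerDl; exact: teq_addl.
Qed.

Lemma teq_addN s : tensor_eq (fs_scale (-1) s ++ s) [::].
Proof.
elim: s => [|[e b] s IH]; first exact: teq_refl.
apply: (teq_trans (teq_ACA [:: (-1 *: e, b)] (fs_scale (-1) s) [:: (e, b)] s)).
rewrite -[[::]]/([::] ++ [::]); apply: teq_cat => //.
apply: teq_trans (teq_sym (teq_addl _ _ _)) _.
by rewrite scaleN1r addNr; exact: teq_zero.
Qed.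

Definition tensor_setoid : lmodSetoid C.
Proof.
apply: (@LmodSetoid C formal_sum tensor_eq [::] cat fs_scale).
- exact: teq_refl.
- exact: teq_sym.
- exact: teq_trans.
- by move=> s s' t t'; exact: teq_cat.
- by move=> z s t; exact: teq_scalel.
- by move=> s t u; rewrite catA; exact: teq_refl.
- exact: teq_comm.
- exact: teq_refl.
- exact: teq_addN.
- move=> z w s; rewrite /fs_scale -map_comp.
  rewrite (eq_map (g := fun x => ((z * w) *: x.1, x.2))); first exact: teq_refl.
  by move=> x /=; rewrite scalerA.
- move=> s; rewrite /fs_scale (eq_map (g := id)) ?map_id; first exact: teq_refl.
  by case=> e b /=; rewrite scale1r.
- by move=> z s t; rewrite /fs_scale map_cat; exact: teq_refl.
- by move=> s z w; exact: teq_scaleDl.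
Defined.

Definition tensor : lmodType C := lquot tensor_setoid.

Definition tclass (s : formal_sum) : tensor := @lclass _ tensor_setoid s.

Definition tens (e : V) (b : C0 R Y) : tensor := tclass [:: (e, b)].

Lemma tclassP s t : tclass s = tclass t <-> tensor_eq s t.
Proof. exact: (@lclassP _ tensor_setoid). Qed.

Lemma tclassD s t : tclass (s ++ t) = tclass s + tclass t.
Proof. exact: (@lclassD _ tensor_setoid). Qed.

Lemma tclassZ z s : tclass (fs_scale z s) = z *: tclass s.
Proof. exact: (@lclassZ _ tensor_setoid). Qed.

Lemma tclass_sum s : tclass s = \sum_(x <- s) tens x.1 x.2.
Proof.
elim: s => [|x s IH]; first by rewrite big_nil.
by rewrite big_cons -IH -cat1s tclassD; case: x.
Qed.

Lemma tensZl z e b : tens (z *: e) b = z *: tens e b.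
Proof. by rewrite -tclassZ. Qed.

Lemma tensZ z e b : tens (z *: e) b = tens e (z *: b).
Proof. by apply/tclassP; exact: teq_scale. Qed.

Definition odot m n k (D : 'M[V]_(m, k)) (G : 'M[C0 R Y]_(k, n)) : 'M[tensor]_(m, n) :=
  \matrix_(i, j) \sum_l tens (D i l) (G l j).

Definition haagerup_norm m n (F : 'M[tensor]_(m, n)) : R :=
  inf [set r | exists k (D : 'M[V]_(m, k)) (G : 'M[C0 R Y]_(k, n)),
    F = odot D G /\ r = mn_norm D * C0_norm G].

Definition haagerup_seminorm (w : tensor) : R :=
  haagerup_norm (const_mx w : 'M_(1, 1)).

Hypothesis hV : is_matrix_norm (@mn_norm R X V).

Lemma haagerup_has_inf (w : tensor) :
  has_inf [set r | exists k (D : 'M[V]_(1, k)) (G : 'M[C0 R Y]_(k, 1)),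
    const_mx w = odot D G /\ r = mn_norm D * C0_norm G].
Proof.
split; last first.
  exists 0 => r [k [D [G [_ ->]]]].
  by rewrite mulr_ge0 ?(mxn_ge0 hV) ?C0_norm_ge0.
pose s : formal_sum := @lrepr _ tensor_setoid w.
pose D : 'M[V]_(1, size s) := \row_l (tnth (in_tuple s) l).1.
pose G : 'M[C0 R Y]_(size s, 1) := \col_l (tnth (in_tuple s) l).2.
exists (mn_norm D * C0_norm G), (size s), D, G; split=> //.
apply/matrixP => i j; rewrite !mxE.
have -> : w = tclass s by rewrite /tclass lreprK.
rewrite tclass_sum big_tnth; apply: eq_bigr => l _.
by rewrite !mxE.
Qed.

Lemma haagerup_le (w : tensor) k (D : 'M[V]_(1, k)) (G : 'M[C0 R Y]_(k, 1)) :
  const_mx w = odot D G -> haagerup_seminorm w <= mn_norm D * C0_norm G.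
Proof.
move=> wDG; apply: ge_inf; first by case: (haagerup_has_inf w).
by exists k, D, G.
Qed.

Lemma haagerup_adherent (w : tensor) e : haagerup_seminorm w < e ->
  exists k (D : 'M[V]_(1, k)) (G : 'M[C0 R Y]_(k, 1)),
    const_mx w = odot D G /\ mn_norm D * C0_norm G < e.
Proof.
move=> we; have e0 : 0 < e - haagerup_seminorm w by rewrite subr_gt0.
have [r [k [D [G [wDG ->]]]]] := inf_adherent e0 (haagerup_has_inf w).
by rewrite -/(haagerup_norm _) -/(haagerup_seminorm _) subrKC => h; exists k, D, G.
Qed.

Lemma haagerup_ge0 (w : tensor) : 0 <= haagerup_seminorm w.
Proof.
apply: lb_le_inf; first by case: (haagerup_has_inf w).
by move=> r [k [D [G [_ ->]]]]; rewrite mulr_ge0 ?(mxn_ge0 hV) ?C0_norm_ge0.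
Qed.

Lemma odot_scale m n k (D : 'M[V]_(m, k)) (G : 'M[C0 R Y]_(k, n)) (t : C) : t != 0 ->
  odot (map_mx ( *:%R t) D) (map_mx ( *:%R t^-1) G) = odot D G.
Proof.
move=> t0; apply/matrixP => i j; rewrite !mxE; apply: eq_bigr => l _.
by rewrite !mxE tensZ scalerA divff // scale1r.
Qed.

Lemma haagerup_balanced (w : tensor) e : haagerup_seminorm w < e ->
  exists k (D : 'M[V]_(1, k)) (G : 'M[C0 R Y]_(k, 1)),
    [/\ const_mx w = odot D G, mn_norm D ^+ 2 <= e & C0_norm G ^+ 2 <= e].
Proof.
move=> we; have e0 : 0 < e by apply: le_lt_trans we; exact: haagerup_ge0.
have [k [D [G [wDG DGe]]]] := haagerup_adherent we.
have d0 : 0 <= mn_norm D := mxn_ge0 hV D.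
have g0 : 0 <= C0_norm G := C0_norm_ge0 G.
set d := mn_norm D in d0 DGe *; set g := C0_norm G in g0 DGe *.
have [d' [dd' d'0 d'g]] : exists d', [/\ d <= d', 0 < d' & d' * g <= e].
  have [d00|dn0] := eqVneq d 0; last first.
    by exists d; split=> //; [rewrite lt_neqAle eq_sym dn0|exact: ltW].
  have g1 : 0 < g + 1 by rewrite ltr_wpDl.
  exists (e / (g + 1)); rewrite d00 divr_ge0 ?(ltW e0) ?(ltW g1) // divr_gt0 //.
  by split=> //; rewrite mulrAC ler_pdivrMr // ler_wpM2l ?lerDl ?ltW.
have se : 0 < Num.sqrt e by rewrite sqrtr_gt0.
pose t : R := Num.sqrt e / d'.
have t0 : 0 < t by rewrite divr_gt0.
have t0' : (t%:C%C : C) != 0 by rewrite gt_eqF // ltcR.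
exists k, (map_mx ( *:%R (t%:C%C : C)) D), (map_mx ( *:%R (t%:C%C : C)^-1) G).
split; first by rewrite odot_scale.
  rewrite -[leRHS](sqr_sqrtr (ltW e0)) ler_sqr ?nnegrE ?(mxn_ge0 hV) ?sqrtr_ge0 //.
  apply: le_trans (mxn_scale hV _ _) _; rewrite cmodR gtr0_norm //.
  by rewrite -/d /t mulrAC ler_pdivrMr // ler_wpM2l ?sqrtr_ge0.
rewrite -[leRHS](sqr_sqrtr (ltW e0)) ler_sqr ?nnegrE ?C0_norm_ge0 ?sqrtr_ge0 //.
apply: le_trans (mxn_scale C0_matrix_norm _ _) _.
have -> : ((t%:C%C : C)^-1) = ((t^-1)%:C%C : C) by rewrite -fmorphV.
rewrite cmodR ger0_norm ?invr_ge0 ?(ltW t0) //.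
rewrite -/g /t invf_div mulrAC ler_pdivrMr //.
by rewrite -expr2 sqr_sqrtr // ltW.
Qed.

Lemma haagerup_is_seminorm : is_seminorm haagerup_seminorm.
Proof.
split; first exact: haagerup_ge0.
- move=> v w; apply/ler_addgt0Pr => e e0.
  have e2 : 0 < e / 2 by rewrite divr_gt0.
  have hv : haagerup_seminorm v < haagerup_seminorm v + e / 2 by rewrite ltrDl.
  have hw : haagerup_seminorm w < haagerup_seminorm w + e / 2 by rewrite ltrDl.
  have [k [D [G [vDG hD hG]]]] := haagerup_balanced hv.
  have [k' [D' [G' [wDG hD' hG']]]] := haagerup_balanced hw.
  have E : const_mx (v + w) = odot (row_mx D D') (col_mx G G').
    apply/matrixP => i j; rewrite !mxE big_split_ord /=.
    move/matrixP/(_ i j): vDG; rewrite !mxE => ->.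
    move/matrixP/(_ i j): wDG; rewrite !mxE => ->.
    by congr (_ + _); apply: eq_bigr => l _; rewrite ?row_mxEl ?col_mxEu ?row_mxEr ?col_mxEd.
  apply: le_trans (haagerup_le E) _.
  set h := leRHS; have hE : h = (haagerup_seminorm v + e / 2) + (haagerup_seminorm w + e / 2).
    by rewrite addrACA -splitr.
  have h0 : 0 <= h by rewrite !addr_ge0 ?haagerup_ge0 ?ltW.
  rewrite -[leRHS]sqr_sqrtr // expr2; apply: ler_pM.
  + exact: mxn_ge0.
  + exact: C0_norm_ge0.
  + rewrite -(@ler_sqr R) ?nnegrE ?sqrtr_ge0 ?(mxn_ge0 hV) // sqr_sqrtr // hE.
    by apply: le_trans (mxn_row hV _ _) _; exact: lerD.
  + rewrite -(@ler_sqr R) ?nnegrE ?sqrtr_ge0 ?C0_norm_ge0 // sqr_sqrtr // hE.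
    by apply: le_trans (mxn_col C0_matrix_norm _ _) _; exact: lerD.
- move=> z w; apply/ler_addgt0Pr => e e0.
  have z1 : 0 < cmod z + 1 by rewrite ltr_wpDl ?cmod_ge0.
  have hw : haagerup_seminorm w < haagerup_seminorm w + e / (cmod z + 1).
    by rewrite ltrDl divr_gt0.
  have [k [D [G [wDG hDG]]]] := haagerup_adherent hw.
  have E : const_mx (z *: w) = odot (map_mx ( *:%R z) D) G.
    apply/matrixP => i j; rewrite !mxE.
    move/matrixP/(_ i j): wDG; rewrite !mxE => ->.
    by rewrite scaler_sumr; apply: eq_bigr => l _; rewrite mxE tensZl.
  apply: le_trans (haagerup_le E) _.
  apply: (@le_trans _ _ (cmod z * (mn_norm D * C0_norm G))).
    by rewrite mulrA ler_wpM2r ?C0_norm_ge0 // (mxn_scale hV).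
  apply: le_trans (ler_wpM2l (cmod_ge0 z) (ltW hDG)) _.
  rewrite mulrDr lerD2l mulrA ler_pdivrMr // mulrC ler_wpM2l ?ltW //.
  by rewrite ltrDl.
Qed.

Definition fs_act (c : C0 R Y) (s : formal_sum) : formal_sum :=
  [seq (x.1, C0_mul x.2 c) | x <- s].

Lemma teq_act c s t : tensor_eq s t -> tensor_eq (fs_act c s) (fs_act c t).
Proof.
elim=> {s t} /=.
- by move=> s; exact: teq_refl.
- by move=> s t _; exact: teq_sym.
- by move=> s t u _ h1 _; exact: teq_trans h1.
- by move=> s s' t t' _ h1 _ h2; rewrite /fs_act !map_cat; exact: teq_cat.
- by move=> s t; rewrite /fs_act !map_cat; exact: teq_comm.
- by move=> b; exact: teq_zero.
- by move=> e e' b; exact: teq_addl.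
- move=> e b b'; have -> : C0_mul (b + b') c = C0_mul b c + C0_mul b' c.
    by apply/val_inj/funext => y /=; exact: mulrDl.
  exact: teq_addr.
- move=> z e b; have -> : C0_mul (z *: b) c = z *: C0_mul b c.
    by apply/val_inj/funext => y /=; exact/esym/mulrA.
  exact: teq_scale.
- move=> e a b.
  have -> : C0_mul (C0_mul (C0_pull nu a) b) c = C0_mul (C0_pull nu a) (C0_mul b c).
    by apply/val_inj/funext => y /=; exact/esym/mulrA.
  exact: teq_bal.
Qed.

Definition tensor_act (c : C0 R Y) (w : tensor) : tensor :=
  tclass (fs_act c (@lrepr _ tensor_setoid w)).

Lemma tensor_act_class c s : tensor_act c (tclass s) = tclass (fs_act c s).
Proof. by apply/tclassP/teq_act; exact: (@lreprP _ tensor_setoid). Qed.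

Lemma tclassK w : tclass (@lrepr _ tensor_setoid w) = w.
Proof. exact: (@lreprK _ tensor_setoid). Qed.

Lemma tensor_actD c v w : tensor_act c (v + w) = tensor_act c v + tensor_act c w.
Proof.
rewrite -(tclassK v) -(tclassK w) -tclassD !tensor_act_class -tclassD.
by rewrite /fs_act map_cat.
Qed.

Lemma tensor_actB c v w : tensor_act c (v - w) = tensor_act c v - tensor_act c w.
Proof. by rewrite -[X in _ = tensor_act c X - _](subrK w v) [in RHS]tensor_actD addrK. Qed.

Lemma tensor_act_tens c e b : tensor_act c (tens e b) = tens e (C0_mul b c).
Proof. exact: tensor_act_class. Qed.

Lemma tensor_act_sum c n (f : 'I_n -> tensor) :
  tensor_act c (\sum_l f l) = \sum_l tensor_act c (f l).
Proof.
have act0 : tensor_act c 0 = 0 by rewrite -[0 in LHS](subrr 0) tensor_actB subrr.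
exact: (big_morph _ (tensor_actD c) act0).
Qed.

Lemma tensor_act_bounded (c : C0 R Y) : exists M, forall w,
  haagerup_seminorm (tensor_act c w) <= M * haagerup_seminorm w.
Proof.
have [M M0 HM] := is_C0_bounded (C0P c); exists M => w.
apply/ler_addgt0Pr => e e0.
have M1 : 0 < M + 1 by rewrite ltr_wpDl.
have hw : haagerup_seminorm w < haagerup_seminorm w + e / (M + 1).
  by rewrite ltrDl divr_gt0.
have [k [D [G [wDG hDG]]]] := haagerup_adherent hw.
have E : const_mx (tensor_act c w) = odot D (map_mx (@C0_mul R Y ^~ c) G).
  apply/matrixP => i j; rewrite !mxE.
  move/matrixP/(_ i j): wDG; rewrite !mxE => ->.
  by rewrite tensor_act_sum; apply: eq_bigr => l _; rewrite mxE tensor_act_tens.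
apply: le_trans (haagerup_le E) _.
apply: (@le_trans _ _ (M * (mn_norm D * C0_norm G))).
  by rewrite mulrCA ler_wpM2l ?(mxn_ge0 hV) // C0_norm_mulr.
apply: le_trans (ler_wpM2l M0 (ltW hDG)) _.
rewrite mulrDr lerD2l mulrA ler_pdivrMr // mulrC ler_wpM2l ?ltW //.
by rewrite ltrDl.
Qed.

Definition haagerup_tensor : lmodType C := completion haagerup_is_seminorm.

(** Continuous extension of the Haagerup matrix seminorms to the completion; the
    limit does not depend on the chosen representatives. *)
Definition haagerup_tensor_norm m n (F : 'M[haagerup_tensor]_(m, n)) : R :=
  limn (fun k : nat =>
    haagerup_norm (\matrix_(i, j) completion_repr (F i j) k)).

(** The extension by continuity of (e (x) b) . c = e (x) bc. *)
Definition haagerup_tensor_act (t : haagerup_tensor) (c : C0 R Y) : haagerup_tensor :=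
  completion_map (tensor_actB c) (projT2 (cid (tensor_act_bounded c))) t.

Definition haagerup_module : mnModule R Y :=
  @MnModule R Y haagerup_tensor (@haagerup_tensor_norm) haagerup_tensor_act.

Definition htens (e : V) (b : C0 R Y) : haagerup_module :=
  completion_in haagerup_is_seminorm (tens e b).

End Haagerup.

Section OperatorModules.
Variable R : realType.
Local Notation C := (Cplx R).

Definition dot_norm (H : lmodType C) (dot : {dot H for Num.conj}) (x : H) : R :=
  Num.sqrt (complex.Re (dot x x)).

Record hilbert := Hilbert {
  hs_car :> lmodType C;
  hs_dot : {dot hs_car for Num.conj};
  hs_complete : forall u : nat -> hs_car,
    (forall eps : R, 0 < eps -> exists n, forall i j, (n <= i)%N -> (n <= j)%N ->
       dot_norm hs_dot (u i - u j) < eps) ->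
    exists l, forall eps : R, 0 < eps -> exists n, forall i, (n <= i)%N ->
       dot_norm hs_dot (u i - l) < eps
}.

Definition hnorm (H : hilbert) : H -> R := dot_norm (@hs_dot H).

Section HilbertNorm.
Variable H : hilbert.
Implicit Types x y : H.
Local Notation dot := (@hs_dot H).
Local Notation rdot x y := (complex.Re (dot x y)).

Lemma dot_self x : dot x x = (rdot x x)%:C%C.
Proof.
have := dnorm_ge0 dot x.
case: (dot x x) => a b; rewrite lecE => /andP[/eqP /= h _].
by congr (_ +i* _)%C.
Qed.

Lemma rdot_ge0 x : 0 <= rdot x x.
Proof. by have := dnorm_ge0 dot x; rewrite dot_self lecR. Qed.

Lemma hnorm_ge0 x : 0 <= hnorm x.
Proof. exact: sqrtr_ge0. Qed.

Lemma hnorm_sqr x : hnorm x ^+ 2 = rdot x x.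
Proof. by rewrite sqr_sqrtr // rdot_ge0. Qed.

Lemma rdotC x y : rdot x y = rdot y x.
Proof.
have -> : dot x y = Num.conj (dot y x) by rewrite hermC expr0 mul1r.
by case: (dot y x).
Qed.

Lemma rdotDl x y z : rdot (x + y) z = rdot x z + rdot y z.
Proof. by rewrite linearDl /=; case: (dot x z) => ? ?; case: (dot y z). Qed.

Lemma rdotZl (r : R) x y : rdot ((r%:C%C : C) *: x) y = r * rdot x y.
Proof. by rewrite linearZl_LR /=; case: (dot x y) => a b /=; rewrite mul0r subr0. Qed.

Lemma rdot_sqr (r : R) x y :
  rdot (x + (r%:C%C : C) *: y) (x + (r%:C%C : C) *: y) =
  rdot x x + 2 * r * rdot x y + r ^+ 2 * rdot y y.
Proof.
rewrite rdotDl rdotZl (rdotC x) (rdotC y) !rdotDl !rdotZl (rdotC y x).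
by ring.
Qed.

Lemma rdot_le x y : rdot x y <= hnorm x * hnorm y.
Proof.
apply: le_trans (ler_norm _) _.
rewrite -(@ler_sqr R) ?nnegrE ?mulr_ge0 ?hnorm_ge0 // exprMn !hnorm_sqr.
rewrite real_normK ?num_real //.
have Q r := rdot_ge0 (x + (r%:C%C : C) *: y).
have {}Q r : 0 <= rdot x x + 2 * r * rdot x y + r ^+ 2 * rdot y y.
  by rewrite -rdot_sqr.
have := rdot_ge0 y; have := rdot_ge0 x; move: Q.
move: (rdot x x) (rdot x y) (rdot y y) => a b c Q a0 c0.
have [c00|cn0] := eqVneq c 0.
  have [->|bn0] := eqVneq b 0; first by rewrite expr0n mulr_ge0.
  have := Q (- (a + 1) / (2 * b)); rewrite c00 mulr0 addr0.
  have -> : 2 * (- (a + 1) / (2 * b)) * b = - (a + 1) by field.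
  lra.
have cp : 0 < c by rewrite lt_neqAle eq_sym cn0.
have := Q (- b / c); have -> : a + 2 * (- b / c) * b + (- b / c) ^+ 2 * c =
  (a * c - b ^+ 2) / c by field.
by rewrite pmulr_lge0 ?invr_gt0 // subr_ge0.
Qed.

Lemma hnormD x y : hnorm (x + y) <= hnorm x + hnorm y.
Proof.
rewrite -(@ler_sqr R) ?nnegrE ?addr_ge0 ?hnorm_ge0 // sqrrD !hnorm_sqr.
have := rdot_sqr 1 x y; rewrite scale1r => ->; have := rdot_le x y; lra.
Qed.

Lemma hnormZ (a : C) x : hnorm (a *: x) = cmod a * hnorm x.
Proof.
rewrite /hnorm /dot_norm linearZl_LR linearZr_LR /= mulrA.
have -> : a * Num.conj a = ((cmod a) ^+ 2)%:C%C by rewrite -normCK cmodE rmorphXn.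
rewrite {1}dot_self -rmorphM /= sqrtrM ?sqr_ge0 // sqrtr_sqr ger0_norm //.
exact: cmod_ge0.
Qed.

End HilbertNorm.

Definition star_representation (X : topologicalType) (H : hilbert)
    (rep : C0 R X -> H -> H) : Prop :=
  [/\ forall a, bounded_linear (@hnorm H) (rep a),
      linear rep,
      forall a b x, rep (C0_mul a b) x = rep a (rep b x) &
      forall a x y, @hs_dot H (rep a x) y = @hs_dot H x (rep (C0_conj a) y)].

(** A nondegenerate right operator C_0(X)-module E in B(H). The closed subspace E is
    given as the image of the injective linear map [om_op] from a vector space
    [om_car], so that its elements form a type; C_0(X) is represented on H by
    [om_rep], and E . C_0(X) = E is [om_actE] (inclusion, with the product e.a named
    [om_act e a]) together with [om_nondegenerate]. *)
Record opModule (X : topologicalType) := OpModule {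
  om_car :> lmodType C;
  om_hilbert : hilbert;
  om_rep : C0 R X -> om_hilbert -> om_hilbert;
  om_op : om_car -> om_hilbert -> om_hilbert;
  om_act : om_car -> C0 R X -> om_car;
  om_repP : star_representation om_rep;
  om_bounded : forall e, bounded_linear (@hnorm om_hilbert) (om_op e);
  om_linear : linear om_op;
  om_inj : injective om_op;
  om_closed : forall T, bounded_linear (@hnorm om_hilbert) T ->
    (forall eps : R, 0 < eps ->
       exists e, forall x, hnorm (om_op e x - T x) <= eps * hnorm x) ->
    exists e, om_op e = T;
  om_actE : forall e a x, om_op (om_act e a) x = om_op e (om_rep a x);
  om_nondegenerate : forall e, exists e' a, e = om_act e' a
}.

Definition om_norm (X : topologicalType) (E : opModule X) m n (F : 'M[E]_(m, n)) : R :=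
  opnorm (@hnorm (om_hilbert E)) (fun i j => om_op (F i j)).

Definition om_module (X : topologicalType) (E : opModule X) : mnModule R X :=
  @MnModule R X E (@om_norm X E) (@om_act X E).

Lemma om_matrix_norm (X : topologicalType) (E : opModule X) :
  is_matrix_norm (@mn_norm R X (om_module E)).
Proof.
have h0 := @hnorm_ge0 (om_hilbert E).
have hD := @hnormD (om_hilbert E).
have hZ := @hnormZ (om_hilbert E).
split.
- by move=> m n F; exact: opnorm_ge0.
- move=> m n a F; apply: (opnorm_scale h0 hD hZ) => [i j x|i j]; last exact: om_bounded.
  have := @om_linear X E a (F i j) 0; rewrite !addr0 => h.
  rewrite mxE h.
  have -> : om_op (0 : E) = 0; last by rewrite addr0.
  by have := @om_linear X E (-1) 0 0; rewrite scaler0 addr0 scaleN1r addNr.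
- move=> m n n' F G; rewrite -[leRHS]sqr_sqrtr ?addr_ge0 ?sqr_ge0 //.
  rewrite ler_sqr ?nnegrE ?sqrtr_ge0 //; last exact: opnorm_ge0.
  apply: (opnorm_row h0 hD hZ _ _ (fun i j => om_bounded (F i j))
    (fun i j => om_bounded (G i j)) (lexx _) (lexx _)) => i j;
  by rewrite (row_mxEl, row_mxEr).
- move=> m m' n F G; rewrite -[leRHS]sqr_sqrtr ?addr_ge0 ?sqr_ge0 //.
  rewrite ler_sqr ?nnegrE ?sqrtr_ge0 //; last exact: opnorm_ge0.
  apply: (opnorm_col h0 hD hZ _ _ (fun i j => om_bounded (F i j))
    (fun i j => om_bounded (G i j)) (lexx _) (lexx _)) => i j;
  by rewrite (col_mxEu, col_mxEd).
Qed.

End OperatorModules.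

Section BeckChevalley.
Variables (R : realType) (X Y1 Y2 : topologicalType).
Hypothesis hX : hausdorff_space X.
Variables (mu1 : properMap Y1 X) (mu2 : properMap Y2 X).
Local Notation pi1 := (fibre_fst hX mu1 mu2).
Local Notation pi2 := (fibre_snd hX mu1 mu2).

Section Component.
Variable E : opModule R Y1.

(** The component at E of mu_2^* mu_{1*} -> pi_{2*} pi_1^* goes from [bc_source] to
    [bc_target]. *)
Definition bc_source : mnModule R Y2 :=
  haagerup_module mu2 (V := restrict mu1 (om_module E)) (om_matrix_norm E).

Definition bc_target : mnModule R Y2 :=
  restrict pi2 (haagerup_module pi1 (om_matrix_norm E)).

(** The right-hand side is e (x) pi_1^*(b) pi_2^*(c). As every element of E is of the
    form e.b, this formula prescribes [t] on all elementary tensors, hence determines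
    the bounded map [t]. *)
Definition is_base_change_map (t : bc_source -> bc_target) : Prop :=
  OM_morphism t /\
  forall (e : E) (b : C0 R Y1) (c : C0 R Y2),
    t (htens mu2 (V := restrict mu1 (om_module E)) (om_matrix_norm E) (om_act e b) c) =
    htens pi1 (om_matrix_norm E) e (C0_mul (C0_pull pi1 b) (C0_pull pi2 c)).

End Component.

(** A natural transformation is a natural isomorphism when each of its components is
    an isomorphism. *)
Definition beck_chevalley : Prop :=
  forall E : opModule R Y1,
    exists t, @is_base_change_map E t /\ OM_isomorphism t.

End BeckChevalley.

(* Main.v *)
Require Import Defs.
From HB Require Import structures.
From mathcomp Require Import all_boot all_order all_algebra.
From mathcomp Require Import finmap complex.
From mathcomp Require Import all_classical all_reals ereal topology normedtype sequences.
From mathcomp Require Import counting_measure realfun.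
From mathcomp Require Import ring lra.

Set Implicit Arguments.
Unset Strict Implicit.
Unset Printing Implicit Defensive.

Import Order.TTheory GRing.Theory Num.Theory.
Import numFieldNormedType.Exports.
Local Open Scope classical_set_scope.
Local Open Scope ring_scope.

(** Write Z for the fibre product of Y1 and Y2 over X. The target of base change at E is
    the tensor product of E with C_0(Z) over C_0(Y1), and its source is that of E with
    C_0(Y1) (x) C_0(Y2), balanced over C_0(X). Everything therefore depends on comparing,
    for a matrix W over C_0(Y1) (x) C_0(Y2), the Haagerup norm with the supremum norm of
    the function that W defines on Z ([fibre_fun]).

    Suppose first that over every x one of the two fibres has at most N points. If the
    first fibre is y_1, ..., y_m, and u_i are bump functions at these points, then near x
    the matrix W is sum_i u_i (x) W(y_i, .) up to a small error: a row of norm at most 1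
    times a column of norm at most sqrt m times the supremum of W. If the second fibre is
    the finite one, exchange the two factors ([local_factor_fst], [local_factor_snd]). The
    norms of both factors are determined pointwise, so a partition of unity on X glues the
    local factorizations without loss, and the Haagerup norm of W is at most a constant
    times its supremum norm ([global_factor]).

    A representation of C_0(Y1) is completely contractive ([repmx_contraction]), so the
    same constant bounds e . W for a matrix e over E ([modmulmx_bound]). The functions of
    tensors are dense in C_0(Z) ([fibre_fun_dense]); hence e (x) F can be mapped to the
    limit of e . W_k, where the functions of W_k tend to F, and this inverts base change
    ([inverse_tens_base_change]). Consequently base change is bounded below on matrices of
    tensors, its range is dense, and its extension to the completions is an isomorphism
    ([base_change_isomorphism]).

    Conversely, suppose that base change is an isomorphism for E = C_0(Y1), acting on
    l^2(Y1). Take n points in each of the two fibres over x, bump functions b_i and v_j at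
    them, and an n x n matrix A with entries of modulus at most 1. With
    chi = sum_i b_i, base change maps sum_ij A_ij chi b_i (x) v_j to an element of norm at
    most 1, so this tensor is bounded independently of n, and evaluation at the points
    factors A through matrices with rows and columns bounded independently of n
    ([iso_bounded_factorization]). For a Hadamard matrix this bounds n
    ([hadamard_factorization]). *)

(** * Functions vanishing at infinity on a locally compact space *)

Section RealC0.
Variables (R : realType) (X : topologicalType).
Local Notation C := (Cplx R).

Definition is_C0r (f : X -> R) : Prop := continuous f /\
  forall eps : R, 0 < eps ->
    exists2 K : set X, compact K & forall x, ~ K x -> `|f x| < eps.

(** The norm of C takes its values in C; this is convergence with real tolerances. *)
Lemma cvg_cmodP (T : Type) (F : set_system T) (FF : Filter F) (f : T -> C) (l : C) :
  f @ F --> l <-> forall e : R, 0 < e -> \forall x \near F, cmod (l - f x) < e.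
Proof.
split=> [/(@cvgrPdist_lt _ C^o) fl e e0|fl].
  have e0' : 0 < (e%:C%C : C) by rewrite ltcR.
  by apply: filterS (fl _ e0') => x; rewrite cmodE ltcR.
apply/(@cvgrPdist_lt _ C^o) => e e0.
have eE : e = (complex.Re e)%:C%C by have /ltW/ger0_Im := e0; case: (e) => a b /= ->.
have e0' : 0 < complex.Re e by move: e0; rewrite {1}eE ltcR.
by apply: filterS (fl _ e0') => x; rewrite {2}eE cmodE ltcR.
Qed.

Lemma realC_continuous : continuous (fun r : R => r%:C%C : C).
Proof.
move=> r; apply/cvg_cmodP => e e0.
have := @nbhsx_ballx _ R r _ e0.
rewrite -ball_normE; apply: filterS => w h.
change (cmod (r%:C%C - w%:C%C : C) < e).
by rewrite -rmorphB cmodR.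
Qed.

Lemma is_C0_real f : is_C0r f -> (fun x => (f x)%:C%C) \in @is_C0 R X.
Proof.
move=> [fc fv]; apply/is_C0P; split.
  by move=> x; apply: (continuous_comp (fc x)); exact: realC_continuous.
by move=> e /fv [K cK HK]; exists K => // x /HK; rewrite cmodR.
Qed.

Definition C0_real f (hf : is_C0r f) : C0 R X := MkC0 (is_C0_real hf).

End RealC0.

Section Urysohn.
Variables (R : realType) (X : topologicalType).
Hypotheses (hX : hausdorff_space X) (lX : locally_compact [set: X]).

(** In the one-point compactification, which is completely regular, p is separated
    from the closed set made of the point at infinity and the complement of U; vanishing
    at infinity comes for free. *)
Lemma urysohn_C0 (p : X) (U : set X) : nbhs p U ->
  exists f : X -> R, [/\ is_C0r f, forall x, 0 <= f x <= 1, f p = 1 &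
    forall x, ~ U x -> f x = 0].
Proof.
move=> /= nU.
pose opc := one_point_compactification X.
pose B : set opc := ~` (Some @` U^°).
have clB : closed B.
  rewrite closedC; apply: one_point_compactification_open_some; exact: open_interior.
have nB : ~ B (Some p).
  by move=> nBp; apply: nBp; exists p.
have /(@uniform_separatorP _ R) [g [gc g01 g0 g1]] :=
  @one_point_compactification_completely_reg X R lX hX (Some p) B clB nB.
have gB y : B y -> g y = 1 by move=> By; apply: g1; exists y.
have gp : g (Some p) = 0 by apply: g0; exists (Some p).
have gr y : 0 <= g y <= 1 by have := g01 (g y) (ex_intro2 _ _ y I erefl); rewrite /= in_itv.
have gN : g None = 1 by apply: gB => -[x _].
exists (fun x => 1 - g (Some x)); split.
- split.
    move=> x; apply: cvgB; first exact: cvg_cst.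
    exact: (@cvg_comp _ _ _ Some g _ _ _
      (@one_point_compactification_some_continuous X x) (gc (Some x))).
  move=> e e0.
  have [K [cK _] HK] : nbhs (None : opc) [set y | `|1 - g y| < e].
    have /(@cvgrPdist_lt _ R^o _ (nbhs (None : opc)) _) := gc None.
    by rewrite gN => /(_ _ e0).
  exists K => // x nK; have := HK (Some x); apply; left.
  by exists x.
- by move=> x; have := gr (Some x); lra.
- by rewrite gp subr0.
- move=> x nUx; rewrite gB ?subrr // => -[y Uy [yx]].
  by apply: nUx; rewrite -yx; exact: nbhs_singleton.
Qed.

End Urysohn.

Section FiniteCover.

(** Compactness as near-covering, along the filter of lists ordered by inclusion. *)
Lemma compact_finite_cover (X : topologicalType) (K : set X) (V : X -> set X) :
  compact K -> (forall p, K p -> nbhs p (V p)) ->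
  exists2 s : seq X, (forall p, p \in s -> K p) &
    forall x, K x -> exists2 p, p \in s & V p x.
Proof.
move=> /compact_near_coveringP cK VK.
pose F : set_system (seq X) :=
  filter_from setT (fun s : seq X => [set t : seq X | {subset s <= t}]).
have FF : Filter F.
  apply: filter_from_filter; first by exists [::].
  move=> s t _ _; exists (s ++ t) => // u su; split=> x xs; apply: su;
  by rewrite mem_cat xs ?orbT.
have Hc x : K x -> \near x & F, exists2 p, p \in F & K p /\ V p x.
  move=> Kx; exists (V x, [set t : seq X | {subset [:: x] <= t}]).
    by split; [exact: VK | exists [:: x]].
  move=> [x' t] [/= Vx' xt]; exists x => //; exact/xt/mem_head.
have [s _ Hs] := cK _ F (fun t x => exists2 p, p \in t & K p /\ V p x) FF Hc.
exists [seq p <- s | `[< K p >]] => [p|x Kx].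
  by rewrite mem_filter => /andP[/asboolP].
have [p ps [Kp Vp]] := Hs s (fun _ => id) x Kx.
by exists p => //; rewrite mem_filter ps andbT; exact/asboolP.
Qed.

(** Over a compact neighbourhood of x, the part of Y outside O is compact, so its image
    is closed; it misses x. *)
Lemma proper_tube (X Y : topologicalType) (mu : properMap Y X) (x : X) (O : set Y) :
  hausdorff_space X -> locally_compact [set: X] ->
  (forall y, mu y = x -> nbhs y O) ->
  exists2 V, nbhs x V & forall y, V (mu y) -> O y.
Proof.
move=> hX lX HO.
have [K nK [cK clK]] : exists2 K, nbhs x K & compact K /\ closed K.
  have [K nK cK] := lX x I; exists K => //.
  by apply: (@filterS _ (nbhs x) _ _ K _ nK) => z; apply.
pose L := mu @^-1` K `&` ~` O^°.
have cL : compact L.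
  apply: (@subclosed_compact _ L (mu @^-1` K)); [|exact: pm_proper|by move=> ? []].
  apply: closedI; last by rewrite closedC; exact: open_interior.
  by apply: preimage_closed => // y _; exact: pm_continuous.
have cmL : closed (mu @` L).
  apply: compact_closed => //; apply: continuous_compact => //.
  by apply: continuous_subspaceT; exact: pm_continuous.
exists (K `&` ~` (mu @` L)).
  apply: filterI => //; apply: open_nbhs_nbhs; split; first by rewrite openC.
  by move=> [y [_ nO] yx]; apply: nO; exact: HO.
move=> y [Ky nL]; apply: contrapT => nOy; apply: nL; exists y => //; split=> //.
by move=> /nbhs_singleton.
Qed.

End FiniteCover.

Section PartitionOfUnity.
Variables (R : realType) (X : topologicalType).

(** Dividing by max(c, sum) instead of the sum keeps continuity where the sum is
    small. *)
Lemma normalize_C0 (I : finType) (f : I -> X -> R) (c : R) : 0 < c ->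
  (forall i, is_C0r (f i)) -> (forall i x, 0 <= f i x) ->
  let b i x := f i x / Order.max c (\sum_j f j x) in
  [/\ forall i, is_C0r (b i), forall i x, 0 <= b i x <= f i x / c,
      forall x, \sum_i b i x <= 1 &
      forall x, c <= \sum_j f j x -> \sum_i b i x = 1].
Proof.
move=> c0 Cf f0 b; pose S x := \sum_j f j x.
have m0 x : 0 < Order.max c (S x) by rewrite lt_max c0.
have b0 i x : 0 <= b i x by apply: divr_ge0 => //; exact: ltW (m0 x).
have bf i x : b i x <= f i x / c.
  by rewrite /b ler_wpM2l ?f0 ?lef_pV2 ?posrE // ?m0 ?le_max ?lexx.
have bS x : \sum_i b i x = S x / Order.max c (S x) by rewrite -mulr_suml.
split.
- move=> i; have [fc fv] := Cf i; split.
    have Sc : continuous (S : X -> R^o).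
      apply: continuous_big => [|j _]; last by have [] := Cf j.
      exact: add_continuous.
    move=> x; apply: cvgM; first exact: fc.
    apply: (@cvgV R^o); first by rewrite (gt_eqF (m0 x)).
    have := @continuous_max R X (cst c) S x; apply; last exact: Sc.
    exact: cvg_cst.
  move=> e e0; have [K cK HK] := fv (e * c) (mulr_gt0 e0 c0).
  exists K => // x /HK; rewrite !ger0_norm // => h.
  by apply: le_lt_trans (bf i x) _; rewrite ltr_pdivrMr.
- by move=> i x; rewrite b0 bf.
- by move=> x; rewrite bS ler_pdivrMr // mul1r le_max lexx orbT.
- by move=> x cS; rewrite bS (max_idPr cS) divff // gt_eqF // (lt_le_trans c0).
Qed.

Hypotheses (hX : hausdorff_space X) (lX : locally_compact [set: X]).

(** Bumps at finitely many points of K with sum above 1/2 on K, normalized. The total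
    mass is 1 only on K, which suffices because everything that is glued with these
    functions is small off a compact set. *)
Lemma partition_of_unity (K : set X) (U : X -> set X) : compact K ->
  (forall p, K p -> nbhs p (U p)) ->
  exists r (p : 'I_r -> X) (b : 'I_r -> X -> R),
    [/\ forall k, K (p k), forall k, is_C0r (b k) /\ (forall x, 0 <= b k x),
        forall k x, ~ U (p k) x -> b k x = 0,
        forall x, \sum_k b k x <= 1 &
        forall x, K x -> \sum_k b k x = 1].
Proof.
move=> cK UK.
have /choice [f Hf] : forall p, exists f : X -> R, K p ->
    [/\ is_C0r f, forall x, 0 <= f x <= 1, f p = 1 & forall x, ~ U p x -> f x = 0].
  move=> p; have [Kp|nKp] := pselect (K p); last by exists (cst 0).
  by have [f Hf] := @urysohn_C0 R X hX lX p (U p) (UK p Kp); exists f.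
have [|s sK Ks] := @compact_finite_cover X K (fun p => [set x | 2^-1 < f p x]) cK.
  move=> p Kp; have [[fc _] _ fp _] := Hf p Kp.
  apply: (@cvgr_gt R X (nbhs p) _ (f p) (f p p)); first exact: fc.
  by rewrite fp; lra.
pose q (k : 'I_(size s)) := tnth (in_tuple s) k.
have qK k : K (q k) by apply: sK; exact: mem_tnth.
have fq0 k x : 0 <= f (q k) x by have [_ /(_ x)/andP[]] := Hf _ (qK k).
have Cq k : is_C0r (f (q k)) by have [] := Hf _ (qK k).
have h2 : 0 < 2^-1 :> R by rewrite invr_gt0.
have := @normalize_C0 'I_(size s) (fun k => f (q k)) 2^-1 h2 Cq fq0.
set b := fun k x => _; move=> [Cb b0 b1 bK].
exists (size s), q, b; split=> //.
- by move=> k; split=> // x; have /andP[] := b0 k x.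
- by move=> k x nU; rewrite /b; have [_ _ _ ->] := Hf _ (qK k); rewrite ?mul0r.
- move=> x Kx; apply: bK; have [p ps Vp] := Ks x Kx.
  have [k pk] : exists k, p = q k.
    by have /tnthP [k ->] : p \in in_tuple s by []; exists k.
  rewrite (bigD1 k) //= -pk; apply: le_trans (ltW Vp) _.
  by rewrite lerDl sumr_ge0.
Qed.

(** Total mass at most 1 makes (u_i) a row of norm at most 1 over C_0(X). *)
Lemma bump_functions n (y : 'I_n -> X) : injective y ->
  exists u : 'I_n -> X -> R,
    [/\ forall i, is_C0r (u i), forall i x, 0 <= u i x, forall x, \sum_i u i x <= 1 &
        forall i j, u i (y j) = (i == j)%:R].
Proof.
move=> yi.
have /choice [f Hf] : forall i, exists f : X -> R,
    [/\ is_C0r f, forall x, 0 <= f x <= 1, f (y i) = 1 &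
        forall j, j != i -> f (y j) = 0].
  move=> i; have [|f [Cf f01 fi f0]] := @urysohn_C0 R X hX lX (y i)
      [set x | forall j : 'I_n, j != i -> x != y j].
    apply: filter_forall => j; have [->|ji] := eqVneq j i.
      by apply: filterE.
    have ij : y i != y j by apply: contra ji => /eqP/yi ->.
    have : nbhs (y i) (~` [set y j]).
      apply: open_nbhs_nbhs; split; last by move=> /eqP; rewrite (negbTE ij).
      rewrite openC; exact/accessible_closed_set1/hausdorff_accessible.
    by apply: filterS => x /eqP.
  exists f; split=> // j ji; apply: f0 => /(_ j ji); by rewrite eqxx.
have Cf i : is_C0r (f i) by have [] := Hf i.
have f0 i x : 0 <= f i x by have [_ /(_ x)/andP[]] := Hf i.
have := @normalize_C0 'I_n f 1 ltr01 Cf f0.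
set b := fun k x => _; move=> [Cb b0 b1 _].
exists b; split=> //; first by move=> i x; have /andP[] := b0 i x.
move=> i j; rewrite /b.
have fE k : f k (y j) = (k == j)%:R.
  have [_ _ fk fk0] := Hf k; have [<-//|kj] := eqVneq k j.
  by rewrite fk0 // eq_sym.
rewrite fE; have -> : \sum_k f k (y j) = 1.
  by rewrite (bigD1 j) //= fE eqxx big1 ?addr0 // => k kj; rewrite fE (negbTE kj).
by rewrite max_l // divr1.
Qed.

End PartitionOfUnity.

(** * Operator norms of matrices of scalars and of functions *)

Section MatrixOperatorNorm.
Variable R : realType.
Local Notation C := (Cplx R).

(** The norm of A as an operator between l^2-spaces, in the form in which it appears
    pointwise in [C0_norm]. *)
Definition mxopnorm m n (A : 'M[C]_(m, n)) : R :=
  opnorm (@cmod R) (fun i j (z : C^o) => A i j * z).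

Let cm0 (z : C^o) : 0 <= cmod (z : C). Proof. exact: cmod_ge0. Qed.
Let cmD (z w : C^o) : cmod (z + w : C) <= cmod (z : C) + cmod (w : C).
Proof. exact: cmodD. Qed.
Let cmZ (a : C) (z : C^o) : cmod (a *: z : C) = cmod a * cmod (z : C).
Proof. exact: cmodM. Qed.

Lemma mul_bounded_linear (a : C) : bounded_linear (@cmod R) (fun z : C^o => a * z).
Proof.
split; last by exists (cmod a) => z; rewrite cmodM.
by move=> b z w /=; rewrite mulrDr; congr (_ + _); exact: mulrCA.
Qed.

Lemma mxopnorm_ge0 m n (A : 'M[C]_(m, n)) : 0 <= mxopnorm A.
Proof. exact: opnorm_ge0. Qed.

Lemma mxopnorm_app m n (A : 'M[C]_(m, n)) (xi : 'I_n -> C^o) :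
  vnorm (@cmod R) (mxapp (fun i j (z : C^o) => A i j * z) xi) <= mxopnorm A * vnorm (@cmod R) xi.
Proof. by apply: (le_opnorm cm0 cmD cmZ) => i j; exact: mul_bounded_linear. Qed.

Lemma mxopnorm_le m n (A : 'M[C]_(m, n)) M : 0 <= M ->
  (forall xi, vnorm (@cmod R) (mxapp (fun i j (z : C^o) => A i j * z) xi) <=
     M * vnorm (@cmod R) xi) -> mxopnorm A <= M.
Proof. exact: opnorm_le. Qed.

Lemma mxopnorm_row m n n' (A : 'M[C]_(m, n)) (B : 'M[C]_(m, n')) :
  mxopnorm (row_mx A B) ^+ 2 <= mxopnorm A ^+ 2 + mxopnorm B ^+ 2.
Proof.
rewrite -[leRHS]sqr_sqrtr ?addr_ge0 ?sqr_ge0 // ler_sqr ?nnegrE ?mxopnorm_ge0 ?sqrtr_ge0 //.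
apply: (opnorm_row cm0 cmD cmZ _ _ (fun i j => mul_bounded_linear (A i j))
    (fun i j => mul_bounded_linear (B i j)) (lexx _) (lexx _)) => i j;
by apply/funext => z; rewrite (row_mxEl, row_mxEr).
Qed.

Lemma mxopnorm_col m m' n (A : 'M[C]_(m, n)) (B : 'M[C]_(m', n)) :
  mxopnorm (col_mx A B) ^+ 2 <= mxopnorm A ^+ 2 + mxopnorm B ^+ 2.
Proof.
rewrite -[leRHS]sqr_sqrtr ?addr_ge0 ?sqr_ge0 // ler_sqr ?nnegrE ?mxopnorm_ge0 ?sqrtr_ge0 //.
apply: (opnorm_col cm0 cmD cmZ _ _ (fun i j => mul_bounded_linear (A i j))
    (fun i j => mul_bounded_linear (B i j)) (lexx _) (lexx _)) => i j;
by apply/funext => z; rewrite (col_mxEu, col_mxEd).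
Qed.

Lemma mxopnormZ m n (a : C) (A : 'M[C]_(m, n)) : mxopnorm (a *: A) <= cmod a * mxopnorm A.
Proof.
apply: (opnorm_scale cm0 cmD cmZ) => [i j x|i j]; last exact: mul_bounded_linear.
by rewrite mxE /=; exact/esym/mulrA.
Qed.

Lemma mxopnormD m n (A B : 'M[C]_(m, n)) : mxopnorm (A + B) <= mxopnorm A + mxopnorm B.
Proof.
apply: mxopnorm_le => [|xi]; first by rewrite addr_ge0 ?mxopnorm_ge0.
have -> : mxapp (fun i j (z : C^o) => (A + B) i j * z) xi =
  fun i => mxapp (fun i j (z : C^o) => A i j * z) xi i +
           mxapp (fun i j (z : C^o) => B i j * z) xi i.
  apply/funext => i; rewrite /mxapp -big_split /=; apply: eq_bigr => j _.
  by rewrite mxE mulrDl.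
apply: le_trans (vnormD cm0 cmD _ _) _.
by rewrite mulrDl lerD // mxopnorm_app.
Qed.

Lemma mxopnormM m n p (A : 'M[C]_(m, n)) (B : 'M[C]_(n, p)) :
  mxopnorm (A *m B) <= mxopnorm A * mxopnorm B.
Proof.
apply: mxopnorm_le => [|xi]; first by rewrite mulr_ge0 ?mxopnorm_ge0.
have -> : mxapp (fun i j (z : C^o) => (A *m B) i j * z) xi =
    mxapp (fun i j (z : C^o) => A i j * z) (mxapp (fun i j (z : C^o) => B i j * z) xi).
  apply/funext => i; rewrite /mxapp.
  under [RHS]eq_bigr => j _ do rewrite mulr_sumr.
  rewrite exchange_big /=; apply: eq_bigr => k _.
  rewrite mxE mulr_suml; apply: eq_bigr => j _; exact/esym/mulrA.
apply: le_trans (mxopnorm_app _ _) _.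
by rewrite -mulrA ler_wpM2l ?mxopnorm_ge0 ?mxopnorm_app.
Qed.

Lemma mxopnorm_scalar n (a : C) : mxopnorm (a%:M : 'M[C]_n) <= cmod a.
Proof.
apply: mxopnorm_le => [|xi]; first exact: cmod_ge0.
have -> : mxapp (fun i j (z : C^o) => (a%:M : 'M[C]_n) i j * z) xi = fun i => a *: xi i.
  apply/funext => i; rewrite /mxapp (bigD1 i) //= mxE eqxx big1 ?addr0 // => j ji.
  by rewrite mxE eq_sym (negbTE ji) mul0r.
by rewrite (vnormZ cmZ).
Qed.

Lemma mxopnorm_le_sum m n (A : 'M[C]_(m, n)) : mxopnorm A <= \sum_i \sum_j cmod (A i j).
Proof.
apply: mxopnorm_le => [|xi].
  by apply: sumr_ge0 => i _; apply: sumr_ge0 => j _; exact: cmod_ge0.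
apply: (mxapp_bound cm0 cmD cmZ (B := fun i j => cmod (A i j))) => [i j|i j x].
  exact: cmod_ge0.
by rewrite cmodM.
Qed.

Lemma mxopnorm0 m n : mxopnorm (0 : 'M[C]_(m, n)) = 0.
Proof.
apply/eqP; rewrite eq_le mxopnorm_ge0 andbT -(scale0r 0).
by apply: le_trans (mxopnormZ _ _) _; rewrite cmod0 mul0r.
Qed.

Lemma mxopnorm_const (a : C) : mxopnorm (const_mx a : 'M_1) <= cmod a.
Proof.
have -> : const_mx a = a%:M :> 'M[C]_1 by apply/matrixP => i j; rewrite !mxE !ord1.
exact: mxopnorm_scalar.
Qed.

Lemma cmod_le_mxopnorm m n (A : 'M[C]_(m, n)) i j : cmod (A i j) <= mxopnorm A.
Proof.
pose xi : 'I_n -> C^o := fun k => (k == j)%:R.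
have xi1 : vnorm (@cmod R) xi = 1.
  rewrite /vnorm (bigD1 j) //= big1 => [|k kj]; rewrite /xi ?eqxx ?(negbTE kj) ?cmod0 ?expr0n //.
  by rewrite cmod1 expr1n addr0 sqrtr1.
have := mxopnorm_app A xi; rewrite xi1 mulr1; apply: le_trans.
have := N_le_vnorm (V := C^o) (N := @cmod R) (@cmod_ge0 R)
  (mxapp (fun i j (z : C^o) => A i j * z) xi) i.
apply: le_trans; rewrite /mxapp (bigD1 j) //= big1 => [|k kj]; rewrite /xi ?eqxx ?(negbTE kj).
  by rewrite mulr1 addr0.
by rewrite mulr0.
Qed.

End MatrixOperatorNorm.

Section C0Matrix.
Variables (R : realType).
Local Notation C := (Cplx R).

Definition mxev (Y : topologicalType) (y : Y) m n (G : 'M[C0 R Y]_(m, n)) : 'M[C]_(m, n) :=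
  map_mx (fun g : C0 R Y => (g y : C)) G.

Lemma mxopnorm_mxev (Y : topologicalType) (y : Y) m n (G : 'M[C0 R Y]_(m, n)) :
  mxopnorm (mxev y G) = opnorm (@cmod R) (fun i j (z : C^o) => G i j y * z).
Proof.
by congr opnorm; apply/funext => i; apply/funext => j; apply/funext => z; rewrite mxE.
Qed.

Lemma C0_norm_lub (Y : topologicalType) m n (G : 'M[C0 R Y]_(m, n)) M : 0 <= M ->
  (forall y, mxopnorm (mxev y G) <= M) -> C0_norm G <= M.
Proof. by move=> M0 HM; apply: C0_norm_le => // y; rewrite -mxopnorm_mxev. Qed.

Lemma mxev_le_C0_norm (Y : topologicalType) m n (G : 'M[C0 R Y]_(m, n)) y :
  mxopnorm (mxev y G) <= C0_norm G.
Proof. by rewrite mxopnorm_mxev; exact: opnorm_le_C0_norm. Qed.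

Lemma mxev_row (Y : topologicalType) (y : Y) m n n' (A : 'M[C0 R Y]_(m, n))
  (B : 'M[C0 R Y]_(m, n')) : mxev y (row_mx A B) = row_mx (mxev y A) (mxev y B).
Proof. exact: map_row_mx. Qed.

Lemma mxev_col (Y : topologicalType) (y : Y) m m' n (A : 'M[C0 R Y]_(m, n))
  (B : 'M[C0 R Y]_(m', n)) : mxev y (col_mx A B) = col_mx (mxev y A) (mxev y B).
Proof. exact: map_col_mx. Qed.

Lemma C0D (Y : topologicalType) (f g : C0 R Y) y : (f + g) y = f y + g y.
Proof. by []. Qed.

Lemma C0Z (Y : topologicalType) (a : C) (f : C0 R Y) y : (a *: f) y = a * f y.
Proof. by []. Qed.

Lemma C0_sum (Y : topologicalType) (I : Type) (s : seq I) (P : pred I) (f : I -> C0 R Y) y :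
  (\sum_(i <- s | P i) f i) y = \sum_(i <- s | P i) f i y.
Proof. by elim/big_rec2: _ => // i a b _ <-. Qed.

Lemma C0_eq (Y : topologicalType) (f g : C0 R Y) : f =1 g -> f = g.
Proof. by move=> fg; apply/val_inj/funext. Qed.

End C0Matrix.

(** * Representations of C_0(X) are completely contractive *)

Section Adjoint.
Variables (R : realType).
Local Notation C := (Cplx R).

Lemma csum_le (I : Type) (s : seq I) (P : pred I) (f : I -> C) :
  cmod (\sum_(i <- s | P i) f i) <= \sum_(i <- s | P i) cmod (f i).
Proof.
elim/big_rec2: _ => [|i a b _ h]; first by rewrite cmod0.
by apply: le_trans (cmodD _ _) _; rewrite lerD2l.
Qed.

Lemma sum_mul_le_vnorm n (a b : 'I_n -> C^o) :
  cmod (\sum_i a i * b i : C) <= vnorm (@cmod R) a * vnorm (@cmod R) b.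
Proof.
apply: le_trans (csum_le _ _ _) _.
rewrite -(@ler_sqr R) ?nnegrE ?mulr_ge0 ?vnorm_ge0 //; last first.
  by apply: sumr_ge0 => i _; exact: cmod_ge0.
rewrite exprMn !vnorm_sqr.
under eq_bigr => i _ do rewrite cmodM.
exact: cauchy_schwarz.
Qed.

Lemma cmod_sqrE (z : C) : (cmod z ^+ 2)%:C%C = z * Num.conj z.
Proof. by rewrite -normCK cmodE rmorphXn. Qed.

Lemma vnorm_conj n (a : 'I_n -> C^o) :
  vnorm (@cmod R) (fun i => Num.conj (a i : C)) = vnorm (@cmod R) a.
Proof. by rewrite /vnorm; congr Num.sqrt; apply: eq_bigr => i _; rewrite cmodJ. Qed.

(** If v is the adjoint of A applied to u, then |v|^2 is the pairing of u with A v,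
    at most |u| |A| |v|. *)
Lemma mxopnorm_adjoint m n (A : 'M[C]_(m, n)) :
  mxopnorm (\matrix_(j, i) Num.conj (A i j)) <= mxopnorm A.
Proof.
apply: mxopnorm_le => [|u]; first exact: mxopnorm_ge0.
set v := mxapp _ u.
have vE : (vnorm (@cmod R) v ^+ 2) =
    cmod (\sum_i u i * Num.conj (mxapp (fun i j (z : C^o) => A i j * z) v i : C) : C).
  have -> : \sum_i u i * Num.conj (mxapp (fun i j (z : C^o) => A i j * z) v i : C) =
      (vnorm (@cmod R) v ^+ 2)%:C%C.
    rewrite vnorm_sqr rmorph_sum /=.
    under [RHS]eq_bigr => j _ do rewrite cmod_sqrE {1}/v /mxapp mulr_suml.
    rewrite exchange_big /=; apply: eq_bigr => i _.
    rewrite /mxapp rmorph_sum mulr_sumr /=; apply: eq_bigr => j _.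
    rewrite mxE rmorphM /=; change (u i * (Num.conj (A i j) * Num.conj (v j : C)) =
      Num.conj (A i j) * u i * Num.conj (v j : C)); ring.
  by rewrite cmodR ger0_norm ?sqr_ge0.
have : vnorm (@cmod R) v ^+ 2 <= vnorm (@cmod R) u * (mxopnorm A * vnorm (@cmod R) v).
  rewrite vE; apply: le_trans (sum_mul_le_vnorm _ _) _.
  by rewrite vnorm_conj ler_wpM2l ?vnorm_ge0 ?mxopnorm_app.
have := vnorm_ge0 (@cmod R) v; rewrite le_eqVlt => /orP[/eqP <- _|v0].
  by rewrite mulr_ge0 ?mxopnorm_ge0 ?vnorm_ge0.
by rewrite expr2 mulrCA mulrA ler_pM2r.
Qed.

End Adjoint.

Section SquaringBound.
Variable R : realType.

(** Iterating a_n^2 <= a_(n+1) gives a_0^(2^n) <= a_n <= c b^(2^n); the constant c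
    disappears in the 2^n-th root. *)
Lemma squaring_bound (a : nat -> R) (b c : R) : 0 <= b ->
  (forall n, 0 <= a n) -> (forall n, a n ^+ 2 <= a n.+1) ->
  (forall n, a n <= c * b ^+ (2 ^ n)) -> a 0%N <= b.
Proof.
move=> b0 a0 asq ac.
have apow n : a 0%N ^+ (2 ^ n) <= a n.
  elim: n => [|n IH]; first by rewrite expn0 expr1.
  rewrite expnSr exprM; apply: le_trans (asq n).
  by rewrite ler_sqr ?nnegrE ?exprn_ge0.
rewrite leNgt; apply/negP => ba.
move: b0; rewrite le_eqVlt => /orP[/eqP b0|b0].
  have := le_trans (apow 1%N) (ac 1%N); rewrite -b0 expr0n /= mulr0.
  by rewrite leNgt exprn_gt0 // b0.
pose d := a 0%N / b - 1.
have d0 : 0 < d by rewrite subr_gt0 ltr_pdivlMr // mul1r.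
have E n : 1 + d *+ (2 ^ n) <= c.
  have h : (a 0%N / b) ^+ (2 ^ n) <= c.
    rewrite expr_div_n ler_pdivrMr ?exprn_gt0 //.
    exact: le_trans (apow n) (ac n).
  apply: le_trans h.
  have -> : a 0%N / b = 1 + d by rewrite /d; ring.
  elim: (2 ^ n)%N => [|k IH]; first by rewrite mulr0n addr0 expr0.
  rewrite exprS mulrSr; apply: (@le_trans _ _ ((1 + d) * (1 + d *+ k))); last first.
    by rewrite ler_pM2l // addr_gt0.
  rewrite mulrDr mulr1 mulrDl mul1r.
  have : 0 <= d * d *+ k by rewrite mulrn_wge0 // mulr_ge0 // ltW.
  by rewrite -mulrnAr; lra.
have [n Hn] : exists n : nat, c / d < n%:R.
  by exists (Num.bound (c / d)); apply: archi_boundP; have := E 0%N; rewrite expn0 mulr1n => h;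
   rewrite divr_ge0 ?(ltW d0) //; apply: le_trans h; rewrite addr_ge0 ?ltW.
have := E n; rewrite leNgt => /negP; apply.
rewrite ltr_pdivrMr // in Hn; apply: lt_le_trans Hn _.
rewrite mulrC; apply: (@le_trans _ _ (d * (2 ^ n)%N%:R)).
  by rewrite ler_pM2l // ler_nat ltnW // ltn_expl.
by rewrite mulr_natr lerDr.
Qed.

End SquaringBound.

Section Representation.
Variables (R : realType) (X : topologicalType) (H : hilbert R).
Local Notation C := (Cplx R).
Variable rep : C0 R X -> H -> H.
Hypothesis hrep : star_representation rep.
Local Notation rdot x y := (complex.Re (@hs_dot R H x y)).

Lemma star_repD a b x : rep (a + b) x = rep a x + rep b x.
Proof. by have [_ lr _ _] := hrep; have := lr 1 a b; rewrite !scale1r => ->. Qed.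

Lemma star_rep0 x : rep 0 x = 0.
Proof. by apply: (@addIr _ (rep 0 x)); rewrite -star_repD !add0r. Qed.

Lemma star_repZ a b x : rep (a *: b) x = a *: rep b x.
Proof.
have [_ lr _ _] := hrep; have := lr a b 0; rewrite addr0 => ->.
by rewrite -[RHS]addr0 -(star_rep0 x).
Qed.

Lemma star_rep_sum (I : Type) (s : seq I) (P : pred I) (f : I -> C0 R X) x :
  rep (\sum_(i <- s | P i) f i) x = \sum_(i <- s | P i) rep (f i) x.
Proof.
elim/big_rec2: _ => [|i y1 y2 _ <-]; first exact: star_rep0.
exact: star_repD.
Qed.

Lemma star_rep_lin a x y : rep a (x + y) = rep a x + rep a y.
Proof. by have [/(_ a)[l _] _ _ _] := hrep; have := l 1 x y; rewrite !scale1r. Qed.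

Lemma star_rep_lin0 a : rep a 0 = 0.
Proof. by apply: (@addIr _ (rep a 0)); rewrite -star_rep_lin !add0r. Qed.

Lemma star_rep_lin_sum a (I : Type) (s : seq I) (P : pred I) (f : I -> H) :
  rep a (\sum_(i <- s | P i) f i) = \sum_(i <- s | P i) rep a (f i).
Proof. exact: (big_morph _ (star_rep_lin a) (star_rep_lin0 a)). Qed.

Lemma rdot_rep a x y : rdot (rep a x) y = rdot x (rep (C0_conj a) y).
Proof. by have [_ _ _ ->] := hrep. Qed.

Lemma rep_mul a b x : rep (C0_mul a b) x = rep a (rep b x).
Proof. by have [_ _ -> _] := hrep. Qed.

(** The function f = 1 - sqrt(1 - |a|^2) is in C_0(X), although 1 need not be, and
    |a|^2 + f^2 = 2 f. Hence |rep a xi|^2 + |xi - rep f xi|^2 = |xi|^2. *)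
Lemma star_rep_contraction1 (a : C0 R X) : (forall x, cmod (a x) <= 1) ->
  forall xi, hnorm (rep a xi) <= hnorm xi.
Proof.
move=> a1 xi; pose s x := Num.sqrt (1 - cmod (a x) ^+ 2).
have s01 x : 0 <= 1 - cmod (a x) ^+ 2 by rewrite subr_ge0 expr_le1 ?cmod_ge0.
have s1 x : s x <= 1.
  rewrite -(@ler_sqr R) ?nnegrE ?sqrtr_ge0 // sqr_sqrtr // expr1n.
  by rewrite lerBlDr lerDl sqr_ge0.
have sge x : 1 - cmod (a x) ^+ 2 <= s x.
  have := sqrtr_ge0 (1 - cmod (a x) ^+ 2); have := sqr_sqrtr (s01 x).
  by have := s1 x; rewrite /s; nra.
have /is_C0P [ac av] := C0P a.
have Cf : is_C0r (fun x => 1 - s x).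
  split.
    move=> x; apply: (@cvgB _ R^o); first exact: cvg_cst.
    apply: (@continuous_comp _ _ _ (fun x => 1 - cmod (a x) ^+ 2)); last exact: sqrt_continuous.
    apply: (@cvgB _ R^o); first exact: cvg_cst.
    have cc : {for x, continuous (fun x => cmod (a x) : R^o)}.
      by apply: continuous_comp; [exact: ac|exact: cmod_continuous].
    by rewrite /= expr2; apply: (@cvgM R); exact: cc.
  move=> e e0; have [K cK HK] := av e e0; exists K => // x /HK h.
  have h1 := s1 x; have h2 := sge x; have h3 := a1 x; have h4 := cmod_ge0 (a x).
  rewrite ger0_norm ?subr_ge0 //; apply: le_lt_trans h.
  by nra.
pose f := C0_real Cf.
have fJ : C0_conj f = f by apply: C0_eq => x; exact: conjc_real.
have fE : C0_mul (C0_conj a) a + C0_mul f f = (1 + 1) *: f.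
  apply: C0_eq => x; rewrite C0D C0Z /=.
  change (Num.conj (a x) * a x + (1 - s x)%:C%C * (1 - s x)%:C%C = (1 + 1) * (1 - s x)%:C%C :> C).
  rewrite mulrC -cmod_sqrE -rmorphM -rmorphD /= -[1 + 1 : C](rmorphD (@real_complex R) 1 1).
  rewrite -rmorphM /=; congr (_ %:C%C).
  by have := sqr_sqrtr (s01 x); rewrite -/(s x) => h; rewrite -[cmod _ ^+ 2](subKr 1) -h; ring.
have E1 : rdot (rep a xi) (rep a xi) = rdot (rep (C0_mul (C0_conj a) a) xi) xi.
  by rewrite rdot_rep rdotC -rep_mul.
have E2 : rdot (rep f xi) (rep f xi) = rdot (rep (C0_mul f f) xi) xi.
  by rewrite rdot_rep rdotC fJ -rep_mul.
have E3 : rdot (rep a xi) (rep a xi) + rdot (rep f xi) (rep f xi) = 2 * rdot (rep f xi) xi.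
  rewrite E1 E2 -rdotDl -star_repD fE star_repZ.
  by rewrite -[1 + 1 : C](rmorphD (@real_complex R) 1 1) rdotZl; congr (_ * _); ring.
have := rdot_ge0 (xi + ((- 1)%:C%C : C) *: rep f xi).
rewrite rdot_sqr (rdotC xi) => h.
rewrite -(@ler_sqr R) ?nnegrE ?hnorm_ge0 // !hnorm_sqr.
by move: E3 h; lra.
Qed.

Lemma star_rep_contraction (a : C0 R X) M : 0 <= M -> (forall x, cmod (a x) <= M) ->
  forall xi, hnorm (rep a xi) <= M * hnorm xi.
Proof.
move=> M0 aM xi; apply/ler_addgt0Pr => e e0.
have h1 : 0 < hnorm xi + 1 by rewrite ltr_wpDl ?hnorm_ge0.
pose d := e / (hnorm xi + 1); have d0 : 0 < d by rewrite divr_gt0.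
have Md : 0 < M + d by rewrite ltr_wpDl.
pose z : C := ((M + d)^-1)%:C%C.
have zE : cmod z = (M + d)^-1 by rewrite cmodR gtr0_norm ?invr_gt0.
have := @star_rep_contraction1 (z *: a) _ xi; rewrite star_repZ hnormZ zE.
rewrite ler_pdivrMl // => h; apply: le_trans (h _) _.
  move=> x; rewrite C0Z cmodM zE ler_pdivrMl // mulr1.
  by apply: le_trans (aM x) _; rewrite lerDl ltW.
rewrite mulrDl lerD2l /d mulrAC ler_pdivrMr // ler_wpM2l ?lerDl //.
exact: ltW.
Qed.

Definition repmx m n (A : 'M[C0 R X]_(m, n)) (xi : 'I_n -> H) : 'I_m -> H :=
  mxapp (fun i j => rep (A i j)) xi.

(** The adjoint of A times A. *)
Definition gram m n (A : 'M[C0 R X]_(m, n)) : 'M[C0 R X]_n :=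
  \matrix_(i, j) \sum_l C0_mul (C0_conj (A l i)) (A l j).

Lemma sum_rdot_le n (xi eta : 'I_n -> H) :
  \sum_i rdot (xi i) (eta i) <= vnorm (@hnorm R H) xi * vnorm (@hnorm R H) eta.
Proof.
apply: (@le_trans _ _ (\sum_i hnorm (xi i) * hnorm (eta i))).
  by apply: ler_sum => i _; exact: rdot_le.
rewrite -(@ler_sqr R) ?nnegrE ?mulr_ge0 ?vnorm_ge0 //; last first.
  by apply: sumr_ge0 => i _; rewrite mulr_ge0 ?hnorm_ge0.
by rewrite exprMn !vnorm_sqr; exact: cauchy_schwarz.
Qed.

Lemma rdot_suml (I : Type) (s : seq I) (P : pred I) (f : I -> H) y :
  rdot (\sum_(i <- s | P i) f i) y = \sum_(i <- s | P i) rdot (f i) y.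
Proof.
elim/big_rec2: _ => [|i a b _ <-]; last exact: rdotDl.
by have := rdotZl 0 0 y; rewrite scaler0 mul0r.
Qed.

(** Cauchy-Schwarz for the pairing of xi with the image of xi under the Gram matrix,
    which is |rep A xi|^2. *)
Lemma repmx_gram m n (A : 'M[C0 R X]_(m, n)) xi :
  vnorm (@hnorm R H) (repmx A xi) ^+ 2 <=
    vnorm (@hnorm R H) xi * vnorm (@hnorm R H) (repmx (gram A) xi).
Proof.
apply: le_trans (sum_rdot_le _ _).
rewrite vnorm_sqr le_eqVlt; apply/orP; left; apply/eqP.
under eq_bigr => l _ do rewrite hnorm_sqr {1}/repmx /mxapp rdot_suml.
rewrite exchange_big /=; apply: eq_bigr => i _.
under eq_bigr => l _ do rewrite rdot_rep rdotC /repmx /mxapp star_rep_lin_sum.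
rewrite -rdot_suml rdotC; apply: (congr1 (fun z => rdot (xi i) z)).
rewrite exchange_big /= /repmx /mxapp; apply: eq_bigr => j _.
by rewrite mxE star_rep_sum; apply: eq_bigr => l _; rewrite rep_mul.
Qed.

Lemma mxev_gram m n (A : 'M[C0 R X]_(m, n)) x :
  mxopnorm (mxev x (gram A)) <= mxopnorm (mxev x A) ^+ 2.
Proof.
have -> : mxev x (gram A) = (\matrix_(j, i) Num.conj (mxev x A i j)) *m mxev x A.
  apply/matrixP => i j; rewrite !mxE C0_sum; apply: eq_bigr => l _.
  by rewrite !mxE.
apply: le_trans (mxopnormM _ _) _; rewrite expr2.
by rewrite ler_wpM2r ?mxopnorm_ge0 ?mxopnorm_adjoint.
Qed.

(** The factor m n is lost here, and recovered by [squaring_bound]. *)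
Lemma repmx_crude m n (A : 'M[C0 R X]_(m, n)) M xi : 0 <= M ->
  (forall x, mxopnorm (mxev x A) <= M) ->
  vnorm (@hnorm R H) (repmx A xi) <= (m * n)%:R * M * vnorm (@hnorm R H) xi.
Proof.
move=> M0 AM.
have := @mxapp_bound R H (@hnorm R H) (@hnorm_ge0 R H) (@Defs.hnormD R H) (@hnormZ R H) m n
  (fun i j => rep (A i j)) (fun _ _ => M) (fun _ _ => M0).
rewrite !sumr_const !card_ord -mulrnA mulnC mulr_natl; apply => i j x.
apply: star_rep_contraction => // y.
by apply: le_trans (AM y); have := cmod_le_mxopnorm (mxev y A) i j; rewrite mxE.
Qed.

(** Each passage to the Gram matrix squares the bound, so [squaring_bound] applies to
    the iterated Gram matrices of A. This replaces the positive square root of a matrix of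
    functions, which the scalar case [star_rep_contraction1] uses. *)
Theorem repmx_contraction m n (A : 'M[C0 R X]_(m, n)) xi :
  vnorm (@hnorm R H) (repmx A xi) <= C0_norm A * vnorm (@hnorm R H) xi.
Proof.
set b := C0_norm A; set x := vnorm _ xi.
have x0 : 0 <= x := vnorm_ge0 _ _.
have b0 : 0 <= b := C0_norm_ge0 A.
pose G k := iter k (@gram n n) (gram A).
have GM k y : mxopnorm (mxev y (G k)) <= (b ^+ 2) ^+ (2 ^ k).
  elim: k => [|k IH] /=.
    rewrite expn0 expr1; apply: le_trans (mxev_gram _ _) _.
    by rewrite ler_sqr ?nnegrE ?mxopnorm_ge0 // mxev_le_C0_norm.
  apply: le_trans (mxev_gram _ _) _.
  by rewrite expnSr exprM ler_sqr ?nnegrE ?mxopnorm_ge0 ?exprn_ge0.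
have := repmx_gram A xi; rewrite -/x => h.
move: x0; rewrite le_eqVlt => /orP[/eqP x0|x0].
  move: h; rewrite -x0 mul0r mulr0 => h.
  by rewrite leNgt; apply/negP => h'; move: h; rewrite leNgt exprn_gt0.
have hG : vnorm (@hnorm R H) (repmx (gram A) xi) / x <= b ^+ 2.
  apply: (@squaring_bound R (fun k => vnorm (@hnorm R H) (repmx (G k) xi) / x)
      _ (n * n)%:R); first exact: sqr_ge0.
  - by move=> k; rewrite divr_ge0 ?vnorm_ge0 // ltW.
  - move=> k; rewrite expr_div_n ler_pdivrMr ?exprn_gt0 //.
    apply: le_trans (repmx_gram _ _) _; rewrite -/x le_eqVlt; apply/orP; left; apply/eqP.
    by rewrite /=; field; rewrite gt_eqF.
  - move=> k; rewrite ler_pdivrMr //; apply: repmx_crude => //.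
    by rewrite exprn_ge0 // sqr_ge0.
rewrite -(@ler_sqr R) ?nnegrE ?vnorm_ge0 ?mulr_ge0 ?(ltW x0) //.
apply: le_trans h _; rewrite ler_pdivrMr // in hG.
by apply: le_trans (ler_wpM2l (ltW x0) hG) _; rewrite exprMn expr2; nra.
Qed.

End Representation.

(** * The algebraic balanced tensor product *)

Section TensorLift.
Context {R : realType} {X Y : topologicalType}.
Local Notation C := (Cplx R).
Variables (nu : properMap Y X) (V : mnModule R X).

Lemma tensDl e e' b : tens nu (e + e' : V) b = tens nu e b + tens nu e' b.
Proof. by rewrite -tclassD; apply/tclassP; exact: teq_addl. Qed.

Lemma tensDr (e : V) b b' : tens nu e (b + b') = tens nu e b + tens nu e b'.
Proof. by rewrite -tclassD; apply/tclassP; exact: teq_addr. Qed.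

Lemma tens0l b : tens nu (0 : V) b = 0.
Proof. by apply: (@addIr _ (tens nu (0 : V) b)); rewrite -tensDl !add0r. Qed.

Lemma tens0r (e : V) : tens nu e 0 = 0.
Proof. by apply: (@addIr _ (tens nu e 0)); rewrite -tensDr !add0r. Qed.

Lemma tensNl (e : V) b : tens nu (- e) b = - tens nu e b.
Proof. by rewrite -scaleN1r tensZl scaleN1r. Qed.

Lemma tens_suml (I : Type) (s : seq I) (P : pred I) (f : I -> V) b :
  tens nu (\sum_(i <- s | P i) f i) b = \sum_(i <- s | P i) tens nu (f i) b.
Proof. exact: (big_morph (fun e => tens nu e b) (fun x y => tensDl x y b) (tens0l b)). Qed.

Lemma tens_sumr (I : Type) (s : seq I) (P : pred I) (e : V) (f : I -> C0 R Y) :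
  tens nu e (\sum_(i <- s | P i) f i) = \sum_(i <- s | P i) tens nu e (f i).
Proof. exact: (big_morph (tens nu e) (tensDr e) (tens0r e)). Qed.

Lemma tens_bal (e : V) (a : C0 R X) b :
  tens nu (mn_act e a) b = tens nu e (C0_mul (C0_pull nu a) b).
Proof. by apply/tclassP; exact: teq_bal. Qed.

Lemma tensor_ind (P : tensor nu V -> Prop) : P 0 ->
  (forall e b w, P w -> P (tens nu e b + w)) -> forall w, P w.
Proof.
move=> P0 PD w; rewrite -(tclassK w) tclass_sum.
by elim: (lrepr _) => [|x s IH]; rewrite ?big_nil // big_cons; exact: PD.
Qed.

Section Lift.
Variables (U : lmodType C) (f : V -> C0 R Y -> U).

Record balanced : Prop := Balanced {
  balDl : forall e e' b, f (e + e') b = f e b + f e' b;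
  balDr : forall e b b', f e (b + b') = f e b + f e b';
  balZl : forall z e b, f (z *: e) b = z *: f e b;
  balZr : forall z e b, f e (z *: b) = z *: f e b;
  bal_act : forall e a b, f (mn_act e a) b = f e (C0_mul (C0_pull nu a) b)
}.

(** The sum runs over a chosen representative; [tensor_lift_class] shows that the choice
    does not matter once f is balanced. *)
Definition tensor_lift (w : tensor nu V) : U :=
  \sum_(x <- @lrepr _ (tensor_setoid nu V) w : seq (V * C0 R Y)) f x.1 x.2.

Hypothesis fP : balanced.

Lemma tensor_lift_class (s : seq (V * C0 R Y)) :
  tensor_lift (tclass nu s) = \sum_(x <- s) f x.1 x.2.
Proof.
have := @lreprP _ (tensor_setoid nu V) s; rewrite -/(tclass nu s) /tensor_lift.
move: (lrepr _) => s' /= ss'; elim: ss' => {s s'} //=.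
- by move=> s t u _ -> _ ->.
- by move=> s s' t t' _ h1 _ h2; rewrite !big_cat /= h1 h2.
- by move=> s t; rewrite !big_cat /= addrC.
- by move=> b; rewrite big_seq1 big_nil /= -(scale0r 0) (balZl fP) scale0r.
- by move=> e e' b; rewrite big_seq1 !big_cons big_nil addr0 /= (balDl fP).
- by move=> e b b'; rewrite big_seq1 !big_cons big_nil addr0 /= (balDr fP).
- by move=> z e b; rewrite !big_seq1 /= (balZl fP) (balZr fP).
- by move=> e a b; rewrite !big_seq1 /= (bal_act fP).
Qed.

Lemma tensor_lift_tens e b : tensor_lift (tens nu e b) = f e b.
Proof. by rewrite tensor_lift_class big_seq1. Qed.

Lemma tensor_lift_linear : linear tensor_lift.
Proof.
move=> z v w; rewrite -(tclassK v) -(tclassK w) -tclassZ -tclassD !tensor_lift_class.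
rewrite big_cat /=; congr (_ + _); rewrite big_map scaler_sumr.
by apply: eq_bigr => x _; rewrite (balZl fP).
Qed.

Lemma tensor_liftD v w : tensor_lift (v + w) = tensor_lift v + tensor_lift w.
Proof. by have := tensor_lift_linear 1 v w; rewrite !scale1r. Qed.

Lemma tensor_lift0 : tensor_lift 0 = 0.
Proof. by apply: (@addIr _ (tensor_lift 0)); rewrite -tensor_liftD !add0r. Qed.

Lemma tensor_liftZ z v : tensor_lift (z *: v) = z *: tensor_lift v.
Proof. by have := tensor_lift_linear z v 0; rewrite tensor_lift0 !addr0. Qed.

Lemma tensor_liftB v w : tensor_lift (v - w) = tensor_lift v - tensor_lift w.
Proof. by rewrite tensor_liftD -scaleN1r tensor_liftZ scaleN1r. Qed.

Lemma tensor_lift_sum (I : Type) (s : seq I) (P : pred I) (g : I -> tensor nu V) :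
  tensor_lift (\sum_(i <- s | P i) g i) = \sum_(i <- s | P i) tensor_lift (g i).
Proof. exact: (big_morph _ tensor_liftD tensor_lift0). Qed.

End Lift.

Lemma odot_row m n k k' (D : 'M[V]_(m, k)) (D' : 'M[V]_(m, k'))
    (G : 'M[C0 R Y]_(k, n)) (G' : 'M[C0 R Y]_(k', n)) :
  odot nu (row_mx D D') (col_mx G G') = odot nu D G + odot nu D' G'.
Proof.
apply/matrixP => i j; rewrite !mxE big_split_ord /=.
by congr (_ + _); apply: eq_bigr => l _; rewrite ?row_mxEl ?row_mxEr ?col_mxEu ?col_mxEd.
Qed.

(** A matrix is the sum of its entries times matrix units, and sums of products are
    products of block matrices. *)
Lemma tensor_odot m n (W : 'M[tensor nu V]_(m, n)) :
  exists k (D : 'M[V]_(m, k)) (G : 'M[C0 R Y]_(k, n)), W = odot nu D G.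
Proof.
pose rep (W : 'M[tensor nu V]_(m, n)) := exists k (D : 'M[V]_(m, k)) (G : 'M[C0 R Y]_(k, n)),
  W = odot nu D G.
have rep0 : rep 0.
  exists 0%N, 0, 0; apply/matrixP => i j; by rewrite !mxE big_ord0.
have repD W1 W2 : rep W1 -> rep W2 -> rep (W1 + W2).
  move=> [k1 [D1 [G1 ->]]] [k2 [D2 [G2 ->]]].
  by exists (k1 + k2)%N, (row_mx D1 D2), (col_mx G1 G2); rewrite odot_row.
have rep1 i j (w : tensor nu V) : rep (\matrix_(i', j') if (i' == i) && (j' == j) then w else 0).
  move: w; apply: tensor_ind.
    rewrite (_ : \matrix_(i', j') _ = 0) //.
    by apply/matrixP => i' j'; rewrite !mxE if_same.
  move=> e b w rw.
  have -> : (\matrix_(i', j') (if (i' == i) && (j' == j) then tens nu e b + w else 0)) =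
    odot nu (\matrix_(i' < m, l < 1) if i' == i then e else 0)
            (\matrix_(l < 1, j' < n) if j' == j then b else 0) +
    \matrix_(i', j') if (i' == i) && (j' == j) then w else 0.
    apply/matrixP => i' j'; rewrite !mxE big_ord1 !mxE.
    by case: eqP => _; case: eqP => _ /=; rewrite ?tens0l ?tens0r ?addr0.
  by apply: repD => //; eexists _, _, _; reflexivity.
have -> : W = \sum_i \sum_j \matrix_(i', j') if (i' == i) && (j' == j) then W i j else 0.
  apply/matrixP => i' j'; rewrite summxE (bigD1 i') //= [X in _ = _ + X]big1 ?addr0.
    rewrite summxE (bigD1 j') //= mxE !eqxx /= big1 ?addr0 // => j jj.
    by rewrite mxE (eq_sym j') (negbTE jj) andbF.
  move=> i ii; rewrite summxE big1 // => j _.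
  by rewrite mxE (eq_sym i') (negbTE ii).
by elim/big_ind: _ => // i _; elim/big_ind: _ => // j _; exact: rep1.
Qed.

End TensorLift.

(** * Factorizations with pointwise bounds *)

(** With these coefficients the tensor product over C_0(X) has no operators in it: it is
    the case to which every operator module is reduced. *)
Definition C0_module (R : realType) (Y : topologicalType) : mnModule R Y :=
  @MnModule R Y (C0 R Y) (@C0_norm R Y) (@C0_mul R Y).

(** The fibre is listed without repetition, since bump functions will be attached to
    its points. *)
Definition fibre_card_le (Y X : topologicalType) (mu : Y -> X) (x : X) (N : nat) : Prop :=
  exists m (y : 'I_m -> Y), [/\ (m <= N)%N, injective y, forall i, mu (y i) = x &
    forall y', mu y' = x -> exists i, y' = y i].

Section MxevContinuity.
Variables (R : realType) (Y : topologicalType).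
Local Notation C := (Cplx R).

Lemma mxev_near m n (G : 'M[C0 R Y]_(m, n)) (z0 : Y) (e : R) : 0 < e ->
  nbhs z0 [set z | mxopnorm (mxev z G - mxev z0 G) < e].
Proof.
move=> e0.
have h1 : 0 < (m * n)%N%:R + 1 :> R by rewrite ltr_wpDl.
pose d := e / ((m * n)%N%:R + 1).
have d0 : 0 < d by rewrite divr_gt0.
have H : \forall z \near z0, forall ij : 'I_m * 'I_n, cmod (G ij.1 ij.2 z - G ij.1 ij.2 z0) < d.
  apply: filter_forall => -[i j] /=.
  have /is_C0P [Gc _] := C0P (G i j).
  have /cvg_cmodP /(_ _ d0) := Gc z0.
  by apply: filterS => z; rewrite -cmodN opprB.
apply: filterS H => z Hz /=; apply: le_lt_trans (mxopnorm_le_sum _) _.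
apply: (@le_lt_trans _ _ ((m * n)%N%:R * d)).
  rewrite mulr_natl mulnC mulrnA.
  rewrite -[X in _ *+ X]card_ord -sumr_const; apply: ler_sum => i _.
  rewrite -[X in _ *+ X]card_ord -sumr_const; apply: ler_sum => j _.
  by rewrite !mxE; exact: ltW (Hz (i, j)).
rewrite /d mulrCA -[ltRHS]mulr1 ltr_pM2l // ltr_pdivrMr // mul1r.
by rewrite ltrDl.
Qed.

Lemma mxopnorm_near m n (G : 'M[C0 R Y]_(m, n)) (z0 : Y) (a b : R) : a < b ->
  mxopnorm (mxev z0 G) <= a -> nbhs z0 [set z | mxopnorm (mxev z G) <= b].
Proof.
move=> ab Ga; have e0 : 0 < b - a by rewrite subr_gt0.
apply: filterS (mxev_near G z0 e0) => z /= h.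
rewrite -(subrK (mxev z0 G) (mxev z G)); apply: le_trans (mxopnormD _ _) _.
by apply: le_trans (lerD (ltW h) Ga) _; rewrite subrK.
Qed.

Lemma mxev_vanishes m n (G : 'M[C0 R Y]_(m, n)) (e : R) : 0 < e ->
  exists2 K : set Y, compact K & forall y, ~ K y -> mxopnorm (mxev y G) < e.
Proof.
move=> e0.
have h1 : 0 < (m * n)%N%:R + 1 :> R by rewrite ltr_wpDl.
pose d := e / ((m * n)%N%:R + 1).
have d0 : 0 < d by rewrite divr_gt0.
have /choice [K HK] : forall ij : 'I_m * 'I_n, exists K : set Y, compact K /\
    forall y, ~ K y -> cmod (G ij.1 ij.2 y) < d.
  move=> [i j]; have /is_C0P [_ /(_ _ d0) [K cK HK]] := C0P (G i j).
  by exists K.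
exists (\big[setU/set0]_ij K ij).
  by elim/big_ind: _ => [|A B|ij _]; [exact: compact0|exact: compactU|by case: (HK ij)].
move=> y nK; apply: le_lt_trans (mxopnorm_le_sum _) _.
apply: (@le_lt_trans _ _ ((m * n)%N%:R * d)).
  rewrite mulr_natl mulnC mulrnA.
  rewrite -[X in _ *+ X]card_ord -sumr_const; apply: ler_sum => i _.
  rewrite -[X in _ *+ X]card_ord -sumr_const; apply: ler_sum => j _.
  rewrite !mxE; apply/ltW; have [_ /(_ y)] := HK (i, j); apply.
  by move=> Ky; apply: nK; rewrite (bigD1 (i, j)) //=; left.
rewrite /d mulrCA -[ltRHS]mulr1 ltr_pM2l // ltr_pdivrMr // mul1r.
by rewrite ltrDl.
Qed.

End MxevContinuity.

Section Factorization.
Variables (R : realType) (X Y1 Y2 : topologicalType).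
Variables (mu1 : properMap Y1 X) (mu2 : properMap Y2 X).
Local Notation C := (Cplx R).
Local Notation M1 := (Defs.restrict mu1 (C0_module R Y1)).
Local Notation T0 := (tensor mu2 M1).

(** The bounds are functions on Y1 and Y2 rather than numbers: they add when
    factorizations are concatenated, and are multiplied by phi when W is, so that a
    partition of unity on X glues factorizations without any loss. *)
Definition factored p n (W : 'M[T0]_(p, n)) (alpha : Y1 -> R) (beta : Y2 -> R) : Prop :=
  exists k (D : 'M[C0 R Y1]_(p, k)) (G : 'M[C0 R Y2]_(k, n)),
    [/\ W = odot mu2 (D : 'M[M1]_(p, k)) G,
        forall y, mxopnorm (mxev y D) ^+ 2 <= alpha y &
        forall z, mxopnorm (mxev z G) ^+ 2 <= beta z].

Lemma factored_le p n (W : 'M[T0]_(p, n)) a b a' b' : factored W a b ->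
  (forall y, a y <= a' y) -> (forall z, b z <= b' z) -> factored W a' b'.
Proof.
move=> [k [D [G [WE Da Gb]]]] aa bb; exists k, D, G; split=> // [y|z].
  exact: le_trans (Da y) (aa y).
exact: le_trans (Gb z) (bb z).
Qed.

Lemma factored0 p n : factored (0 : 'M[T0]_(p, n)) (fun=> 0) (fun=> 0).
Proof.
exists 0%N, 0, 0; split.
- by apply/matrixP => i j; rewrite !mxE big_ord0.
- move=> y; have -> : mxev y (0 : 'M[C0 R Y1]_(p, 0)) = 0 by apply/matrixP => ? [].
  by rewrite mxopnorm0 expr0n.
- move=> y; have -> : mxev y (0 : 'M[C0 R Y2]_(0, n)) = 0 by apply/matrixP => -[].
  by rewrite mxopnorm0 expr0n.
Qed.

Lemma factoredD p n (W W' : 'M[T0]_(p, n)) a b a' b' :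
  factored W a b -> factored W' a' b' ->
  factored (W + W') (fun y => a y + a' y) (fun z => b z + b' z).
Proof.
move=> [k [D [G [-> Da Gb]]]] [k' [D' [G' [-> Da' Gb']]]].
exists (k + k')%N, (row_mx D D'), (col_mx G G'); split=> [|y|z].
- exact/esym/odot_row.
- by rewrite mxev_row; apply: le_trans (mxopnorm_row _ _) _; exact: lerD.
- by rewrite mxev_col; apply: le_trans (mxopnorm_col _ _) _; exact: lerD.
Qed.

Lemma factored_sum p n r (W : 'I_r -> 'M[T0]_(p, n)) a b :
  (forall i, factored (W i) (a i) (b i)) ->
  factored (\sum_i W i) (fun y => \sum_i a i y) (fun z => \sum_i b i z).
Proof.
elim: r W a b => [|r IH] W a b H.
  rewrite big_ord0; apply: factored_le (@factored0 p n) _ _ => ?; by rewrite big_ord0.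
rewrite big_ord_recl.
apply: factored_le (factoredD (H ord0) (IH _ _ _ (fun i => H (lift ord0 i)))) _ _;
by move=> ? /=; rewrite big_ord_recl.
Qed.

Lemma mxevZ (Y : topologicalType) (y : Y) m n (t : C) (G : 'M[C0 R Y]_(m, n)) :
  mxev y (map_mx ( *:%R t) G) = t *: mxev y G.
Proof. by apply/matrixP => i j; rewrite !mxE. Qed.

Lemma factored_scale p n (W : 'M[T0]_(p, n)) a b t : 0 < t -> factored W a b ->
  factored W (fun y => t * a y) (fun z => b z / t).
Proof.
move=> t0 [k [D [G [-> Da Gb]]]].
pose s : C := (Num.sqrt t)%:C%C.
have st0 : 0 < Num.sqrt t by rewrite sqrtr_gt0.
have s0 : s != 0 by rewrite gt_eqF // ltcR.
exists k, (map_mx ( *:%R s) D), (map_mx ( *:%R s^-1) G); split=> [|y|z].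
- exact/esym/(@odot_scale R X Y2 mu2 M1).
- rewrite mxevZ; apply: (@le_trans _ _ ((Num.sqrt t * mxopnorm (mxev y D)) ^+ 2)).
    rewrite ler_sqr ?nnegrE ?mulr_ge0 ?mxopnorm_ge0 ?(ltW st0) //.
    by apply: le_trans (mxopnormZ _ _) _; rewrite cmodR gtr0_norm.
  by rewrite exprMn (sqr_sqrtr (ltW t0)) ler_pM2l.
- rewrite mxevZ; apply: (@le_trans _ _ (((Num.sqrt t)^-1 * mxopnorm (mxev z G)) ^+ 2)).
    rewrite ler_sqr ?nnegrE ?mulr_ge0 ?mxopnorm_ge0 ?invr_ge0 ?(ltW st0) //.
    apply: le_trans (mxopnormZ _ _) _; rewrite /s -fmorphV cmodR gtr0_norm ?invr_gt0 //.
  by rewrite exprMn exprVn (sqr_sqrtr (ltW t0)) mulrC ler_pM2r ?invr_gt0.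
Qed.

(** Half of phi = psi^2 goes to each factor, through the balancing over C_0(X). *)
Lemma factored_act p n (W : 'M[T0]_(p, n)) a b (phi : X -> R) (Cphi : is_C0r phi) :
  (forall x, 0 <= phi x) -> factored W a b ->
  factored (map_mx (tensor_act (C0_pull mu2 (C0_real Cphi))) W)
    (fun y => phi (mu1 y) * a y) (fun z => phi (mu2 z) * b z).
Proof.
move=> phi0 [k [D [G [-> Da Gb]]]].
have Cpsi : is_C0r (fun x => Num.sqrt (phi x)).
  have [pc pv] := Cphi; split.
    by move=> x; apply: continuous_comp; [exact: pc|exact: sqrt_continuous].
  move=> e e0; have [K cK HK] := pv (e ^+ 2) (exprn_gt0 _ e0); exists K => // x /HK.
  rewrite !ger0_norm ?sqrtr_ge0 // => h.
  by rewrite -ltr_sqr ?nnegrE ?sqrtr_ge0 ?ltW // sqr_sqrtr.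
pose psi := C0_real Cpsi.
have phiE : C0_real Cphi = C0_mul psi psi.
  apply: C0_eq => x /=.
  change ((phi x)%:C%C = (Num.sqrt (phi x))%:C%C * (Num.sqrt (phi x))%:C%C :> C).
  by rewrite -rmorphM /= -expr2 sqr_sqrtr.
exists k, (map_mx (fun d : C0 R Y1 => C0_mul d (C0_pull mu1 psi)) D),
  (map_mx (fun g : C0 R Y2 => C0_mul (C0_pull mu2 psi) g) G); split=> [|y|z].
- apply/matrixP => i j; rewrite !mxE tensor_act_sum; apply: eq_bigr => l _.
  rewrite !mxE tensor_act_tens.
  have := @tens_bal R X Y2 mu2 M1 (D i l) psi (C0_mul (C0_pull mu2 psi) (G l j)).
  rewrite /= => ->; congr (tens _ _ _); apply: C0_eq => z.
  rewrite phiE /=.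
  change (G l j z * (psi (mu2 z) * psi (mu2 z)) = psi (mu2 z) * (psi (mu2 z) * G l j z) :> C).
  ring.
- have -> : mxev y (map_mx (fun d : C0 R Y1 => C0_mul d (C0_pull mu1 psi)) D) =
      psi (mu1 y) *: mxev y D.
    by apply/matrixP => i j; rewrite !mxE /= mulrC.
  apply: (@le_trans _ _ ((Num.sqrt (phi (mu1 y)) * mxopnorm (mxev y D)) ^+ 2)).
    rewrite ler_sqr ?nnegrE ?mulr_ge0 ?mxopnorm_ge0 ?sqrtr_ge0 //.
    by apply: le_trans (mxopnormZ _ _) _; rewrite cmodR ger0_norm ?sqrtr_ge0.
  by rewrite exprMn sqr_sqrtr // ler_wpM2l.
- have -> : mxev z (map_mx (fun d : C0 R Y2 => C0_mul (C0_pull mu2 psi) d) G) =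
      psi (mu2 z) *: mxev z G.
    by apply/matrixP => i j; rewrite !mxE /=.
  apply: (@le_trans _ _ ((Num.sqrt (phi (mu2 z)) * mxopnorm (mxev z G)) ^+ 2)).
    rewrite ler_sqr ?nnegrE ?mulr_ge0 ?mxopnorm_ge0 ?sqrtr_ge0 //.
    by apply: le_trans (mxopnormZ _ _) _; rewrite cmodR ger0_norm ?sqrtr_ge0.
  by rewrite exprMn sqr_sqrtr // ler_wpM2l.
Qed.

End Factorization.

(** * Bounded factorizations when one of two fibres is finite *)

Section ConstantMatrices.
Variables (R : realType).
Local Notation C := (Cplx R).

Definition C0_scalar_mx (Y : topologicalType) k (u : C0 R Y) : 'M[C0 R Y]_k :=
  \matrix_(i, j) if i == j then u else 0.

Definition const_mulmx (Y : topologicalType) k l m (A : 'M[C]_(k, l)) (G : 'M[C0 R Y]_(l, m)) :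
    'M[C0 R Y]_(k, m) :=
  \matrix_(i, j) \sum_s A i s *: G s j.

Definition mulmx_const (Y : topologicalType) k l m (D : 'M[C0 R Y]_(k, l)) (A : 'M[C]_(l, m)) :
    'M[C0 R Y]_(k, m) :=
  \matrix_(i, j) \sum_s A s j *: D i s.

Lemma mxev_C0_scalar_mx (Y : topologicalType) (y : Y) k (u : C0 R Y) :
  mxev y (C0_scalar_mx k u) = (u y)%:M.
Proof. by apply/matrixP => i j; rewrite !mxE; case: eqP. Qed.

Lemma mxev_const_mulmx (Y : topologicalType) (y : Y) k l m (A : 'M[C]_(k, l)) (G : 'M[C0 R Y]_(l, m)) :
  mxev y (const_mulmx A G) = A *m mxev y G.
Proof.
by apply/matrixP => i j; rewrite !mxE C0_sum; apply: eq_bigr => s _; rewrite !mxE.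
Qed.

Lemma mxev_mulmx_const (Y : topologicalType) (y : Y) k l m (D : 'M[C0 R Y]_(k, l)) (A : 'M[C]_(l, m)) :
  mxev y (mulmx_const D A) = mxev y D *m A.
Proof.
apply/matrixP => i j; rewrite !mxE C0_sum; apply: eq_bigr => s _.
by rewrite !mxE mulrC.
Qed.

Lemma mxevB (Y : topologicalType) (y : Y) k l (A B : 'M[C0 R Y]_(k, l)) :
  mxev y (A - B) = mxev y A - mxev y B.
Proof. by apply/matrixP => i j; rewrite !mxE. Qed.

Lemma mxev_sum (Y : topologicalType) (y : Y) k l r (A : 'I_r -> 'M[C0 R Y]_(k, l)) :
  mxev y (\sum_i A i) = \sum_i mxev y (A i).
Proof.
apply/matrixP => i j; rewrite !mxE summxE C0_sum summxE.
by apply: eq_bigr => s _; rewrite !mxE.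
Qed.

End ConstantMatrices.

Section OdotBilinear.
Variables (R : realType) (X Y1 Y2 : topologicalType).
Variables (mu1 : properMap Y1 X) (mu2 : properMap Y2 X).
Local Notation C := (Cplx R).
Local Notation M1 := (Defs.restrict mu1 (C0_module R Y1)).

Lemma odotBl k l m (D D' : 'M[C0 R Y1]_(k, l)) (G : 'M[C0 R Y2]_(l, m)) :
  odot mu2 ((D - D') : 'M[M1]_(k, l)) G =
  odot mu2 (D : 'M[M1]_(k, l)) G - odot mu2 (D' : 'M[M1]_(k, l)) G.
Proof.
apply/matrixP => i j; rewrite !mxE -sumrB; apply: eq_bigr => s _.
rewrite !mxE -[in RHS]tensNl; exact: (@tensDl R X Y2 mu2 M1).
Qed.

Lemma odotBr k l m (D : 'M[C0 R Y1]_(k, l)) (G G' : 'M[C0 R Y2]_(l, m)) :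
  odot mu2 (D : 'M[M1]_(k, l)) (G - G') =
  odot mu2 (D : 'M[M1]_(k, l)) G - odot mu2 (D : 'M[M1]_(k, l)) G'.
Proof.
apply/matrixP => i j; rewrite !mxE -sumrB; apply: eq_bigr => s _.
by rewrite !mxE tensDr -scaleN1r -tensZ scaleN1r tensNl.
Qed.

Lemma odot_suml k l m r (D : 'I_r -> 'M[C0 R Y1]_(k, l)) (G : 'M[C0 R Y2]_(l, m)) :
  odot mu2 ((\sum_i D i) : 'M[M1]_(k, l)) G = \sum_i odot mu2 (D i : 'M[M1]_(k, l)) G.
Proof.
apply/matrixP => i j; rewrite !mxE summxE.
under [RHS]eq_bigr => s _ do rewrite !mxE.
rewrite exchange_big /=; apply: eq_bigr => s _.
by rewrite summxE; exact: (@tens_suml R X Y2 mu2 M1).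
Qed.

Lemma odot_sumr k l m r (D : 'M[C0 R Y1]_(k, l)) (G : 'I_r -> 'M[C0 R Y2]_(l, m)) :
  odot mu2 (D : 'M[M1]_(k, l)) (\sum_i G i) = \sum_i odot mu2 (D : 'M[M1]_(k, l)) (G i).
Proof.
apply/matrixP => i j; rewrite !mxE summxE.
under [RHS]eq_bigr => s _ do rewrite !mxE.
rewrite exchange_big /=; apply: eq_bigr => s _.
by rewrite summxE; exact: (@tens_sumr R X Y2 mu2 M1).
Qed.

Lemma odot_const_mulmx k l m (u : C0 R Y1) (A : 'M[C]_(k, l)) (G : 'M[C0 R Y2]_(l, m)) :
  odot mu2 (mulmx_const (C0_scalar_mx k u) A : 'M[M1]_(k, l)) G =
  odot mu2 (C0_scalar_mx k u : 'M[M1]_k) (const_mulmx A G).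
Proof.
apply/matrixP => i j; rewrite !mxE [RHS](bigD1 i) //= !mxE eqxx [X in _ = _ + X]big1 ?addr0.
  rewrite tens_sumr; apply: eq_bigr => s _.
  rewrite mxE -tensZ; congr (tens _ _ _).
  rewrite (bigD1 i) //= mxE eqxx big1 ?addr0 // => t ti.
  by rewrite mxE eq_sym (negbTE ti) scaler0.
by move=> s si; rewrite mxE eq_sym (negbTE si); exact: (@tens0l R X Y2 mu2 M1).
Qed.

Lemma odot_mulmx_const k l m (D : 'M[C0 R Y1]_(k, l)) (A : 'M[C]_(l, m)) (v : C0 R Y2) :
  odot mu2 (D : 'M[M1]_(k, l)) (const_mulmx A (C0_scalar_mx m v)) =
  odot mu2 (mulmx_const D A : 'M[M1]_(k, m)) (C0_scalar_mx m v).
Proof.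
apply/matrixP => i j; rewrite !mxE [RHS](bigD1 j) //= !mxE eqxx [X in _ = _ + X]big1 ?addr0.
  rewrite (@tens_suml R X Y2 mu2 M1); apply: eq_bigr => s _.
  rewrite mxE (@tensZ R X Y2 mu2 M1); congr (tens _ _ _).
  rewrite (bigD1 j) //= mxE eqxx big1 ?addr0 // => t tj.
  by rewrite mxE (negbTE tj) scaler0.
by move=> s sj; rewrite [C0_scalar_mx _ _ _ _]mxE (negbTE sj); exact: (@tens0r R X Y2 mu2 M1).
Qed.

End OdotBilinear.

Section Gluing.
Variables (R : realType) (X Y1 Y2 : topologicalType).
Hypotheses (hX : hausdorff_space X) (lX : locally_compact [set: X]).
Hypotheses (hY1 : hausdorff_space Y1) (lY1 : locally_compact [set: Y1]).
Hypotheses (hY2 : hausdorff_space Y2) (lY2 : locally_compact [set: Y2]).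
Variables (mu1 : properMap Y1 X) (mu2 : properMap Y2 X).
Local Notation C := (Cplx R).
Local Notation M1 := (Defs.restrict mu1 (C0_module R Y1)).
Local Notation T0 := (tensor mu2 M1).

Lemma sum_sqr_le1 (I : finType) (u : I -> R) : (forall i, 0 <= u i) -> \sum_i u i <= 1 ->
  \sum_i u i ^+ 2 <= 1.
Proof.
move=> u0 u1; apply: (le_trans _ u1); apply: ler_sum => i _.
rewrite expr2 ler_piMr // (le_trans _ u1) // (bigD1 i) //= lerDl.
by apply: sumr_ge0.
Qed.

(** A bound on the fibre over x persists over a neighbourhood of x, with any margin. *)
Lemma near_fibres (Y : topologicalType) (mu : properMap Y X) (x : X) m' k l
    (G : 'I_m' -> 'M[C0 R Y]_(k, l)) (a b : R) : a < b ->
  (forall i y, mu y = x -> mxopnorm (mxev y (G i)) <= a) ->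
  exists2 V, nbhs x V & forall y i, V (mu y) -> mxopnorm (mxev y (G i)) <= b.
Proof.
move=> ab Ga; have [|V nV HV] := @proper_tube X Y mu x
  [set y | forall i, mxopnorm (mxev y (G i)) <= b] hX lX.
  by move=> y yx; apply: filter_forall => i; apply: mxopnorm_near ab _; exact: Ga.
by exists V => // y i /HV.
Qed.

Section Fixed.
Variables (p q n : nat) (D0 : 'M[C0 R Y1]_(p, q)) (G0 : 'M[C0 R Y2]_(q, n)).
Variables (h : R) (N : nat).
Hypothesis h0 : 0 < h.
Hypothesis D0G0 : forall y z, mu1 y = mu2 z -> mxopnorm (mxev y D0 *m mxev z G0) <= h.

Local Notation W := (odot mu2 (D0 : 'M[M1]_(p, q)) G0).

Lemma sum_ler_const m (f : 'I_m -> R) (c : R) : (m <= N)%N -> 0 <= c ->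
  (forall i, f i <= c) -> \sum_i f i <= N%:R * c.
Proof.
move=> mN c0 fc; apply: (@le_trans _ _ (\sum_(i < m) c)); first exact: ler_sum.
by rewrite sumr_const card_ord -[c *+ m]mulr_natl ler_wpM2r // ler_nat.
Qed.

(* N matrices bounded by 2 h contribute 4 N h to one factor, the bumps h to the other,
   and the remainder h to each. *)
Local Notation K := ((4 * N + 2)%N%:R * h).

(** If y_1, ..., y_m is the fibre of x and u_i are bumps at these points, then
    W = sum_i u_i (x) D0(y_i) G0 + (D0 - sum_i u_i D0(y_i)) (x) G0.
    The u_i form a row of norm at most 1; the matrices D0(y_i) G0(z), at most N in number,
    are bounded by h for z over x, hence by 2 h over a neighbourhood; the first factor of
    the remainder vanishes on the fibre of x. *)
Lemma local_factor_fst x : fibre_card_le mu1 x N ->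
  exists2 V, nbhs x V & exists a b, [/\ factored W a b,
    forall y, V (mu1 y) -> a y <= K & forall z, V (mu2 z) -> b z <= K].
Proof.
move=> [m [y [mN yi yx yfib]]].
have [u [Cu u0 u1 uy]] := @bump_functions R Y1 hY1 lY1 m y yi.
pose U i := C0_real (Cu i).
pose A i := mxev (y i) D0.
pose D' := D0 - \sum_i mulmx_const (C0_scalar_mx p (U i)) (A i).
have WE : W = (\sum_i odot mu2 (C0_scalar_mx p (U i) : 'M[M1]_p) (const_mulmx (A i) G0)) +
    odot mu2 (D' : 'M[M1]_(p, q)) G0.
  under eq_bigr => i _ do rewrite -odot_const_mulmx.
  by rewrite -odot_suml /D' odotBl addrC subrK.
have D'y y' : mu1 y' = x -> mxev y' D' = 0.
  move=> /yfib [i ->]; rewrite mxevB mxev_sum (bigD1 i) //= big1 => [|j ji].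
    rewrite mxev_mulmx_const mxev_C0_scalar_mx /= uy eqxx addr0.
    by rewrite [X in X *m _](_ : _ = 1%:M) // mul1mx subrr.
  rewrite mxev_mulmx_const mxev_C0_scalar_mx /= uy (negbTE ji).
  by rewrite [X in X *m _](_ : _ = 0%:M) // mul_scalar_mx scale0r.
have D'yle y' : mu1 y' = x -> mxopnorm (mxev y' D') <= 0 by move=> /D'y ->; rewrite mxopnorm0.
pose g := C0_norm G0; have g0 : 0 <= g := C0_norm_ge0 G0.
(* With weight k, the factor of the remainder that is merely bounded contributes at
   most h, and the one that can be made small absorbs k. *)
pose k := (g ^+ 2 + 1) / h; have k0 : 0 < k by rewrite divr_gt0 // ltr_wpDl ?sqr_ge0.
have e0 : 0 < Num.sqrt (h / k) by rewrite sqrtr_gt0 divr_gt0.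
have hk0 : 0 <= h / k := divr_ge0 (ltW h0) (ltW k0).
have hh : h < 2 * h by move: h0; lra.
have [V1 nV1 HV1] := @near_fibres Y1 mu1 x 1 _ _ (fun=> D') 0 _ e0
  (fun _ y' hy' => D'yle y' hy').
have [|V2 nV2 HV2] := @near_fibres Y2 mu2 x m _ _ (fun i => const_mulmx (A i) G0) h (2 * h)
  hh.
  by move=> i z zx; rewrite mxev_const_mulmx; apply: D0G0; rewrite yx.
exists (V1 `&` V2); first exact: filterI.
exists (fun y => \sum_i h * u i y ^+ 2 + k * mxopnorm (mxev y D') ^+ 2).
exists (fun z => \sum_i mxopnorm (mxev z (const_mulmx (A i) G0)) ^+ 2 / h +
  mxopnorm (mxev z G0) ^+ 2 / k).
split.
- rewrite WE; apply: factoredD.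
    apply: factored_sum => i.
    apply: (@factored_scale R X Y1 Y2 mu1 mu2 _ _ _ (fun y => u i y ^+ 2)
      (fun z => mxopnorm (mxev z (const_mulmx (A i) G0)) ^+ 2)) => //.
    eexists _, _, _; split; [reflexivity| |by []] => y'.
    rewrite mxev_C0_scalar_mx ler_sqr ?nnegrE ?mxopnorm_ge0 //.
    by apply: le_trans (mxopnorm_scalar _ _) _; rewrite cmodR ger0_norm.
  apply: (@factored_scale R X Y1 Y2 mu1 mu2 _ _ _ (fun y => mxopnorm (mxev y D') ^+ 2)
      (fun z => mxopnorm (mxev z G0) ^+ 2)) => //.
  by eexists _, _, _; split; [reflexivity| |].
- move=> y' [Vy _]; rewrite -mulr_sumr.
  have h1 : h * \sum_i u i y' ^+ 2 <= h.
    by rewrite ger_pMr // sum_sqr_le1.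
  have h2 : k * mxopnorm (mxev y' D') ^+ 2 <= h.
    rewrite mulrC -ler_pdivlMr // -[leRHS](sqr_sqrtr hk0).
    by rewrite ler_sqr ?nnegrE ?mxopnorm_ge0 ?sqrtr_ge0 //; exact: (HV1 y' ord0).
  apply: le_trans (lerD h1 h2) _; rewrite natrD natrM mulrDl.
  have : 0 <= 4 * N%:R * h by rewrite !mulr_ge0 // ltW.
  lra.
- move=> z [_ Vz]; have h1 i : mxopnorm (mxev z (const_mulmx (A i) G0)) ^+ 2 / h <= 4 * h.
    rewrite ler_pdivrMr // (_ : 4 * h * h = (2 * h) ^+ 2); last by ring.
    by rewrite ler_sqr ?nnegrE ?mxopnorm_ge0 ?mulr_ge0 ?(ltW h0) //; exact: HV2.
  have h2 : mxopnorm (mxev z G0) ^+ 2 / k <= h.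
    rewrite ler_pdivrMr // /k mulrCA divff ?gt_eqF // mulr1.
    apply: (@le_trans _ _ (g ^+ 2)); last by rewrite lerDl.
    by rewrite ler_sqr ?nnegrE ?mxopnorm_ge0 ?mxev_le_C0_norm.
  have h3 := sum_ler_const mN (mulr_ge0 (ler0n R 4) (ltW h0)) h1.
  apply: le_trans (lerD h3 h2) _; rewrite natrD natrM mulrDl.
  by move: h0; lra.
Qed.

(** As in [local_factor_fst], with the bumps in the second factor: now
    W = sum_i D0 G0(z_i) (x) v_i + D0 (x) (G0 - sum_i G0(z_i) v_i). *)
Lemma local_factor_snd x : fibre_card_le mu2 x N ->
  exists2 V, nbhs x V & exists a b, [/\ factored W a b,
    forall y, V (mu1 y) -> a y <= K & forall z, V (mu2 z) -> b z <= K].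
Proof.
move=> [m [z [mN zi zx zfib]]].
have [v [Cv v0 v1 vz]] := @bump_functions R Y2 hY2 lY2 m z zi.
pose U i := C0_real (Cv i).
pose B i := mxev (z i) G0.
pose G' := G0 - \sum_i const_mulmx (B i) (C0_scalar_mx n (U i)).
have WE : W = (\sum_i odot mu2 (mulmx_const D0 (B i) : 'M[M1]_(p, n)) (C0_scalar_mx n (U i))) +
    odot mu2 (D0 : 'M[M1]_(p, q)) G'.
  under eq_bigr => i _ do rewrite -odot_mulmx_const.
  by rewrite -odot_sumr /G' odotBr addrC subrK.
have G'z z' : mu2 z' = x -> mxev z' G' = 0.
  move=> /zfib [i ->]; rewrite mxevB mxev_sum (bigD1 i) //= big1 => [|j ji].
    rewrite mxev_const_mulmx mxev_C0_scalar_mx /= vz eqxx addr0.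
    by rewrite [X in _ *m X](_ : _ = 1%:M) // mulmx1 subrr.
  rewrite mxev_const_mulmx mxev_C0_scalar_mx /= vz (negbTE ji).
  by rewrite [X in _ *m X](_ : _ = 0%:M) // mul_mx_scalar scale0r.
have G'zle z' : mu2 z' = x -> mxopnorm (mxev z' G') <= 0 by move=> /G'z ->; rewrite mxopnorm0.
pose g := C0_norm D0; have g0 : 0 <= g := C0_norm_ge0 D0.
pose k := (g ^+ 2 + 1) / h; have k0 : 0 < k by rewrite divr_gt0 // ltr_wpDl ?sqr_ge0.
have e0 : 0 < Num.sqrt (h / k) by rewrite sqrtr_gt0 divr_gt0.
have hk0 : 0 <= h / k := divr_ge0 (ltW h0) (ltW k0).
have hh : h < 2 * h by move: h0; lra.
have [V1 nV1 HV1] := @near_fibres Y2 mu2 x 1 _ _ (fun=> G') 0 _ e0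
  (fun _ y' hy' => G'zle y' hy').
have [|V2 nV2 HV2] := @near_fibres Y1 mu1 x m _ _ (fun i => mulmx_const D0 (B i)) h (2 * h)
  hh.
  by move=> i y yx; rewrite mxev_mulmx_const; apply: D0G0; rewrite zx.
exists (V1 `&` V2); first exact: filterI.
exists (fun y => \sum_i h^-1 * mxopnorm (mxev y (mulmx_const D0 (B i))) ^+ 2 +
  k^-1 * mxopnorm (mxev y D0) ^+ 2).
exists (fun z => \sum_i v i z ^+ 2 / h^-1 + mxopnorm (mxev z G') ^+ 2 / k^-1).
split.
- rewrite WE; apply: factoredD.
    apply: factored_sum => i.
    apply: (@factored_scale R X Y1 Y2 mu1 mu2 _ _ _
      (fun y => mxopnorm (mxev y (mulmx_const D0 (B i))) ^+ 2) (fun z => v i z ^+ 2)).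
      by rewrite invr_gt0.
    eexists _, _, _; split; [reflexivity|by []|] => y'.
    rewrite mxev_C0_scalar_mx ler_sqr ?nnegrE ?mxopnorm_ge0 //.
    by apply: le_trans (mxopnorm_scalar _ _) _; rewrite cmodR ger0_norm.
  apply: (@factored_scale R X Y1 Y2 mu1 mu2 _ _ _ (fun y => mxopnorm (mxev y D0) ^+ 2)
      (fun z => mxopnorm (mxev z G') ^+ 2)); first by rewrite invr_gt0.
  by eexists _, _, _; split; [reflexivity| |].
- move=> y' [_ Vy].
  have h1 i : h^-1 * mxopnorm (mxev y' (mulmx_const D0 (B i))) ^+ 2 <= 4 * h.
    rewrite mulrC ler_pdivrMr // (_ : 4 * h * h = (2 * h) ^+ 2); last by ring.
    by rewrite ler_sqr ?nnegrE ?mxopnorm_ge0 ?mulr_ge0 ?(ltW h0) //; exact: HV2.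
  have h2 : k^-1 * mxopnorm (mxev y' D0) ^+ 2 <= h.
    rewrite mulrC ler_pdivrMr // /k mulrCA divff ?gt_eqF // mulr1.
    apply: (@le_trans _ _ (g ^+ 2)); last by rewrite lerDl.
    by rewrite ler_sqr ?nnegrE ?mxopnorm_ge0 ?mxev_le_C0_norm.
  have h3 := sum_ler_const mN (mulr_ge0 (ler0n R 4) (ltW h0)) h1.
  apply: le_trans (lerD h3 h2) _; rewrite natrD natrM mulrDl.
  by move: h0; lra.
- move=> z' [Vz _]; rewrite !invrK -mulr_suml.
  have h1 : (\sum_i v i z' ^+ 2) * h <= h.
    by rewrite ger_pMl // sum_sqr_le1.
  have h2 : mxopnorm (mxev z' G') ^+ 2 * k <= h.
    rewrite -ler_pdivlMr // -[leRHS](sqr_sqrtr hk0).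
    by rewrite ler_sqr ?nnegrE ?mxopnorm_ge0 ?sqrtr_ge0 //; exact: (HV1 z' ord0).
  apply: le_trans (lerD h1 h2) _; rewrite natrD natrM mulrDl.
  have : 0 <= 4 * N%:R * h by rewrite !mulr_ge0 // ltW.
  lra.
Qed.

(** Where phi_i is nonzero the factorization found at x_i is bounded by K, so the bounds
    sum_i phi_i a_i and sum_i phi_i b_i of the glued factorization stay below K. What is
    left, W - sum_i phi_i W, has a first factor that vanishes over the compact set where
    the phi_i add up to 1 and is small elsewhere. *)
Lemma global_factor :
  (forall x, fibre_card_le mu1 x N \/ fibre_card_le mu2 x N) ->
  factored W (fun=> (4 * N + 3)%N%:R * h) (fun=> (4 * N + 3)%N%:R * h).
Proof.
move=> fibN.
have HV0 : forall x : X, exists V : set X, nbhs x V /\ exists a b, [/\ factored W a b,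
    forall y, V (mu1 y) -> a y <= K & forall z, V (mu2 z) -> b z <= K].
  move=> x; have [V nV HV] : exists2 V, nbhs x V & exists a b, [/\ factored W a b,
    forall y, V (mu1 y) -> a y <= K & forall z, V (mu2 z) -> b z <= K].
    by case: (fibN x); [exact: local_factor_fst|exact: local_factor_snd].
  by exists V.
have [V HV] := choice HV0.
pose g := C0_norm G0; have g0 : 0 <= g := C0_norm_ge0 G0.
pose k := (g ^+ 2 + 1) / h; have k0 : 0 < k by rewrite divr_gt0 // ltr_wpDl ?sqr_ge0.
have e0 : 0 < Num.sqrt (h / k) by rewrite sqrtr_gt0 divr_gt0.
have hk0 : 0 <= h / k := divr_ge0 (ltW h0) (ltW k0).
have hh : h < 2 * h by move: h0; lra.
have [L cL HL] := mxev_vanishes D0 e0.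
have cmL : compact (mu1 @` L).
  apply: continuous_compact => //.
  by apply: continuous_subspaceT; exact: pm_continuous.
have [r [x [phi [_ Hphi phiV phi1 phiL]]]] := @partition_of_unity R X hX lX _ V cmL
  (fun x _ => (HV x).1).
have Cphi i : is_C0r (phi i) by case: (Hphi i).
have phi0 i t : 0 <= phi i t by case: (Hphi i) => _; exact.
have /choice [a Ha] : forall i : 'I_r, exists a b, [/\ factored W a b,
    forall y, V (x i) (mu1 y) -> a y <= K & forall z, V (x i) (mu2 z) -> b z <= K].
  by move=> i; exact: (HV (x i)).2.
have /choice [b Hab] := Ha.
pose Dphi i := map_mx (fun d : C0 R Y1 => C0_mul d (C0_pull mu1 (C0_real (Cphi i)))) D0.
pose D' : 'M[C0 R Y1]_(p, q) := D0 - \sum_i Dphi i.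
have WE : W = (\sum_i map_mx (tensor_act (C0_pull mu2 (C0_real (Cphi i)))) W) +
    odot mu2 (D' : 'M[M1]_(p, q)) G0.
  rewrite /D' odotBl odot_suml.
  have -> : \sum_i odot mu2 (Dphi i : 'M[M1]_(p, q)) G0 =
      \sum_i map_mx (tensor_act (C0_pull mu2 (C0_real (Cphi i)))) W.
    apply: eq_bigr => i _; apply/matrixP => s t; rewrite !mxE tensor_act_sum.
    apply: eq_bigr => l _; rewrite mxE tensor_act_tens.
    have := @tens_bal R X Y2 mu2 M1 (D0 s l) (C0_real (Cphi i)) (G0 l t).
    rewrite /= => ->; congr (tens _ _ _); apply: C0_eq => z /=; exact: mulrC.
  by rewrite addrC subrK.
have D'E y : mxev y D' = (1 - (\sum_i phi i (mu1 y))%:C%C : C) *: mxev y D0.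
  rewrite mxevB mxev_sum scalerBl scale1r; congr (_ - _).
  rewrite rmorph_sum scaler_suml; apply: eq_bigr => i _.
  by apply/matrixP => s t; rewrite !mxE /= mulrC.
have D'h y : k * mxopnorm (mxev y D') ^+ 2 <= h.
  rewrite mulrC -ler_pdivlMr // -[leRHS](sqr_sqrtr hk0).
  rewrite ler_sqr ?nnegrE ?mxopnorm_ge0 ?sqrtr_ge0 // D'E.
  apply: le_trans (mxopnormZ _ _) _.
  have -> : 1 - (\sum_i phi i (mu1 y))%:C%C = (1 - \sum_i phi i (mu1 y))%:C%C :> C.
    by rewrite rmorphB rmorph1.
  rewrite cmodR.
  have [Ly|nLy] := pselect (L y).
    by rewrite phiL ?subrr ?normr0 ?mul0r ?sqrtr_ge0 //; exists y.
  rewrite ger0_norm ?subr_ge0 //; apply: le_trans (ltW (HL y nLy)).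
  by rewrite ler_piMl ?mxopnorm_ge0 // lerBlDr lerDl sumr_ge0.
have Kge0 : 0 <= K by rewrite mulr_ge0 // ltW.
have sumK (t : X) (c : 'I_r -> R) : (forall i, V (x i) t -> c i <= K) ->
    \sum_i phi i t * c i <= K.
  move=> cK; apply: (@le_trans _ _ (\sum_i phi i t * K)).
    apply: ler_sum => i _; have [Vt|nVt] := pselect (V (x i) t).
      by rewrite ler_wpM2l // cK.
    by rewrite (phiV i t nVt) !mul0r.
  by rewrite -mulr_suml ler_piMl.
rewrite WE; apply: factored_le.
- apply: factoredD.
    apply: factored_sum => i; apply: (@factored_act R X Y1 Y2 mu1 mu2 _ _ _ (a i) (b i)) => //.
    by case: (Hab i).
  apply: (@factored_scale R X Y1 Y2 mu1 mu2 _ _ _ (fun y => mxopnorm (mxev y D') ^+ 2)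
    (fun z => mxopnorm (mxev z G0) ^+ 2) k k0).
  by eexists _, _, _; split; [reflexivity| |].
- move=> y /=; have h1 : \sum_i phi i (mu1 y) * a i y <= K.
    by apply: sumK => i Vy; case: (Hab i) => _ + _; exact.
  have -> : (4 * N + 3)%N%:R * h = K + h by rewrite !natrD; ring.
  exact: lerD.
- move=> z /=; have h1 : \sum_i phi i (mu2 z) * b i z <= K.
    by apply: sumK => i Vy; case: (Hab i) => _ _; exact.
  have -> : (4 * N + 3)%N%:R * h = K + h by rewrite !natrD; ring.
  apply: lerD => //.
  rewrite ler_pdivrMr // /k mulrCA divff ?gt_eqF // mulr1.
  apply: (@le_trans _ _ (g ^+ 2)); last by rewrite lerDl.
  by rewrite ler_sqr ?nnegrE ?mxopnorm_ge0 ?mxev_le_C0_norm.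
Qed.

End Fixed.

End Gluing.

(** * Density of the algebraic tensors in C_0 of the fibre product *)

Section Density.
Variables (R : realType) (X Y1 Y2 : topologicalType).
Hypotheses (hX : hausdorff_space X).
Variables (mu1 : properMap Y1 X) (mu2 : properMap Y2 X).
Local Notation C := (Cplx R).
Local Notation M1 := (Defs.restrict mu1 (C0_module R Y1)).
Local Notation T0 := (tensor mu2 M1).
Local Notation Z := (fibre_product mu1 mu2).
Local Notation pi1 := (fibre_fst hX mu1 mu2).
Local Notation pi2 := (fibre_snd hX mu1 mu2).

Definition fibre_fun_bil (b : M1) (c : C0 R Y2) : C0 R Z :=
  C0_mul (C0_pull pi1 (b : C0 R Y1)) (C0_pull pi2 c).

Lemma fibre_fun_balanced : balanced mu2 fibre_fun_bil.
Proof.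
split=> *; apply: C0_eq => z /=.
- exact: mulrDl.
- exact: mulrDr.
- exact/esym/mulrA.
- exact: mulrCA.
- by rewrite -fibre_productE; exact/esym/mulrA.
Qed.

Definition fibre_fun : T0 -> C0 R Z := tensor_lift fibre_fun_bil.

Lemma fibre_fun_odot p k n (D : 'M[C0 R Y1]_(p, k)) (G : 'M[C0 R Y2]_(k, n)) (z : Z) :
  mxev z (map_mx fibre_fun (odot mu2 (D : 'M[M1]_(p, k)) G)) =
  mxev (pi1 z) D *m mxev (pi2 z) G.
Proof.
apply/matrixP => i j; rewrite !mxE /fibre_fun (tensor_lift_sum fibre_fun_balanced) C0_sum.
apply: eq_bigr => l _; rewrite (tensor_lift_tens fibre_fun_balanced).
by rewrite !mxE.
Qed.

Lemma fibre_point (y : Y1) (z : Y2) : mu1 y = mu2 z ->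
  exists w : Z, pi1 w = y /\ pi2 w = z.
Proof.
move=> yz; have h : (y, z) \in [set p : Y1 * Y2 | mu1 p.1 = mu2 p.2] by apply: mem_set.
by exists (exist _ (y, z) h).
Qed.

(** Since X is Hausdorff, a point off the fibre product has a rectangle that misses the
    fibre product, where any c will do. *)
Lemma fibre_small_rectangle (F : C0 R Z) (e : R) (y : Y1) (z : Y2) : 0 < e ->
  exists U V (c : C), [/\ nbhs y U, nbhs z V &
    forall w : Z, U (pi1 w) -> V (pi2 w) -> cmod (F w - c) <= e].
Proof.
move=> e0; have [yz|yz] := pselect (mu1 y = mu2 z).
  have [w [wy wz]] := fibre_point yz.
  have [Fc _] := is_C0P _ (C0P F).
  have /cvg_cmodP /(_ _ e0) := Fc w.
  move=> [B [[U oU <-] Uw UB]].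
  have : nbhs (set_val w) U by rewrite nbhsE; exists U.
  move=> [[P Q] [/= Py Qz] PQU].
  exists P, Q, (F w); split; [by rewrite -wy|by rewrite -wz|].
  move=> w' Pw Qw; have /= := UB w' (PQU (set_val w') (conj Pw Qw)).
  by rewrite -cmodN opprB => /ltW.
have := hX; rewrite open_hausdorff => /(_ (mu1 y) (mu2 z)).
case=> [|[A B] [/= Ay Bz] [oA oB AB]]; first exact/eqP.
exists (mu1 @^-1` A), (mu2 @^-1` B), 0; split.
- by apply: (@pm_continuous _ _ mu1 y); apply: open_nbhs_nbhs; split => //; exact: set_mem.
- by apply: (@pm_continuous _ _ mu2 z); apply: open_nbhs_nbhs; split => //; exact: set_mem.
- move=> w Aw Bw; have : (A `&` B) (mu1 (pi1 w)) by split=> //; rewrite /= fibre_productE.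
  by rewrite (eqP AB).
Qed.

Hypotheses (hY1 : hausdorff_space Y1) (lY1 : locally_compact [set: Y1]).
Hypotheses (hY2 : hausdorff_space Y2) (lY2 : locally_compact [set: Y2]).

(** The number of functions varies with the point of Y2 at which the partition is
    chosen, so it is part of the data. *)
Record finite_partition := FinitePartition {
  fp_size : nat;
  fp_pt : 'I_fp_size -> Y1;
  fp_fun : 'I_fp_size -> Y1 -> R
}.

(** For every z there is a finite partition of unity on Y1 subordinate to the first
    sides of small rectangles around the points (y, z); the second sides of the finitely
    many rectangles in use meet in a neighbourhood of z. A partition of unity on Y2
    subordinate to these neighbourhoods combines them. *)
Lemma fibre_fun_dense (F : C0 R Z) (e : R) : 0 < e ->
  exists W : T0, forall w, cmod (F w - fibre_fun W w) <= e.
Proof.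
move=> e0; have /is_C0P [_ /(_ e e0) [K cK KF]] := C0P F.
have cK1 : compact (pi1 @` K).
  apply: continuous_compact => //; apply: continuous_subspaceT; exact: pm_continuous.
have cK2 : compact (pi2 @` K).
  apply: continuous_compact => //; apply: continuous_subspaceT; exact: pm_continuous.
have H0 : forall yz : Y1 * Y2, exists UVc : set Y1 * set Y2 * C,
    [/\ nbhs yz.1 UVc.1.1, nbhs yz.2 UVc.1.2 &
    forall w : Z, UVc.1.1 (pi1 w) -> UVc.1.2 (pi2 w) -> cmod (F w - UVc.2) <= e].
  move=> [y z]; have [U [V [c H]]] := @fibre_small_rectangle F e y z e0.
  by exists (U, V, c).
have {H0} [r Hr] := choice H0.
have H1 : forall z : Y2, exists fp : finite_partition,
    [/\ forall k, is_C0r (fp_fun (f := fp) k) /\ (forall x, 0 <= fp_fun (f := fp) k x),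
        forall k x, ~ (r (fp_pt k, z)).1.1 x -> fp_fun (f := fp) k x = 0,
        forall x, \sum_k fp_fun (f := fp) k x <= 1 &
        forall x, (pi1 @` K) x -> \sum_k fp_fun (f := fp) k x = 1].
  move=> z; have [|m [p [b [_ b1 b2 b3 b4]]]] := @partition_of_unity R Y1 hY1 lY1 _
    (fun y => (r (y, z)).1.1) cK1.
    by move=> y _; case: (Hr (y, z)).
  by exists (FinitePartition p b).
have {H1} [fp Hfp] := choice H1.
have [|m [q [c [_ c1 c2 c3 c4]]]] := @partition_of_unity R Y2 hY2 lY2 _
    (fun z => [set z' | forall k, (r (fp_pt (f := fp z) k, z)).1.2 z']) cK2.
  by move=> z _; apply: filter_forall => k; case: (Hr (fp_pt (f := fp z) k, z)).
pose b j := @fp_fun (fp (q j)); pose s j k := (r (@fp_pt (fp (q j)) k, q j)).2.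
have Cb j k : is_C0r (b j k) by case: (Hfp (q j)) => /(_ k) [].
have b0 j k x : 0 <= b j k x by case: (Hfp (q j)) => H _ _ _; exact: (H k).2.
have Cc j : is_C0r (c j) by case: (c1 j).
have c0 j x : 0 <= c j x by exact: (c1 j).2.
have bS j x : \sum_k b j k x <= 1 by case: (Hfp (q j)) => _ _ H _; exact: H.
exists (\sum_j \sum_k s j k *: tens mu2 (C0_real (Cb j k) : M1) (C0_real (Cc j))) => w.
set y := pi1 w; set z := pi2 w.
have -> : fibre_fun (\sum_j \sum_k s j k *: tens mu2 (C0_real (Cb j k) : M1) (C0_real (Cc j))) w =
    \sum_j \sum_k s j k * (b j k y * c j z)%:C%C.
  rewrite /fibre_fun (tensor_lift_sum fibre_fun_balanced) C0_sum; apply: eq_bigr => j _.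
  rewrite (tensor_lift_sum fibre_fun_balanced) C0_sum; apply: eq_bigr => k _.
  rewrite (tensor_liftZ fibre_fun_balanced) (tensor_lift_tens fibre_fun_balanced) C0Z.
  by rewrite rmorphM.
pose S := \sum_j \sum_k b j k y * c j z.
have SE : S = \sum_j (\sum_k b j k y) * c j z.
  by apply: eq_bigr => j _; rewrite mulr_suml.
have S1 : S <= 1.
  rewrite SE; apply: le_trans (c3 z); apply: ler_sum => j _.
  by rewrite ler_piMl.
have -> : F w - \sum_j \sum_k s j k * (b j k y * c j z)%:C%C =
    F w * (1 - S)%:C%C + \sum_j \sum_k (F w - s j k) * (b j k y * c j z)%:C%C.
  have -> : \sum_j \sum_k (F w - s j k) * (b j k y * c j z)%:C%C =
      F w * S%:C%C - \sum_j \sum_k s j k * (b j k y * c j z)%:C%C.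
    rewrite /S rmorph_sum mulr_sumr -sumrB; apply: eq_bigr => j _.
    rewrite rmorph_sum mulr_sumr -sumrB; apply: eq_bigr => k _.
    exact: mulrBl.
  by rewrite rmorphB rmorph1; ring.
apply: le_trans (cmodD _ _) _.
have -> : e = e * (1 - S) + e * S by ring.
apply: lerD.
  rewrite cmodM cmodR ger0_norm ?subr_ge0 //.
  have [Kw|nKw] := pselect (K w); last first.
    by rewrite ler_wpM2r ?subr_ge0 // ltW // KF.
  suff -> : S = 1 by rewrite subrr !mulr0.
  rewrite SE -(c4 z); last by exists w.
  apply: eq_bigr => j _; case: (Hfp (q j)) => _ _ _ ->; first by rewrite mul1r.
  by exists w.
apply: le_trans (csum_le _ _ _) _; rewrite mulr_sumr; apply: ler_sum => j _.
apply: le_trans (csum_le _ _ _) _; rewrite mulr_sumr; apply: ler_sum => k _.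
rewrite cmodM cmodR ger0_norm ?mulr_ge0 //.
have [Uy|nUy] := pselect ((r (@fp_pt (fp (q j)) k, q j)).1.1 y); last first.
  have -> : b j k y = 0 by case: (Hfp (q j)) => _ H _ _; exact: H.
  by rewrite mul0r !mulr0.
have [Vz|nVz] := pselect ((r (@fp_pt (fp (q j)) k, q j)).1.2 z); last first.
  by rewrite (c2 j z) ?mulr0 // => /(_ k).
rewrite ler_wpM2r ?mulr_ge0 //.
by case: (Hr (@fp_pt (fp (q j)) k, q j)) => _ _; apply.
Qed.

End Density.

(** * Haagerup matrix norms on the completion *)

Section HaagerupMatrixNorm.
Context {R : realType} {X Y : topologicalType}.
Local Notation C := (Cplx R).
Variables (nu : properMap Y X) (V : mnModule R X).
Hypothesis hV : is_matrix_norm (@mn_norm R X V).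

(** A row placed at height i in a matrix of zeros. It is through this inequality that the
    norm of a matrix is controlled by the seminorms of its entries. *)
Definition row_embedding_le : Prop := forall m k (i : 'I_m) (d : 'M[V]_(1, k)),
  mn_norm (\matrix_(i', l) (if i' == i then d ord0 l else 0) : 'M[V]_(m, k)) <= mn_norm d.
Hypothesis hU : row_embedding_le.

Local Notation haag := (@haagerup_norm R X Y nu V _ _).
Local Notation semi := (@haagerup_seminorm R X Y nu V).

Lemma haagerup_lbound m n (F : 'M[tensor nu V]_(m, n)) :
  lbound [set r | exists k (D : 'M[V]_(m, k)) (G : 'M[C0 R Y]_(k, n)),
    F = odot nu D G /\ r = mn_norm D * C0_norm G] 0.
Proof. by move=> r [k [D [G [_ ->]]]]; rewrite mulr_ge0 ?(mxn_ge0 hV) ?C0_norm_ge0. Qed.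

Lemma haagerup_norm_ne m n (F : 'M[tensor nu V]_(m, n)) :
  [set r | exists k (D : 'M[V]_(m, k)) (G : 'M[C0 R Y]_(k, n)),
    F = odot nu D G /\ r = mn_norm D * C0_norm G] !=set0.
Proof. by have [k [D [G E]]] := tensor_odot F; eexists; exists k, D, G. Qed.

Lemma haagerup_norm_ge0 m n (F : 'M[tensor nu V]_(m, n)) : 0 <= haag F.
Proof. by apply: lb_le_inf; [exact: haagerup_norm_ne|exact: haagerup_lbound]. Qed.

Lemma haagerup_norm_le m n k (D : 'M[V]_(m, k)) (G : 'M[C0 R Y]_(k, n)) :
  haag (odot nu D G) <= mn_norm D * C0_norm G.
Proof.
apply: ge_inf; last by exists k, D, G.
by exists 0; exact: haagerup_lbound.
Qed.

Lemma haagerup_norm_adherent m n (F : 'M[tensor nu V]_(m, n)) e : haag F < e ->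
  exists k (D : 'M[V]_(m, k)) (G : 'M[C0 R Y]_(k, n)),
    F = odot nu D G /\ mn_norm D * C0_norm G < e.
Proof.
move=> Fe; have e0 : 0 < e - haag F by rewrite subr_gt0.
have Finf : has_inf [set r | exists k (D : 'M[V]_(m, k)) (G : 'M[C0 R Y]_(k, n)),
    F = odot nu D G /\ r = mn_norm D * C0_norm G].
  by split; [exact: haagerup_norm_ne|exists 0; exact: haagerup_lbound].
have [r [k [D [G [FDG ->]]]]] := inf_adherent e0 Finf.
by rewrite -/(haagerup_norm _) subrKC => h; exists k, D, G.
Qed.

(** Factors of equal norm make factorizations additive: the squares of the norms add
    under concatenation. *)
Lemma haagerup_norm_balanced m n (F : 'M[tensor nu V]_(m, n)) e : haag F < e ->
  exists k (D : 'M[V]_(m, k)) (G : 'M[C0 R Y]_(k, n)),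
    [/\ F = odot nu D G, mn_norm D ^+ 2 <= e & C0_norm G ^+ 2 <= e].
Proof.
move=> Fe; have e0 : 0 < e by apply: le_lt_trans Fe; exact: haagerup_norm_ge0.
have [k [D [G [-> DGe]]]] := haagerup_norm_adherent Fe.
have d0 : 0 <= mn_norm D := mxn_ge0 hV D.
have g0 : 0 <= C0_norm G := C0_norm_ge0 G.
have [d' [dd' d'0 d'g]] : exists d', [/\ mn_norm D <= d', 0 < d' & d' * C0_norm G <= e].
  have [d00|dn0] := eqVneq (mn_norm D) 0; last first.
    by exists (mn_norm D); split=> //; [rewrite lt_neqAle eq_sym dn0|exact: ltW].
  have g1 : 0 < C0_norm G + 1 by rewrite ltr_wpDl.
  exists (e / (C0_norm G + 1)); rewrite d00 divr_ge0 ?(ltW e0) ?(ltW g1) // divr_gt0 //.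
  by split=> //; rewrite mulrAC ler_pdivrMr // ler_wpM2l ?lerDl ?ltW.
have se : 0 < Num.sqrt e by rewrite sqrtr_gt0.
pose t : R := Num.sqrt e / d'.
have t0 : 0 < t by rewrite divr_gt0.
have t0' : (t%:C%C : C) != 0 by rewrite gt_eqF // ltcR.
exists k, (map_mx ( *:%R (t%:C%C : C)) D), (map_mx ( *:%R (t%:C%C : C)^-1) G).
split; first by rewrite odot_scale.
  rewrite -[leRHS](sqr_sqrtr (ltW e0)) ler_sqr ?nnegrE ?(mxn_ge0 hV) ?sqrtr_ge0 //.
  apply: le_trans (mxn_scale hV _ _) _; rewrite cmodR gtr0_norm //.
  by rewrite /t mulrAC ler_pdivrMr // ler_wpM2l ?sqrtr_ge0.
rewrite -[leRHS](sqr_sqrtr (ltW e0)) ler_sqr ?nnegrE ?C0_norm_ge0 ?sqrtr_ge0 //.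
apply: le_trans (mxn_scale C0_matrix_norm _ _) _.
rewrite -fmorphV cmodR gtr0_norm ?invr_gt0 // /t invf_div mulrAC ler_pdivrMr //.
by rewrite -expr2 sqr_sqrtr ?(ltW e0).
Qed.

Lemma haagerup_norm_sqr_le m n k (D : 'M[V]_(m, k)) (G : 'M[C0 R Y]_(k, n)) a : 0 <= a ->
  mn_norm D ^+ 2 <= a -> C0_norm G ^+ 2 <= a -> haag (odot nu D G) <= a.
Proof.
move=> a0 Da Ga; apply: le_trans (haagerup_norm_le _ _) _.
rewrite -[leRHS](sqr_sqrtr a0) expr2; apply: ler_pM.
- exact: mxn_ge0.
- exact: C0_norm_ge0.
- by rewrite -(@ler_sqr R) ?nnegrE ?sqrtr_ge0 ?(mxn_ge0 hV) // sqr_sqrtr.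
- by rewrite -(@ler_sqr R) ?nnegrE ?sqrtr_ge0 ?C0_norm_ge0 // sqr_sqrtr.
Qed.

Lemma haagerup_normD m n (F F' : 'M[tensor nu V]_(m, n)) : haag (F + F') <= haag F + haag F'.
Proof.
apply/ler_addgt0Pr => e e0; have e2 : 0 < e / 2 by rewrite divr_gt0.
have hF : haag F < haag F + e / 2 by rewrite ltrDl.
have hF' : haag F' < haag F' + e / 2 by rewrite ltrDl.
have [k [D [G [-> hD hG]]]] := haagerup_norm_balanced hF.
have [k' [D' [G' [-> hD' hG']]]] := haagerup_norm_balanced hF'.
rewrite -odot_row; apply: haagerup_norm_sqr_le.
- by rewrite !addr_ge0 ?haagerup_norm_ge0 ?ltW.
- apply: le_trans (mxn_row hV _ _) _.
  by apply: le_trans (lerD hD hD') _; rewrite addrACA -splitr.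
- apply: le_trans (mxn_col C0_matrix_norm _ _) _.
  by apply: le_trans (lerD hG hG') _; rewrite addrACA -splitr.
Qed.

Lemma C0_norm_col_embedding k n (j : 'I_n) (g : 'M[C0 R Y]_(k, 1)) :
  C0_norm (\matrix_(l, j') (if j' == j then g l ord0 else 0) : 'M[C0 R Y]_(k, n)) <= C0_norm g.
Proof.
apply: C0_norm_lub => [|y]; first exact: C0_norm_ge0.
apply: le_trans (mxev_le_C0_norm g y).
have -> : mxev y (\matrix_(l, j') (if j' == j then g l ord0 else 0) : 'M[C0 R Y]_(k, n)) =
    mxev y g *m delta_mx ord0 j.
  apply/matrixP => l j'; rewrite !mxE big_ord1 !mxE eqxx /=.
  by case: eqP => _; rewrite ?mulr1 ?mulr0.
apply: le_trans (mxopnormM _ _) _; rewrite ler_piMr ?mxopnorm_ge0 //.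
apply: le_trans (mxopnorm_le_sum _) _; rewrite big_ord1 (bigD1 j) //= big1 ?addr0.
  by rewrite mxE !eqxx cmod1.
by move=> i ij; rewrite mxE (negbTE ij) andbF cmod0.
Qed.

Lemma haagerup_norm_single m n (i : 'I_m) (j : 'I_n) (w : tensor nu V) :
  haag (\matrix_(i', j') if (i' == i) && (j' == j) then w else 0) <= semi w.
Proof.
apply/ler_addgt0Pr => e e0.
have hw : semi w < semi w + e by rewrite ltrDl.
have [k [D [G [wDG hD hG]]]] := haagerup_balanced hV hw.
have -> : \matrix_(i', j') (if (i' == i) && (j' == j) then w else 0) =
  odot nu (\matrix_(i', l) (if i' == i then D ord0 l else 0) : 'M[V]_(m, k))
    (\matrix_(l, j') (if j' == j then G l ord0 else 0) : 'M[C0 R Y]_(k, n)).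
  apply/matrixP => i' j'; rewrite !mxE.
  have [->|ni] /= := eqVneq i' i; last first.
    by rewrite big1 // => l _; rewrite !mxE (negbTE ni) tens0l.
  have [->|nj] /= := eqVneq j' j; last first.
    by rewrite big1 // => l _; rewrite !mxE (negbTE nj) tens0r.
  move/matrixP/(_ ord0 ord0): wDG; rewrite !mxE => ->.
  by apply: eq_bigr => l _; rewrite !mxE !eqxx.
apply: haagerup_norm_sqr_le.
- by rewrite addr_ge0 ?haagerup_ge0 ?ltW.
- apply: le_trans hD; rewrite ler_sqr ?nnegrE ?(mxn_ge0 hV) //; exact: hU.
- apply: le_trans hG; rewrite ler_sqr ?nnegrE ?C0_norm_ge0 //; exact: C0_norm_col_embedding.
Qed.

Lemma haagerup_norm_le_sum m n (F : 'M[tensor nu V]_(m, n)) :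
  haag F <= \sum_i \sum_j semi (F i j).
Proof.
have -> : F = \sum_i \sum_j \matrix_(i', j') if (i' == i) && (j' == j) then F i j else 0.
  apply/matrixP => i' j'; rewrite summxE (bigD1 i') //= [X in _ = _ + X]big1 ?addr0.
    rewrite summxE (bigD1 j') //= mxE !eqxx /= big1 ?addr0 // => j jj.
    by rewrite mxE (eq_sym j') (negbTE jj) andbF.
  move=> i ii; rewrite summxE big1 // => j _.
  by rewrite mxE (eq_sym i') (negbTE ii).
have haag0 : haag (0 : 'M[tensor nu V]_(m, n)) <= 0.
  have -> : 0 = odot nu (0 : 'M[V]_(m, 0)) (0 : 'M[C0 R Y]_(0, n)).
    by apply/matrixP => i j; rewrite !mxE big_ord0.
  apply: haagerup_norm_sqr_le => //.
    have -> : mn_norm (0 : 'M[V]_(m, 0)) = 0; last by rewrite expr0n.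
    apply/eqP; rewrite eq_le (mxn_ge0 hV) andbT.
    have -> : (0 : 'M[V]_(m, 0)) = map_mx ( *:%R 0) 0 by apply/matrixP => ? [].
    by apply: le_trans (mxn_scale hV _ _) _; rewrite cmod0 mul0r.
  have -> : C0_norm (0 : 'M[C0 R Y]_(0, n)) = 0; last by rewrite expr0n.
  apply/eqP; rewrite eq_le C0_norm_ge0 andbT; apply: C0_norm_lub => // y.
  have -> : mxev y (0 : 'M[C0 R Y]_(0, n)) = 0 by apply/matrixP => -[].
  by rewrite mxopnorm0.
set F' := (X in _ <= X); set F0 := (X in haag X).
suff H : haag F0 <= \sum_i \sum_j semi (F i j).
  apply: le_trans H _; apply: ler_sum => i _; apply: ler_sum => j _.
  rewrite /F0 summxE (bigD1 i) //= [X in _ <= semi (_ + X)]big1 ?addr0.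
    rewrite summxE (bigD1 j) //= mxE !eqxx /= big1 ?addr0 // => j' jj.
    by rewrite mxE (eq_sym j) (negbTE jj) andbF.
  move=> i' ii; rewrite summxE big1 // => j' _.
  by rewrite mxE (eq_sym i) (negbTE ii).
have hD (F1 F2 : 'M[tensor nu V]_(m, n)) a1 a2 :
    haag F1 <= a1 -> haag F2 <= a2 -> haag (F1 + F2) <= a1 + a2.
  by move=> h1 h2; apply: le_trans (haagerup_normD _ _) _; exact: lerD.
apply: (big_ind2 (fun F1 a => haag F1 <= a)) => // [F1 a1 F2 a2|i _]; first exact: hD.
apply: (big_ind2 (fun F1 a => haag F1 <= a)) => // [F1 a1 F2 a2|j _]; first exact: hD.
exact: haagerup_norm_single.
Qed.

Lemma haagerup_norm_lip m n (F F' : 'M[tensor nu V]_(m, n)) :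
  haag F <= haag F' + \sum_i \sum_j semi (F i j - F' i j).
Proof.
rewrite -[in leLHS](subrKC F' F); apply: le_trans (haagerup_normD _ _) _.
rewrite lerD2l; apply: le_trans (haagerup_norm_le_sum _) _.
by apply: ler_sum => i _; apply: ler_sum => j _; rewrite !mxE.
Qed.

Local Notation hsn := (haagerup_is_seminorm nu hV).
Local Notation seqV := (cauchySeq semi).

Lemma haag_cauchy_close m n (u v : 'I_m -> 'I_n -> seqV) (e : R) : 0 < e ->
  (forall i j, cs_eq (u i j) (v i j)) ->
  \forall k \near \oo, haag (\matrix_(i, j) u i j k) <= haag (\matrix_(i, j) v i j k) + e.
Proof.
move=> e0 uv.
have h1 : 0 < (m * n)%N%:R + 1 :> R by rewrite ltr_wpDl.
pose d := e / ((m * n)%N%:R + 1); have d0 : 0 < d by rewrite divr_gt0.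
have H : \forall k \near \oo, forall ij : 'I_m * 'I_n,
    semi (u ij.1 ij.2 k - v ij.1 ij.2 k) < d.
  apply: filter_forall => -[i j] /=; have [N HN] := uv i j _ d0.
  by exists N.
apply: filterS H => k Hk; apply: le_trans (haagerup_norm_lip _ (\matrix_(i, j) v i j k)) _.
rewrite lerD2l; apply: (@le_trans _ _ ((m * n)%N%:R * d)).
  rewrite mulr_natl mulnC mulrnA.
  rewrite -[X in _ *+ X]card_ord -sumr_const; apply: ler_sum => i _.
  rewrite -[X in _ *+ X]card_ord -sumr_const; apply: ler_sum => j _.
  by rewrite !mxE; exact: ltW (Hk (i, j)).
by rewrite /d mulrCA -[leRHS]mulr1 ler_pM2l // ler_pdivrMr // mul1r lerDl.
Qed.

Lemma haag_cauchy_cvg m n (u : 'I_m -> 'I_n -> seqV) :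
  cvgn (fun k => haag (\matrix_(i, j) u i j k)).
Proof.
apply/cauchy_cvgP/cauchy_exP => e e0.
have h1 : 0 < (m * n)%N%:R + 1 :> R by rewrite ltr_wpDl.
pose d := e / ((m * n)%N%:R + 1); have d0 : 0 < d by rewrite divr_gt0.
have /choice [N HN] : forall ij : 'I_m * 'I_n, exists N, forall k l, (N <= k)%N -> (N <= l)%N ->
    semi (u ij.1 ij.2 k - u ij.1 ij.2 l) < d.
  by move=> [i j]; have /asboolP := csP (u i j); apply.
pose M := \max_ij N ij.
have NM ij : (N ij <= M)%N by exact: leq_bigmax.
have le k l : (M <= k)%N -> (M <= l)%N ->
    haag (\matrix_(i, j) u i j k) < haag (\matrix_(i, j) u i j l) + e.
  move=> Mk Ml; apply: le_lt_trans (haagerup_norm_lip _ (\matrix_(i, j) u i j l)) _.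
  rewrite ltrD2l; apply: (@le_lt_trans _ _ ((m * n)%N%:R * d)).
    rewrite mulr_natl mulnC mulrnA.
    rewrite -[X in _ *+ X]card_ord -sumr_const; apply: ler_sum => i _.
    rewrite -[X in _ *+ X]card_ord -sumr_const; apply: ler_sum => j _.
    rewrite !mxE; apply/ltW; apply: (HN (i, j)); exact: leq_trans (NM _) _.
  by rewrite /d mulrCA -[ltRHS]mulr1 ltr_pM2l // ltr_pdivrMr // mul1r ltrDl.
exists (haag (\matrix_(i, j) u i j M)); exists M => // k /= Mk.
rewrite /ball /= ltr_norml; have := le M k (leqnn _) Mk; have := le k M Mk (leqnn _).
by move=> h2 h3; apply/andP; split; lra.
Qed.

Local Notation cls u := (@completion_class R (tensor nu V) semi hsn u).

Lemma completion_reprP (u : seqV) : cs_eq (completion_repr (cls u)) u.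
Proof. exact: (@lreprP _ (completion_setoid hsn)). Qed.

Lemma completion_reprK (t : completion hsn) : cls (completion_repr t) = t.
Proof. exact: (@lreprK _ (completion_setoid hsn)). Qed.

Lemma completion_classP (u v : seqV) : cls u = cls v <-> cs_eq u v.
Proof. exact: (@lclassP _ (completion_setoid hsn)). Qed.

Lemma completion_classD (u v : seqV) : cls u + cls v = cls (cs_add hsn u v).
Proof. exact/esym/(@lclassD _ (completion_setoid hsn)). Qed.

Lemma completion_classZ a (u : seqV) : a *: cls u = cls (cs_scale hsn a u).
Proof. exact/esym/(@lclassZ _ (completion_setoid hsn)). Qed.

(** The norm on the completion is defined along chosen representatives; every other
    choice gives the same limit. *)
Lemma haagerup_tensor_norm_cvg m n (F : 'M[haagerup_tensor nu hV]_(m, n))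
    (u : 'I_m -> 'I_n -> seqV) :
  (forall i j, F i j = cls (u i j)) ->
  haag (\matrix_(i, j) u i j k) @[k --> \oo] --> haagerup_tensor_norm F.
Proof.
move=> Fu; set l := haagerup_tensor_norm F.
have cr : haag (\matrix_(i, j) completion_repr (F i j) k) @[k --> \oo] --> l.
  have := @haag_cauchy_cvg m n (fun i j => completion_repr (F i j)). by apply.
have ru i j : cs_eq (completion_repr (F i j)) (u i j) by rewrite Fu; exact: completion_reprP.
apply/(@cvgrPdist_le _ R^o _ \oo _) => e e0; have e2 : 0 < e / 2 by rewrite divr_gt0.
have /(@cvgrPdist_le _ R^o _ \oo _) /(_ _ e2) H1 := cr.
have H2 := haag_cauchy_close e2 (fun i j => cs_eq_sym hsn (ru i j)).
have H3 := haag_cauchy_close e2 ru.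
near=> k.
have h1 : `|l - haag (\matrix_(i, j) completion_repr (F i j) k)| <= e / 2 by near: k.
have h2 : haag (\matrix_(i, j) u i j k) <= haag (\matrix_(i, j) completion_repr (F i j) k) + e / 2.
  by near: k.
have h3 : haag (\matrix_(i, j) completion_repr (F i j) k) <= haag (\matrix_(i, j) u i j k) + e / 2.
  by near: k.
by move: h1; rewrite !ler_norml => /andP[h4 h5]; apply/andP; split; lra.
Unshelve. all: by end_near. Qed.

Lemma is_cauchy_act (c : C0 R Y) (u : seqV) : (fun k => tensor_act c (u k)) \in is_cauchy semi.
Proof.
have [M HM] := tensor_act_bounded nu hV c.
exact: (is_cauchy_map hsn (tensor_actB c) HM (csP u)).
Qed.

Lemma haagerup_tensor_act_class (c : C0 R Y) (u : seqV) :
  haagerup_tensor_act (cls u) c = cls (CauchySeq (is_cauchy_act c u)).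
Proof.
apply/completion_classP => e e0.
have [M HM] := tensor_act_bounded nu hV c.
have M1 : 0 < `|M| + 1 by rewrite ltr_wpDl.
have [N HN] := completion_reprP u (divr_gt0 e0 M1); exists N => k Nk /=.
rewrite -tensor_actB; apply: le_lt_trans (HM _) _.
have := HN k Nk; rewrite ltr_pdivlMr // => h; apply: le_lt_trans h.
rewrite mulrC ler_wpM2l ?(sn_ge0 hsn) //.
by apply: le_trans (ler_norm _) _; rewrite lerDl.
Qed.

End HaagerupMatrixNorm.

(** * Isomorphisms of completions from maps bounded below *)

Section CompletedIsomorphism.
Context {R : realType} {X Y X' Y' : topologicalType}.
Local Notation C := (Cplx R).
Variables (nu : properMap Y X) (V : mnModule R X).
Variables (nu' : properMap Y' X') (V' : mnModule R X').
Hypothesis hV : is_matrix_norm (@mn_norm R X V).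
Hypothesis hV' : is_matrix_norm (@mn_norm R X' V').
Hypothesis hU : row_embedding_le V.
Hypothesis hU' : row_embedding_le V'.
Variables (rho : properMap Y' Y) (T : tensor nu V -> tensor nu' V') (K : R).
Hypothesis K0 : 0 < K.
Hypothesis T_linear : linear T.
Hypothesis T_act : forall c w, T (tensor_act c w) = tensor_act (C0_pull rho c) (T w).
Hypothesis T_contractive : forall n (W : 'M[tensor nu V]_n),
  haagerup_norm (map_mx T W) <= haagerup_norm W.

Local Notation semi := (@haagerup_seminorm R X Y nu V).
Local Notation semi' := (@haagerup_seminorm R X' Y' nu' V').
Local Notation hsn := (haagerup_is_seminorm nu hV).
Local Notation hsn' := (haagerup_is_seminorm nu' hV').
Local Notation seqV := (cauchySeq semi).
Local Notation seqV' := (cauchySeq semi').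
Local Notation cls u := (@completion_class R (tensor nu V) semi hsn u).
Local Notation cls' u := (@completion_class R (tensor nu' V') semi' hsn' u).
Local Notation src := (haagerup_module nu hV).
Local Notation tgt := (Defs.restrict rho (haagerup_module nu' hV')).

Lemma T_sub v w : T (v - w) = T v - T w.
Proof. by rewrite addrC -scaleN1r T_linear scaleN1r addrC. Qed.

Lemma T_add v w : T (v + w) = T v + T w.
Proof. by have := T_linear 1 v w; rewrite !scale1r. Qed.

Lemma T_scale a v : T (a *: v) = a *: T v.
Proof.
have T0 : T 0 = 0 by rewrite -(subrr 0) T_sub subrr.
by have := T_linear a v 0; rewrite T0 !addr0.
Qed.

Lemma map_T_const w : map_mx T (const_mx w) = const_mx (T w) :> 'M_(1, 1).
Proof. by apply/matrixP => i j; rewrite !mxE. Qed.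

Lemma T_semi w : semi' (T w) <= semi w.
Proof.
by have := @T_contractive 1 (const_mx w); rewrite map_T_const.
Qed.

Lemma is_cauchy_image (u : seqV) : (fun k => T (u k)) \in is_cauchy semi'.
Proof.
have /asboolP cu := csP u; apply/asboolP => e /cu [N HN]; exists N => i j Ni Nj.
by rewrite -T_sub; apply: le_lt_trans (T_semi _) _; exact: HN.
Qed.

Definition seq_image (u : seqV) : seqV' := CauchySeq (is_cauchy_image u).

(** The extension of T by continuity. *)
Definition completed_map (t : src) : tgt := cls' (seq_image (completion_repr t)).

Lemma completed_map_class (u : seqV) : completed_map (cls u) = cls' (seq_image u).
Proof.
apply/completion_classP => e e0; have [N HN] := completion_reprP hV u e0.
by exists N => k /HN h /=; rewrite -T_sub; apply: le_lt_trans (T_semi _) _.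
Qed.

Lemma completed_map_in w :
  completed_map (completion_in hsn w) = completion_in hsn' (T w).
Proof. by rewrite completed_map_class; apply/completion_classP; exact: (cs_eq_pw hsn'). Qed.

Lemma completed_map_linear : linear completed_map.
Proof.
move=> a s t; rewrite -(completion_reprK s) -(completion_reprK t).
rewrite completion_classZ completion_classD !completed_map_class.
rewrite [X in _ = X + _]completion_classZ [RHS]completion_classD.
apply/completion_classP/(cs_eq_pw hsn') => k /=.
by rewrite T_add T_scale.
Qed.

Lemma completed_map_act (s : src) c :
  completed_map (mn_act s c) = mn_act (completed_map s) c.
Proof.
rewrite -(completion_reprK s) [mn_act _ _]haagerup_tensor_act_class !completed_map_class.
rewrite [RHS]haagerup_tensor_act_class.
by apply/completion_classP/(cs_eq_pw hsn') => k /=; rewrite T_act.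
Qed.

Lemma completed_map_norms m n (F : 'M[src]_(m, n)) (u : 'I_m -> 'I_n -> seqV) :
  (forall i j, F i j = cls (u i j)) ->
  haagerup_norm (\matrix_(i, j) u i j k) @[k --> \oo] --> mn_norm F /\
  haagerup_norm (map_mx T (\matrix_(i, j) u i j k)) @[k --> \oo] -->
    mn_norm (map_mx completed_map F).
Proof.
move=> Fu; split; first exact: haagerup_tensor_norm_cvg.
have := @haagerup_tensor_norm_cvg R X' Y' nu' V' hV' hU' m n (map_mx completed_map F)
  (fun i j => seq_image (u i j)).
have -> : (fun k => haagerup_norm (\matrix_(i, j) seq_image (u i j) k)) =
    (fun k => haagerup_norm (map_mx T (\matrix_(i, j) u i j k))).
  by apply/funext => k; congr haagerup_norm; apply/matrixP => i j; rewrite !mxE.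
by apply => i j; rewrite mxE Fu completed_map_class.
Qed.

Lemma completed_map_morphism : OM_morphism completed_map.
Proof.
split; first by split; [exact: completed_map_linear|exact: completed_map_act].
exists 1 => n F; rewrite mul1r.
have [c1 c2] := @completed_map_norms n n F (fun i j => completion_repr (F i j))
  (fun i j => esym (completion_reprK _)).
apply: (ler_cvg_to c2 c1); apply: filterE => k; exact: T_contractive.
Qed.

Hypothesis T_below : forall n (W : 'M[tensor nu V]_n),
  haagerup_norm W <= K * haagerup_norm (map_mx T W).
Hypothesis T_dense : forall w e, 0 < e -> exists v, semi' (w - T v) < e.

Lemma T_semi_below w : semi w <= K * semi' (T w).
Proof. by have := @T_below 1 (const_mx w); rewrite map_T_const. Qed.

Lemma completed_map_inj : injective completed_map.
Proof.
move=> s t; rewrite -(completion_reprK s) -(completion_reprK t) !completed_map_class.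
move=> /completion_classP st; apply/completion_classP => e e0.
have [N HN] := st _ (divr_gt0 e0 K0); exists N => k /HN /=.
rewrite -T_sub ltr_pdivlMr // => h; apply: le_lt_trans (T_semi_below _) _.
by rewrite mulrC.
Qed.

(** Preimages of better and better approximations of t form a Cauchy sequence, because T
    is bounded below. *)
Lemma completed_map_surj (t : tgt) : exists s, completed_map s = t.
Proof.
pose v : seqV' := completion_repr t.
have /choice [w Hw] : forall k : nat, exists w, semi' (v k - T w) < k.+1%:R^-1.
  by move=> k; apply: T_dense; rewrite invr_gt0.
have small e : 0 < e -> exists N, forall k, (N <= k)%N -> semi' (v k - T (w k)) < e.
  move=> e0; exists (Num.bound e^-1) => k Nk; apply: lt_trans (Hw k) _.
  rewrite invf_plt ?posrE //; apply: lt_le_trans (archi_boundP _) _.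
    by rewrite invr_ge0 ltW.
  by rewrite ler_nat; exact: leq_trans Nk (leqnSn _).
have cw : w \in is_cauchy semi.
  apply/asboolP => e e0; have e3 : 0 < e / K / 3 by rewrite !divr_gt0.
  have [N1 H1] := small _ e3; have /asboolP /(_ _ e3) [N2 H2] := csP v.
  exists (maxn N1 N2) => i j; rewrite !geq_max => /andP[i1 i2] /andP[j1 j2].
  apply: le_lt_trans (T_semi_below _) _; rewrite mulrC -ltr_pdivlMr // T_sub.
  have -> : T (w i) - T (w j) = - (v i - T (w i)) + ((v i - v j) + (v j - T (w j))).
    by rewrite opprB addrA subrKA subrKA.
  apply: le_lt_trans (sn_add hsn' _ _) _; rewrite (sn_opp hsn').
  have h1 := H1 i i1; have h2 := H1 j j1; have h3 := H2 i j i2 j2.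
  have h4 := sn_add hsn' (v i - v j) (v j - T (w j)).
  lra.
exists (cls (CauchySeq cw)); rewrite completed_map_class -(completion_reprK t).
apply/completion_classP => e e0; have [N HN] := small e e0; exists N => k /HN /= h.
by rewrite -opprB (sn_opp hsn').
Qed.

(** The bound from below passes to the limit for matrices of every size, and so bounds
    the inverse completely. *)
Theorem completed_map_isomorphism : OM_isomorphism completed_map.
Proof.
split; first exact: completed_map_morphism.
have /choice [s sK] := completed_map_surj.
have tK t : s (completed_map t) = t by apply: completed_map_inj; rewrite sK.
exists s; split=> //; split.
  split.
    by move=> a x y; apply: completed_map_inj; rewrite completed_map_linear !sK.
  by move=> x c; apply: completed_map_inj; rewrite completed_map_act !sK.
exists K => n F.
have FE : F = map_mx completed_map (map_mx s F).
  by apply/matrixP => i j; rewrite !mxE sK.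
have [c1 c2] := @completed_map_norms n n (map_mx s F)
  (fun i j => completion_repr (s (F i j)))
  (fun i j => etrans (mxE _ _ _ _) (esym (completion_reprK _))).
rewrite -FE in c2.
have c3 : K * haagerup_norm (map_mx T (\matrix_(i, j) completion_repr (s (F i j)) k))
    @[k --> \oo] --> K * mn_norm F.
  by apply: (@cvgM R); [exact: cvg_cst|exact: c2].
apply: (ler_cvg_to c1 c3); apply: filterE => k; exact: T_below.
Qed.

End CompletedIsomorphism.

(** * The inverse of base change *)

Section OpModuleFacts.
Variables (R : realType) (Y : topologicalType) (E : opModule R Y).
Local Notation C := (Cplx R).
Local Notation H := (om_hilbert E).
Implicit Types (e : E) (a b : C0 R Y).

Lemma om_opD e e' x : om_op (e + e') x = om_op e x + om_op e' x.
Proof. by have := @om_linear R Y E 1 e e'; rewrite !scale1r => ->. Qed.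

Lemma om_op0 x : om_op (0 : E) x = 0.
Proof. by apply: (@addIr _ (om_op (0 : E) x)); rewrite -om_opD !add0r. Qed.

Lemma om_opZ z e x : om_op (z *: e) x = z *: om_op e x.
Proof.
have := @om_linear R Y E z e 0; rewrite addr0 => ->.
by rewrite -[RHS]addr0 -(om_op0 x).
Qed.

Lemma om_op_sum (I : Type) (s : seq I) (P : pred I) (f : I -> E) x :
  om_op (\sum_(i <- s | P i) f i) x = \sum_(i <- s | P i) om_op (f i) x.
Proof. exact: (big_morph (fun e => om_op e x) (fun e e' => om_opD e e' x) (om_op0 x)). Qed.

Lemma om_op_lin_sum e (I : Type) (s : seq I) (P : pred I) (f : I -> H) :
  om_op e (\sum_(i <- s | P i) f i) = \sum_(i <- s | P i) om_op e (f i).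
Proof.
have [l _] := om_bounded e.
have lD x y : om_op e (x + y) = om_op e x + om_op e y by have := l 1 x y; rewrite !scale1r.
have l0 : om_op e 0 = 0 by apply: (@addIr _ (om_op e 0)); rewrite -lD !add0r.
exact: (big_morph _ lD l0).
Qed.

Lemma om_op_eq e e' : (forall x, om_op e x = om_op e' x) -> e = e'.
Proof. by move=> h; apply: om_inj; apply/funext. Qed.

Lemma om_opDr e x y : om_op e (x + y) = om_op e x + om_op e y.
Proof. by have [l _] := om_bounded e; have := l 1 x y; rewrite !scale1r. Qed.

Lemma om_opZr e z x : om_op e (z *: x) = z *: om_op e x.
Proof.
have [l _] := om_bounded e; have := l z x 0.
have -> : om_op e 0 = 0 by apply: (@addIr _ (om_op e 0)); rewrite -om_opDr !add0r.
by rewrite !addr0.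
Qed.

Lemma om_actDl e e' a : om_act (e + e') a = om_act e a + om_act e' a.
Proof. by apply: om_op_eq => x; rewrite om_opD !om_actE om_opD. Qed.

Lemma om_actZl z e a : om_act (z *: e) a = z *: om_act e a.
Proof. by apply: om_op_eq => x; rewrite om_opZ !om_actE om_opZ. Qed.

Lemma om_actDr e a b : om_act e (a + b) = om_act e a + om_act e b.
Proof.
by apply: om_op_eq => x; rewrite om_opD !om_actE (star_repD (@om_repP R Y E)) om_opDr.
Qed.

Lemma om_actZr z e a : om_act e (z *: a) = z *: om_act e a.
Proof.
by apply: om_op_eq => x; rewrite om_opZ !om_actE (star_repZ (@om_repP R Y E)) om_opZr.
Qed.

Lemma om_actA e a b : om_act (om_act e a) b = om_act e (C0_mul a b).
Proof.
by apply: om_op_eq => x; rewrite !om_actE (rep_mul (@om_repP R Y E)).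
Qed.

Definition om_actmx m p k (e : 'M[E]_(m, p)) (D : 'M[C0 R Y]_(p, k)) : 'M[E]_(m, k) :=
  \matrix_(i, j) \sum_l om_act (e i l) (D l j).

(** The operator of e D is the operator of e after the image of D under the
    representation, which is completely contractive. *)
Lemma om_actmx_norm m p k (e : 'M[E]_(m, p)) (D : 'M[C0 R Y]_(p, k)) :
  om_norm (om_actmx e D) <= om_norm e * C0_norm D.
Proof.
apply: opnorm_le => [|xi]; first by rewrite mulr_ge0 ?opnorm_ge0 ?C0_norm_ge0.
have -> : mxapp (fun i j => om_op (om_actmx e D i j)) xi =
    mxapp (fun i j => om_op (e i j)) (repmx (@om_rep R Y E) D xi).
  apply/funext => i; rewrite /mxapp /repmx /mxapp.
  under eq_bigr => j _ do rewrite mxE om_op_sum.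
  rewrite exchange_big /=; apply: eq_bigr => l _.
  by rewrite om_op_lin_sum; apply: eq_bigr => j _; rewrite om_actE.
apply: le_trans (le_opnorm (@hnorm_ge0 R H) (@Defs.hnormD R H) (@hnormZ R H) _ _) _.
  by move=> i j; exact: om_bounded.
rewrite -mulrA ler_wpM2l ?opnorm_ge0 //.
exact: (repmx_contraction (@om_repP R Y E)).
Qed.

Lemma om_row_embedding : row_embedding_le (om_module E).
Proof.
move=> m k i d; apply: opnorm_le => [|xi]; first exact: opnorm_ge0.
set F := \matrix_(i', l) _; set eta := mxapp _ xi.
have h := le_opnorm (@hnorm_ge0 R H) (@Defs.hnormD R H) (@hnormZ R H)
  (fun i j => om_bounded (d i j)) xi.
apply: le_trans h; rewrite le_eqVlt; apply/orP; left; apply/eqP.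
rewrite /vnorm; congr Num.sqrt; rewrite big_ord1 (bigD1 i) //= big1 ?addr0.
  congr (hnorm _ ^+ 2); rewrite /eta /mxapp; apply: eq_bigr => l _.
  by rewrite /F mxE eqxx.
move=> i' ii; rewrite /eta /mxapp big1 => [|l _].
  by rewrite (@N00 R H (@hnorm R H)) ?expr0n //; exact: hnormZ.
by rewrite /F mxE (negbTE ii) om_op0.
Qed.

End OpModuleFacts.

Section BaseChangeInverse.
Variables (R : realType) (X Y1 Y2 : topologicalType).
Hypotheses (hX : hausdorff_space X) (lX : locally_compact [set: X]).
Hypotheses (hY1 : hausdorff_space Y1) (lY1 : locally_compact [set: Y1]).
Hypotheses (hY2 : hausdorff_space Y2) (lY2 : locally_compact [set: Y2]).
Variables (mu1 : properMap Y1 X) (mu2 : properMap Y2 X).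
Variable E : opModule R Y1.
Local Notation C := (Cplx R).
Local Notation M1 := (Defs.restrict mu1 (C0_module R Y1)).
Local Notation T0 := (tensor mu2 M1).
Local Notation Z := (fibre_product mu1 mu2).
Local Notation pi1 := (fibre_fst hX mu1 mu2).
Local Notation pi2 := (fibre_snd hX mu1 mu2).
Local Notation Phi := (@fibre_fun R X Y1 Y2 hX mu1 mu2).
Local Notation E1 := (Defs.restrict mu1 (om_module E)).
Local Notation S := (tensor mu2 E1).
Local Notation S' := (tensor pi1 (om_module E)).
Local Notation PhiP := (fibre_fun_balanced R hX mu1 mu2).

Definition modmul_bil (e : E) (b : M1) (c : C0 R Y2) : S :=
  tens mu2 (om_act e (b : C0 R Y1) : E1) c.

Lemma modmul_balanced e : balanced mu2 (modmul_bil e).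
Proof.
split=> *; rewrite /modmul_bil.
- by rewrite om_actDr (@tensDl R X Y2 mu2 E1).
- by rewrite (@tensDr R X Y2 mu2 E1).
- by rewrite om_actZr (@tensZl R X Y2 mu2 E1).
- by rewrite -(@tensZ R X Y2 mu2 E1) (@tensZl R X Y2 mu2 E1).
- by rewrite -[in RHS](@tens_bal R X Y2 mu2 E1) /= om_actA.
Qed.

(** e . (b (x) c) = e b (x) c, from C_0(Y1) (x) C_0(Y2) to E (x) C_0(Y2), both balanced
    over C_0(X). *)
Definition modmul (e : E) : T0 -> S := tensor_lift (modmul_bil e).

Lemma modmul_tens e (b : C0 R Y1) c : modmul e (tens mu2 (b : M1) c) = tens mu2 (om_act e b : E1) c.
Proof. exact: (tensor_lift_tens (modmul_balanced e)). Qed.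

Lemma modmulD e W W' : modmul e (W + W') = modmul e W + modmul e W'.
Proof. exact: (tensor_liftD (modmul_balanced e)). Qed.

Lemma modmul0 e : modmul e 0 = 0.
Proof. exact: (tensor_lift0 (modmul_balanced e)). Qed.

Lemma modmulB e W W' : modmul e (W - W') = modmul e W - modmul e W'.
Proof. exact: (tensor_liftB (modmul_balanced e)). Qed.

Lemma modmulZ e z W : modmul e (z *: W) = z *: modmul e W.
Proof. exact: (tensor_liftZ (modmul_balanced e)). Qed.

Lemma modmulDl e e' W : modmul (e + e') W = modmul e W + modmul e' W.
Proof.
move: W; apply: tensor_ind => [|b c W IH]; first by rewrite !modmul0 addr0.
by rewrite !modmulD IH !modmul_tens om_actDl (@tensDl R X Y2 mu2 E1) addrACA.
Qed.

Lemma modmulZl e z W : modmul (z *: e) W = z *: modmul e W.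
Proof.
move: W; apply: tensor_ind => [|b c W IH]; first by rewrite !modmul0 scaler0.
by rewrite !modmulD IH !modmul_tens om_actZl (@tensZl R X Y2 mu2 E1) scalerDr.
Qed.

Definition modmulmx m p n (e : 'M[E]_(m, p)) (W : 'M[T0]_(p, n)) : 'M[S]_(m, n) :=
  \matrix_(i, j) \sum_l modmul (e i l) (W l j).

Lemma modmulmx_odot m p k n (e : 'M[E]_(m, p)) (D : 'M[C0 R Y1]_(p, k)) (G : 'M[C0 R Y2]_(k, n)) :
  modmulmx e (odot mu2 (D : 'M[M1]_(p, k)) G) = odot mu2 (om_actmx e D : 'M[E1]_(m, k)) G.
Proof.
apply/matrixP => i j; rewrite !mxE.
under eq_bigr => l _.
  rewrite mxE /modmul (tensor_lift_sum (modmul_balanced _)).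
  under eq_bigr => s _ do rewrite -/(modmul _) modmul_tens.
  over.
rewrite exchange_big /=; apply: eq_bigr => s _.
by rewrite mxE (@tens_suml R X Y2 mu2 E1).
Qed.

Variable N : nat.
Hypothesis fibN : forall x, fibre_card_le mu1 x N \/ fibre_card_le mu2 x N.
Local Notation K := ((4 * N + 3)%N%:R : R).

Let K0 : 0 < K. Proof. by rewrite ltr0n addnS. Qed.
Let hE : is_matrix_norm (@mn_norm R X E1) := om_matrix_norm E.
Let hE' : is_matrix_norm (@mn_norm R Y1 (om_module E)) := om_matrix_norm E.
Let hU : row_embedding_le E1 := @om_row_embedding R Y1 E.
Let hU' : row_embedding_le (om_module E) := @om_row_embedding R Y1 E.
Local Notation semi := (@haagerup_seminorm R X Y2 mu2 E1).
Local Notation semi' := (@haagerup_seminorm R Y1 Z pi1 (om_module E)).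
Local Notation hsn := (haagerup_is_seminorm mu2 hE).
Local Notation seqS := (cauchySeq semi).
Local Notation cls u := (@completion_class R S semi hsn u).

(** [global_factor] turns the bound of W on the fibre product into a factorization
    W = D G, and e . W = (e D) G. *)
Lemma modmulmx_bound m p n (e : 'M[E]_(m, p)) (W : 'M[T0]_(p, n)) (h : R) : 0 < h ->
  (forall w, mxopnorm (mxev w (map_mx Phi W)) <= h) ->
  haagerup_norm (modmulmx e W) <= om_norm e * (K * h).
Proof.
move=> h0; have [k [D [G ->]]] := tensor_odot W => Wh.
have [|k' [D' [G' [-> D'h G'h]]]] :=
  @global_factor R X Y1 Y2 hX lX hY1 lY1 hY2 lY2 mu1 mu2 _ _ _ D G h N h0 _ fibN.
  move=> y z /(fibre_point hX) [w [<- <-]]; rewrite -fibre_fun_odot; exact: Wh.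
have Kh0 : 0 <= K * h by rewrite mulr_ge0 ?ltW.
rewrite modmulmx_odot; apply: le_trans (haagerup_norm_le mu2 hE _ _) _.
rewrite -[in leRHS](sqr_sqrtr Kh0) expr2 mulrA; apply: ler_pM.
- exact: opnorm_ge0.
- exact: C0_norm_ge0.
- apply: le_trans (om_actmx_norm _ _) _; rewrite ler_wpM2l ?opnorm_ge0 //.
  apply: C0_norm_lub => [|y]; first exact: sqrtr_ge0.
  by rewrite -(@ler_sqr R) ?nnegrE ?sqrtr_ge0 ?mxopnorm_ge0 // sqr_sqrtr.
- apply: C0_norm_lub => [|y]; first exact: sqrtr_ge0.
  by rewrite -(@ler_sqr R) ?nnegrE ?sqrtr_ge0 ?mxopnorm_ge0 // sqr_sqrtr.
Qed.

Local Notation nrm e := (om_norm (const_mx e : 'M[E]_(1, 1))).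

Lemma modmul_bound (e : E) (W : T0) (h : R) : 0 < h ->
  (forall w, cmod (Phi W w) <= h) -> semi (modmul e W) <= nrm e * (K * h).
Proof.
move=> h0 Wh.
have -> : semi (modmul e W) =
    haagerup_norm (modmulmx (const_mx e : 'M_(1, 1)) (const_mx W : 'M_(1, 1))).
  congr haagerup_norm; apply/matrixP => i j; by rewrite !mxE big_ord1 !mxE.
apply: modmulmx_bound => // w; apply: le_trans (Wh w).
have -> : mxev w (map_mx Phi (const_mx W)) = const_mx (Phi W w) :> 'M[C]_(1, 1).
  by apply/matrixP => i j; rewrite !mxE.
exact: mxopnorm_const.
Qed.

Lemma fibre_approx_exists (F : C0 R Z) (k : nat) :
  exists W : T0, forall w, cmod (F w - Phi W w) <= k.+1%:R^-1.
Proof. by apply: (fibre_fun_dense hX hY1 lY1 hY2 lY2); rewrite invr_gt0. Qed.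

Definition fibre_approx (F : C0 R Z) (k : nat) : T0 := projT1 (cid (fibre_approx_exists F k)).

Lemma fibre_approxP (F : C0 R Z) k w : cmod (F w - Phi (fibre_approx F k) w) <= k.+1%:R^-1.
Proof. by have := projT2 (cid (fibre_approx_exists F k)); apply. Qed.

Lemma small_inv (B e : R) : 0 <= B -> 0 < e ->
  exists N, forall k, (N <= k)%N -> B / k.+1%:R < e.
Proof.
move=> B0 e0; exists (Num.bound (B / e)) => k Nk.
rewrite ltr_pdivrMr // mulrC -ltr_pdivrMr //.
apply: lt_le_trans (archi_boundP _) _; first by rewrite divr_ge0 // ltW.
by rewrite ler_nat; exact: leq_trans Nk (leqnSn _).
Qed.

Lemma modmul_small (e : E) (u : nat -> T0) (B : R) : 0 <= B ->
  (forall k w, cmod (Phi (u k) w) <= B / k.+1%:R) ->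
  forall d, 0 < d -> exists N, forall k, (N <= k)%N -> semi (modmul e (u k)) < d.
Proof.
move=> B0 uB d d0; have n0 : 0 <= nrm e := opnorm_ge0 _ _.
have c0 : 0 <= (nrm e + 1) * K * (B + 1) by rewrite !mulr_ge0 ?addr_ge0 ?(ltW K0).
have [M HM] := small_inv c0 d0; exists M => k Mk; apply: le_lt_trans (HM k Mk).
have B1 : 0 < (B + 1) / k.+1%:R by rewrite divr_gt0 // ltr_wpDl.
apply: le_trans (@modmul_bound e (u k) _ B1 _) _.
  move=> w; apply: le_trans (uB k w) _; rewrite ler_wpM2r ?invr_ge0 // lerDl //.
rewrite !mulrA ler_wpM2r ?invr_ge0 // ler_wpM2r ?addr_ge0 //.
by rewrite ler_wpM2r ?(ltW K0) // lerDl.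
Qed.

Lemma fibre_approx_cauchy (e : E) (F : C0 R Z) :
  (fun k => modmul e (fibre_approx F k)) \in is_cauchy semi.
Proof.
apply/asboolP => d d0; have n0 : 0 <= nrm e := opnorm_ge0 _ _.
have c0 : 0 <= (nrm e + 1) * K * 2 by rewrite !mulr_ge0 ?addr_ge0 ?(ltW K0).
have [M HM] := small_inv c0 d0; exists M => i j Mi Mj; apply: le_lt_trans (HM M (leqnn _)).
rewrite -modmulB.
have B1 : 0 < 2 / M.+1%:R :> R by rewrite divr_gt0.
apply: le_trans (@modmul_bound e _ _ B1 _) _; last first.
  by rewrite !mulrA ler_wpM2r ?invr_ge0 // ler_wpM2r // ler_wpM2r ?(ltW K0) // lerDl.
move=> w; rewrite /fibre_fun (tensor_liftB PhiP) -/Phi.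
have -> : (Phi (fibre_approx F i) - Phi (fibre_approx F j)) w =
    (F w - Phi (fibre_approx F j) w) - (F w - Phi (fibre_approx F i) w).
  change (Phi (fibre_approx F i) w - Phi (fibre_approx F j) w =
    (F w - Phi (fibre_approx F j) w) - (F w - Phi (fibre_approx F i) w)); ring.
apply: le_trans (cmodD _ _) _; rewrite cmodN.
have le k : (M <= k)%N -> cmod (F w - Phi (fibre_approx F k) w) <= M.+1%:R^-1.
  move=> Mk; apply: le_trans (fibre_approxP F k w) _.
  by rewrite lef_pV2 ?posrE // ler_nat.
by rewrite mulrDl mul1r; apply: lerD; exact: le.
Qed.

(** The limit of e . W_k when W_k tends to F uniformly on the fibre product: the value
    on e (x) F of the inverse of base change. *)
Definition inverse_tens (e : om_module E) (F : C0 R Z) : completion hsn :=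
  cls (CauchySeq (fibre_approx_cauchy e F)).

(** By [modmul_bound] the limit does not depend on the approximations. Every identity
    below follows by transforming approximations exactly. *)
Lemma inverse_tens_limit (e : E) (F : C0 R Z) (u : nat -> T0) (v : seqS) (B : R) : 0 <= B ->
  (forall k w, cmod (F w - Phi (u k) w) <= B / k.+1%:R) ->
  (forall k, v k = modmul e (u k)) -> inverse_tens e F = cls v.
Proof.
move=> B0 uF vu; apply/completion_classP => d d0.
have B1 : 0 <= 1 + B by rewrite addr_ge0.
have uB k w : cmod (Phi (fibre_approx F k - u k) w) <= (1 + B) / k.+1%:R.
  rewrite /fibre_fun (tensor_liftB PhiP) -/Phi.
  have -> : (Phi (fibre_approx F k) - Phi (u k)) w =
      (F w - Phi (u k) w) - (F w - Phi (fibre_approx F k) w).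
    change (Phi (fibre_approx F k) w - Phi (u k) w =
      (F w - Phi (u k) w) - (F w - Phi (fibre_approx F k) w)); ring.
  apply: le_trans (cmodD _ _) _; rewrite cmodN mulrDl mul1r addrC.
  by apply: lerD; [exact: fibre_approxP|exact: uF].
have [M HM] := modmul_small e B1 uB d0.
by exists M => k /HM; rewrite modmulB vu.
Qed.

Definition algmul_bil (a : C0 R Y1) (b : M1) (c : C0 R Y2) : T0 :=
  tens mu2 (C0_mul a (b : C0 R Y1) : M1) c.

Lemma algmul_balanced a : balanced mu2 (algmul_bil a).
Proof.
split=> [b b' c|b c c'|z b c|z b c|b x c]; rewrite /algmul_bil.
- rewrite -(@tensDl R X Y2 mu2 M1); congr (tens _ _ _); apply: C0_eq => y; exact: mulrDr.
- exact: tensDr.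
- rewrite -(@tensZl R X Y2 mu2 M1); congr (tens _ _ _); apply: C0_eq => y; exact: mulrCA.
- by rewrite -(@tensZ R X Y2 mu2 M1) (@tensZl R X Y2 mu2 M1).
- rewrite -[RHS](@tens_bal R X Y2 mu2 M1); congr (tens _ _ _); apply: C0_eq => y; exact: mulrA.
Qed.

Definition algmul a : T0 -> T0 := tensor_lift (algmul_bil a).

Lemma modmul_act e a W : modmul (om_act e a) W = modmul e (algmul a W).
Proof.
have P := algmul_balanced a.
move: W; apply: tensor_ind => [|b c W IH]; first by rewrite /algmul (tensor_lift0 P) !modmul0.
rewrite /algmul (tensor_liftD P) -/(algmul a) !modmulD IH /algmul (tensor_lift_tens P) /algmul_bil.
by rewrite !modmul_tens om_actA.
Qed.

Lemma fibre_fun_algmul a W : Phi (algmul a W) = C0_mul (C0_pull pi1 a) (Phi W).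
Proof.
have P := algmul_balanced a; have Q := PhiP.
move: W; apply: tensor_ind => [|b c W IH].
  rewrite /algmul (tensor_lift0 P) /fibre_fun (tensor_lift0 Q).
  by apply: C0_eq => w; rewrite /= mulr0.
rewrite /algmul (tensor_liftD P) -/(algmul a) {1}/fibre_fun (tensor_liftD Q) -/Phi IH.
rewrite [in RHS]/fibre_fun (tensor_liftD Q) -/Phi /algmul (tensor_lift_tens P) /algmul_bil.
rewrite /fibre_fun !(tensor_lift_tens Q); apply: C0_eq => w.
rewrite C0D [RHS]mulrDr; congr (_ + _); exact/esym/mulrA.
Qed.

Lemma inverse_tens_balanced : balanced pi1 inverse_tens.
Proof.
split=> [e e' F|e F F'|z e F|z e F|e a F].
- rewrite [RHS]completion_classD; apply/completion_classP/(cs_eq_pw hsn) => k /=.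
  exact: modmulDl.
- rewrite [RHS]completion_classD.
  apply: (@inverse_tens_limit e _ (fun k => fibre_approx F k + fibre_approx F' k) _ 2) => // [k w|k /=].
    rewrite /fibre_fun (tensor_liftD PhiP) -/Phi.
    have -> : (F + F') w - (Phi (fibre_approx F k) + Phi (fibre_approx F' k)) w =
        (F w - Phi (fibre_approx F k) w) + (F' w - Phi (fibre_approx F' k) w).
      rewrite !C0D; ring.
    apply: le_trans (cmodD _ _) _; rewrite mulrDl mul1r.
    by apply: lerD; exact: fibre_approxP.
  by rewrite modmulD.
- rewrite [RHS]completion_classZ; apply/completion_classP/(cs_eq_pw hsn) => k /=.
  exact: modmulZl.
- rewrite [RHS]completion_classZ.
  apply: (@inverse_tens_limit e _ (fun k => z *: fibre_approx F k) _ (cmod z)) => [|k w|k /=].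
  + exact: cmod_ge0.
  + rewrite /fibre_fun (tensor_liftZ PhiP) -/Phi !C0Z -mulrBr cmodM.
    by rewrite ler_wpM2l ?cmod_ge0 // fibre_approxP.
  + by rewrite modmulZ.
- have [M M0 HM] := is_C0_bounded (C0P a).
  apply/esym/(@inverse_tens_limit e _ (fun k => algmul a (fibre_approx F k)) _ M M0) => [k w|k /=].
    rewrite fibre_fun_algmul /= -mulrBr cmodM.
    by apply: ler_pM; rewrite ?cmod_ge0 ?HM ?fibre_approxP.
  exact: modmul_act.
Qed.

Definition base_change_bil (e : E1) (c : C0 R Y2) : S' := tens pi1 (e : om_module E) (C0_pull pi2 c).

Lemma base_change_balanced : balanced mu2 base_change_bil.
Proof.
split=> [e e' c|e c c'|z e c|z e c|e a c]; rewrite /base_change_bil.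
- exact: tensDl.
- have -> : C0_pull pi2 (c + c') = C0_pull pi2 c + C0_pull pi2 c' by apply: C0_eq.
  exact: tensDr.
- exact: tensZl.
- have -> : C0_pull pi2 (z *: c) = z *: C0_pull pi2 c by apply: C0_eq.
  by rewrite -tensZ tensZl.
- rewrite [LHS](@tens_bal R Y1 Z pi1 (om_module E)); congr (tens _ _ _); apply: C0_eq => w /=.
  by rewrite fibre_productE.
Qed.

(** As mu_1 is proper, so is pi_2, and pi_2^* c is in C_0 of the fibre product: the formula
    e b (x) c |-> e (x) pi_1^* b pi_2^* c becomes e (x) c |-> e (x) pi_2^* c. *)
Definition base_change : S -> S' := tensor_lift base_change_bil.

Lemma base_change_tens e c :
  base_change (tens mu2 (e : E1) c) = tens pi1 (e : om_module E) (C0_pull pi2 c).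
Proof. exact: (tensor_lift_tens base_change_balanced). Qed.

Lemma base_change_odot m k n (D : 'M[E]_(m, k)) (G : 'M[C0 R Y2]_(k, n)) :
  map_mx base_change (odot mu2 (D : 'M[E1]_(m, k)) G) =
  odot pi1 (D : 'M[om_module E]_(m, k)) (map_mx (C0_pull pi2) G).
Proof.
apply/matrixP => i j; rewrite !mxE /base_change (tensor_lift_sum base_change_balanced).
by apply: eq_bigr => l _; rewrite mxE -/base_change base_change_tens.
Qed.

Lemma base_change_contractive n (W : 'M[S]_n) : haagerup_norm (map_mx base_change W) <= haagerup_norm W.
Proof.
apply/ler_addgt0Pr => d d0.
have [|k [D [G [-> DG]]]] := @haagerup_norm_adherent R X Y2 mu2 E1 hE n n W (haagerup_norm W + d).
  by rewrite ltrDl.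
apply: le_trans (ltW DG); rewrite base_change_odot; apply: le_trans (haagerup_norm_le pi1 hE' _ _) _.
apply: ler_wpM2l; first exact: opnorm_ge0.
apply: C0_norm_lub => [|w]; first exact: C0_norm_ge0.
have -> : mxev w (map_mx (C0_pull pi2) G) = mxev (pi2 w) G.
  by apply/matrixP => i j; rewrite !mxE.
exact: mxev_le_C0_norm.
Qed.

Lemma base_change_act c w : base_change (tensor_act c w) = tensor_act (C0_pull pi2 c) (base_change w).
Proof.
have P := base_change_balanced.
have act0 (c' : C0 R Y2) : tensor_act c' (0 : S) = 0.
  by apply: (@addIr _ (tensor_act c' (0 : S))); rewrite -tensor_actD !add0r.
have act0' (c' : C0 R Z) : tensor_act c' (0 : S') = 0.
  by apply: (@addIr _ (tensor_act c' (0 : S'))); rewrite -tensor_actD !add0r.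
move: w; apply: tensor_ind => [|e b w IH].
  by rewrite act0 /base_change (tensor_lift0 P) act0'.
rewrite tensor_actD /base_change !(tensor_liftD P) -/base_change IH tensor_actD tensor_act_tens.
rewrite !base_change_tens.
by rewrite tensor_act_tens; congr (tens _ _ _ + _); apply: C0_eq.
Qed.

Lemma base_change_modmul e W : base_change (modmul e W) = tens pi1 (e : om_module E) (Phi W).
Proof.
have P := base_change_balanced; have Q := PhiP.
move: W; apply: tensor_ind => [|b c W IH].
  by rewrite modmul0 /base_change (tensor_lift0 P) /fibre_fun (tensor_lift0 Q) tens0r.
rewrite modmulD /base_change (tensor_liftD P) -/base_change IH modmul_tens base_change_tens.
rewrite /fibre_fun (tensor_liftD Q) tensDr (tensor_lift_tens Q); congr (_ + _).
exact: (@tens_bal R Y1 Z pi1 (om_module E)).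
Qed.

(** [base_change_modmul] reaches e (x) F whenever F is the function of a tensor. *)
Lemma base_change_dense w d : 0 < d -> exists v, semi' (w - base_change v) < d.
Proof.
have P := base_change_balanced; have hsn' := haagerup_is_seminorm pi1 hE'.
move: w d; apply: tensor_ind => [|e F w IH] d d0.
  by exists 0; rewrite /base_change (tensor_lift0 P) subrr (sn_zero hsn').
have d2 : 0 < d / 2 by rewrite divr_gt0.
have [v Hv] := IH _ d2.
have n0 : 0 <= nrm e := opnorm_ge0 _ _.
have n1 : 0 < nrm e + 1 by rewrite ltr_wpDl.
have dn : 0 < d / 2 / (nrm e + 1) by rewrite divr_gt0.
have [W HW] := fibre_fun_dense hX hY1 lY1 hY2 lY2 F dn.
exists (modmul e W + v).
rewrite /base_change (tensor_liftD P) -/base_change opprD addrACA base_change_modmul.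
apply: le_lt_trans (sn_add hsn' _ _) _; rewrite [ltRHS]splitr; apply: ler_ltD => //.
have -> : tens pi1 (e : om_module E) F - tens pi1 (e : om_module E) (Phi W) =
    tens pi1 (e : om_module E) (F - Phi W).
  by rewrite -scaleN1r -tensZl tensZ -tensDr scaleN1r.
have E0 : const_mx (tens pi1 (e : om_module E) (F - Phi W)) =
    odot pi1 (const_mx e : 'M[om_module E]_(1, 1)) (const_mx (F - Phi W)) :> 'M_(1, 1).
  by apply/matrixP => i j; rewrite !mxE big_ord1 !mxE.
apply: le_trans (haagerup_le hE' E0) _.
apply: (@le_trans _ _ (nrm e * (d / 2 / (nrm e + 1)))).
  apply: ler_wpM2l => //; apply: C0_norm_lub => [|w']; first exact: ltW.
  apply: le_trans (HW w').
  have -> : mxev w' (const_mx (F - Phi W)) = const_mx (F w' - Phi W w') :> 'M[C]_(1, 1).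
    by apply/matrixP => i j; rewrite !mxE.
  exact: mxopnorm_const.
by rewrite mulrA ler_pdivrMr // mulrC ler_wpM2l ?(ltW d2) // lerDl.
Qed.

(** Nondegeneracy gives e = e' b, and pi_1^* b pi_2^* c is exactly the function of
    b (x) c, so a constant sequence of approximations can be used. *)
Lemma inverse_tens_base_change w : tensor_lift inverse_tens (base_change w) = completion_in hsn w.
Proof.
have P := base_change_balanced; have Q := inverse_tens_balanced.
have in0 : completion_in hsn 0 = 0 by [].
move: w; apply: tensor_ind => [|e c w IH].
  by rewrite /base_change (tensor_lift0 P) (tensor_lift0 Q) in0.
rewrite /base_change (tensor_liftD P) -/base_change (tensor_liftD Q) IH
  base_change_tens (tensor_lift_tens Q).
have -> : completion_in hsn (tens mu2 e c + w) =
    completion_in hsn (tens mu2 e c) + completion_in hsn w.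
  by rewrite [RHS]completion_classD; apply/completion_classP/(cs_eq_pw hsn).
congr (_ + _); have [e' [b eE]] := om_nondegenerate e; rewrite eE.
rewrite [LHS](bal_act Q e' b (C0_pull pi2 c)).
apply: (@inverse_tens_limit e' _ (fun=> tens mu2 (b : M1) c) _ 0) => // [k w'|k].
  rewrite /fibre_fun (tensor_lift_tens PhiP) /fibre_fun_bil /= subrr cmod0 mul0r //.
by rewrite modmul_tens.
Qed.

Lemma completion_class_sum n (u : 'I_n -> seqS) :
  exists v : seqS, (forall k, v k = \sum_l u l k) /\ cls v = \sum_l cls (u l).
Proof.
elim: n u => [|n IH] u.
  exists (cs_cst hsn 0); split=> [k|]; first by rewrite big_ord0.
  by rewrite big_ord0.
have [v [vE vc]] := IH (fun l => u (lift ord0 l)).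
exists (cs_add hsn (u ord0) v); split=> [k|]; first by rewrite big_ord_recl /= vE.
by rewrite -completion_classD vc big_ord_recl.
Qed.

(** Any factorization D F of the image of W exhibits W as the limit of D . W_k, where W_k
    approximates F entrywise, and [modmulmx_bound] bounds D . W_k. *)
Lemma base_change_below n (W : 'M[S]_n) : haagerup_norm W <= K * haagerup_norm (map_mx base_change W).
Proof.
rewrite mulrC -ler_pdivrMr //; apply: lb_le_inf; first exact: haagerup_norm_ne.
move=> r [k [D [F [TW ->]]]]; rewrite ler_pdivrMr //.
have D0 : 0 <= om_norm D := opnorm_ge0 _ _.
have F0 : 0 <= C0_norm F := C0_norm_ge0 _.
apply/ler_addgt0Pr => d d0; have d2 : 0 < d / 2 by rewrite divr_gt0.
have /choice [v Hv] : forall ij : 'I_n * 'I_n, exists v : seqS,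
    (forall s, v s = \sum_l modmul (D ij.1 l) (fibre_approx (F l ij.2) s)) /\
    cs_eq (cs_cst hsn (W ij.1 ij.2)) v.
  move=> [i j] /=.
  have [v [vE vc]] := completion_class_sum (fun l => CauchySeq (fibre_approx_cauchy (D i l) (F l j))).
  exists v; split=> //; apply/(completion_classP hE).
  rewrite vc -[LHS](inverse_tens_base_change (W i j)).
  have -> : base_change (W i j) = \sum_l tens pi1 (D i l : om_module E) (F l j).
    by move/matrixP/(_ i j): TW; rewrite !mxE.
  rewrite (tensor_lift_sum inverse_tens_balanced); apply: eq_bigr => l _.
  by rewrite (tensor_lift_tens inverse_tens_balanced).
have H1 := haag_cauchy_close hE hU d2 (fun i j => (Hv (i, j)).2).
(* The error eta on F costs om_norm D * K * eta, at most d / 2. *)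
pose eta := d / 2 / ((om_norm D + 1) * K).
have DK : 0 < (om_norm D + 1) * K by rewrite mulr_gt0 // ltr_wpDl.
have eta0 : 0 < eta by rewrite divr_gt0.
have [M HM] := small_inv (ler0n R (k * n)) eta0.
have [s [Ms Hs]] : exists s, (M <= s)%N /\
    haagerup_norm (\matrix_(i, j) cs_cst hsn (W i j) s) <=
    haagerup_norm (\matrix_(i, j) v (i, j) s) + d / 2.
  have [M' _ HM'] := H1; exists (maxn M M'); split; first exact: leq_maxl.
  by apply: HM'; exact: leq_maxr.
have WE : \matrix_(i, j) cs_cst hsn (W i j) s = W by apply/matrixP => i j; rewrite !mxE.
rewrite WE in Hs; apply: le_trans Hs _.
have vE : \matrix_(i, j) v (i, j) s = modmulmx D (map_mx (fun f => fibre_approx f s) F).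
  apply/matrixP => i j; rewrite !mxE (Hv (i, j)).1; apply: eq_bigr => l _; by rewrite !mxE.
have Fe : 0 < C0_norm F + eta by rewrite ltr_wpDl.
have := @modmulmx_bound _ _ _ D (map_mx (fun f => fibre_approx f s) F) _ Fe; rewrite -vE => h.
rewrite [d in leRHS]splitr addrA lerD2r; apply: le_trans (h _) _.
  move=> w; have -> : mxev w (map_mx Phi (map_mx (fun f => fibre_approx f s) F)) =
      mxev w F - (\matrix_(i, j) (F i j w - Phi (fibre_approx (F i j) s) w)).
    by apply/matrixP => i j; rewrite !mxE opprB subrKC.
  apply: le_trans (mxopnormD _ _) _; apply: lerD; first exact: mxev_le_C0_norm.
  apply: le_trans (mxopnorm_le_sum _) _; apply: le_trans (ltW (HM s Ms)).
  rewrite mulr_natl mulnC mulrnA.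
  rewrite -[X in _ *+ X]card_ord -sumr_const; apply: ler_sum => i _.
  rewrite -[X in _ *+ X]card_ord -sumr_const; apply: ler_sum => j _.
  rewrite !mxE cmodN; exact: fibre_approxP.
have -> : om_norm D * (K * (C0_norm F + eta)) = om_norm D * C0_norm F * K + om_norm D * K * eta.
  ring.
rewrite lerD2l /eta mulrA ler_pdivrMr // mulrC ler_wpM2l ?(ltW d2) //.
by rewrite ler_wpM2r ?(ltW K0) // lerDl.
Qed.

Theorem base_change_isomorphism :
  exists t, @is_base_change_map R X Y1 Y2 hX mu1 mu2 E t /\ OM_isomorphism t.
Proof.
have Tl : linear base_change := tensor_lift_linear base_change_balanced.
exists (@completed_map R X Y2 Y1 Z mu2 E1 pi1 (om_module E) hE hE'
  pi2 base_change Tl base_change_contractive).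
split; last first.
  exact: (@completed_map_isomorphism R X Y2 Y1 Z mu2 E1 pi1 (om_module E) hE hE' hU hU'
    pi2 base_change K K0 Tl base_change_act base_change_contractive base_change_below
    base_change_dense).
split.
  exact: (@completed_map_morphism R X Y2 Y1 Z mu2 E1 pi1 (om_module E) hE hE' hU hU'
    pi2 base_change Tl base_change_act base_change_contractive).
move=> e b c; rewrite [LHS](completed_map_in hE hE' pi2 Tl base_change_contractive) base_change_tens.
by congr completion_in; exact: (@tens_bal R Y1 Z pi1 (om_module E)).
Qed.

End BaseChangeInverse.

(** * Unordered sums *)

Section Summation.
Variables (R : realType) (I : choiceType).
Local Notation C := (Cplx R).
Implicit Types (s t : {fset I}) (u v : I -> C).

Definition psum (V : nmodType) (u : I -> V) s : V := \sum_(i <- enum_fset s) u i.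

Lemma psum_sub (u : I -> R) s t : (forall i, 0 <= u i) -> (s `<=` t)%fset ->
  psum u s <= psum u t.
Proof.
move=> u0 st; rewrite /psum (big_fsetID _ (mem s) t) /=.
have -> : [fset x in t | x \in s]%fset = s.
  by apply/fsetP => x; rewrite !inE andbC; case: (boolP (x \in s)) => // /(fsubsetP st).
by rewrite lerDl; apply: sumr_ge0.
Qed.

Definition real_sum_to (u : I -> R) (l : R) : Prop := forall e : R, 0 < e ->
  exists s, forall t, (s `<=` t)%fset -> `|psum u t - l| < e.

Definition sum_to (u : I -> C) (l : C) : Prop := forall e : R, 0 < e ->
  exists s, forall t, (s `<=` t)%fset -> cmod (psum u t - l) < e.

Lemma real_sum_nneg (u : I -> R) M : (forall i, 0 <= u i) -> (forall s, psum u s <= M) ->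
  real_sum_to u (sup (range (psum u))).
Proof.
move=> u0 uM e e0.
have hs : has_sup (range (psum u)).
  by split; [exists (psum u fset0); exists fset0|exists M => _ [s _ <-]].
have [_ [s _ <-] hse] := sup_adherent e0 hs.
exists s => t st; have := psum_sub u0 st; have : psum u t <= sup (range (psum u)).
  by apply: ub_le_sup; [case: hs|exists t].
by move=> h1 h2; rewrite ltr_norml; apply/andP; split; lra.
Qed.

(** Both u + v and v are nonnegative with bounded partial sums. *)
Lemma real_sum_dominated (u v : I -> R) M : (forall i, `|u i| <= v i) ->
  (forall s, psum v s <= M) -> exists l, real_sum_to u l.
Proof.
move=> uv vM; have v0 i : 0 <= v i by apply: le_trans (uv i).
have w0 i : 0 <= u i + v i by have := uv i; rewrite ler_norml => /andP[]; lra.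
have wM s : psum (fun i => u i + v i) s <= M + M.
  apply: (@le_trans _ _ (psum v s + psum v s)); last exact: lerD.
  rewrite /psum -big_split; apply: ler_sum => i _ /=.
  by rewrite lerD2r; apply: le_trans (uv i); exact: ler_norm.
exists (sup (range (psum (fun i => u i + v i))) - sup (range (psum v))) => e e0.
have e2 : 0 < e / 2 by rewrite divr_gt0.
have [s1 H1] := real_sum_nneg w0 wM e2; have [s2 H2] := real_sum_nneg v0 vM e2.
exists (s1 `|` s2)%fset => t; rewrite fsubUset => /andP[/H1 h1 /H2 h2].
have E : psum (fun i => u i + v i) t = psum u t + psum v t by rewrite /psum big_split.
rewrite E in h1; move: h1 h2; rewrite !ltr_norml => /andP[h1 h2] /andP[h3 h4].
by apply/andP; split; lra.
Qed.

Lemma cmod_le_Re_Im (z : C) : cmod z <= `|complex.Re z| + `|complex.Im z|.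
Proof.
case: z => a b /=; rewrite /cmod /=.
rewrite -(@ler_sqr R) ?nnegrE ?sqrtr_ge0 ?addr_ge0 // sqr_sqrtr ?addr_ge0 ?sqr_ge0 //.
by rewrite sqrrD !real_normK ?num_real // lerD2r lerDl mulrn_wge0 // mulr_ge0.
Qed.

Lemma Re_le_cmod (z : C) : `|complex.Re z| <= cmod z.
Proof.
case: z => a b /=; rewrite /cmod /=.
by rewrite -sqrtr_sqr ler_sqrt ?addr_ge0 ?sqr_ge0 // lerDl sqr_ge0.
Qed.

Lemma Im_le_cmod (z : C) : `|complex.Im z| <= cmod z.
Proof.
case: z => a b /=; rewrite /cmod /=.
by rewrite -sqrtr_sqr ler_sqrt ?addr_ge0 ?sqr_ge0 // lerDr sqr_ge0.
Qed.

Lemma psum_Re u s : complex.Re (psum u s) = psum (fun i => complex.Re (u i)) s.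
Proof. by rewrite /psum; elim/big_rec2: _ => // i x y _ <-; case: (u i); case: y. Qed.

Lemma psum_Im u s : complex.Im (psum u s) = psum (fun i => complex.Im (u i)) s.
Proof. by rewrite /psum; elim/big_rec2: _ => // i x y _ <-; case: (u i); case: y. Qed.

Lemma sum_dominated u (v : I -> R) M : (forall i, cmod (u i) <= v i) ->
  (forall s, psum v s <= M) -> exists l, sum_to u l.
Proof.
move=> uv vM.
have [|a Ha] := @real_sum_dominated (fun i => complex.Re (u i)) v M _ vM.
  by move=> i; apply: le_trans (uv i); exact: Re_le_cmod.
have [|b Hb] := @real_sum_dominated (fun i => complex.Im (u i)) v M _ vM.
  by move=> i; apply: le_trans (uv i); exact: Im_le_cmod.
exists (a +i* b)%C => e e0; have e2 : 0 < e / 2 by rewrite divr_gt0.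
have [s1 H1] := Ha _ e2; have [s2 H2] := Hb _ e2.
exists (s1 `|` s2)%fset => t; rewrite fsubUset => /andP[/H1 h1 /H2 h2].
apply: le_lt_trans (cmod_le_Re_Im _) _; rewrite [ltRHS]splitr; apply: ltrD.
  by move: h1; rewrite -psum_Re; case: (psum u t).
by move: h2; rewrite -psum_Im; case: (psum u t).
Qed.

Lemma sum_to_unique u l l' : sum_to u l -> sum_to u l' -> l = l'.
Proof.
move=> ul ul'; apply/eqP; rewrite -subr_eq0 -normr_eq0 cmodE; apply/eqP.
congr (_%:C%C); apply/eqP; rewrite eq_le cmod_ge0 andbT; apply/ler_addgt0Pr => e e0; rewrite add0r.
have e2 : 0 < e / 2 by rewrite divr_gt0.
have [s1 H1] := ul _ e2; have [s2 H2] := ul' _ e2.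
have h1 := H1 _ (fsubsetUl s1 s2); have h2 := H2 _ (fsubsetUr s1 s2).
have -> : l - l' = (psum u (s1 `|` s2)%fset - l') - (psum u (s1 `|` s2)%fset - l) by ring.
apply: le_trans (cmodD _ _) _; rewrite cmodN (splitr e).
by apply: ltW; exact: ltrD.
Qed.

Definition lsum u : C := xget 0 [set l | sum_to u l].

Lemma lsumE u l : sum_to u l -> lsum u = l.
Proof.
move=> ul; apply: (@sum_to_unique u) => //.
by rewrite /lsum; case: xgetP => // /(_ l).
Qed.

Lemma sum_toD u v l m : sum_to u l -> sum_to v m -> sum_to (fun i => u i + v i) (l + m).
Proof.
move=> ul vm e e0; have e2 : 0 < e / 2 by rewrite divr_gt0.
have [s1 H1] := ul _ e2; have [s2 H2] := vm _ e2.
exists (s1 `|` s2)%fset => t; rewrite fsubUset => /andP[/H1 h1 /H2 h2].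
have -> : psum (fun i => u i + v i) t - (l + m) = (psum u t - l) + (psum v t - m).
  by rewrite /psum big_split /= opprD addrACA.
by apply: le_lt_trans (cmodD _ _) _; rewrite [ltRHS]splitr; exact: ltrD.
Qed.

Lemma sum_toZ a u l : sum_to u l -> sum_to (fun i => a * u i) (a * l).
Proof.
move=> ul e e0; have a1 : 0 < cmod a + 1 by rewrite ltr_wpDl ?cmod_ge0.
have [s H] := ul _ (divr_gt0 e0 a1); exists s => t /H.
rewrite ltr_pdivlMr // => h.
have -> : psum (fun i => a * u i) t - a * l = a * (psum u t - l).
  by rewrite /psum -mulr_sumr mulrBr.
rewrite cmodM; apply: le_lt_trans h; rewrite mulrC ler_wpM2l ?cmod_ge0 //.
by rewrite lerDl.
Qed.

Lemma sum_toJ u l : sum_to u l -> sum_to (fun i => Num.conj (u i)) (Num.conj l).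
Proof.
move=> ul e /ul [s H]; exists s => t /H.
have -> : psum (fun i => Num.conj (u i)) t - Num.conj l = Num.conj (psum u t - l).
  by rewrite rmorphB /psum rmorph_sum.
by rewrite cmodJ.
Qed.

End Summation.

(** * The Hilbert space of square-summable families *)

Section SquareSummable.
Variables (R : realType) (I : choiceType).
Local Notation C := (Cplx R).
Local Notation psq f := (psum (fun i => cmod (f i) ^+ 2)).

Definition is_ell2 : {pred I -> C} := fun f => `[< exists M : R, forall s, psq f s <= M >].

Record ell2 := MkEll2 {
  ell2_fun :> I -> C;
  ell2P : ell2_fun \in is_ell2
}.

HB.instance Definition _ := [isSub of ell2 for ell2_fun].
HB.instance Definition _ := [Choice of ell2 by <:].

Lemma sqr_cmodD_le (z w : C) : cmod (z + w) ^+ 2 <= 2 * cmod z ^+ 2 + 2 * cmod w ^+ 2.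
Proof.
have h := cmodD z w; apply: (@le_trans _ _ ((cmod z + cmod w) ^+ 2)).
  by rewrite ler_sqr ?nnegrE ?addr_ge0 ?cmod_ge0.
have := sqr_ge0 (cmod z - cmod w); nra.
Qed.

Lemma psq_le (f g : I -> C) (c d : R) (k : I -> C) s : 
  (forall i, cmod (k i) ^+ 2 <= c * cmod (f i) ^+ 2 + d * cmod (g i) ^+ 2) ->
  psq k s <= c * psq f s + d * psq g s.
Proof.
move=> H; rewrite /psum !mulr_sumr -big_split /=; apply: ler_sum => i _; exact: H.
Qed.

Lemma is_ell2_submod : GRing.submod_closed is_ell2.
Proof.
split=> [|a f g].
  by apply/asboolP; exists 0 => s; rewrite /psum big1 // => i _; rewrite cmod0 expr0n.
move=> /asboolP [M fM] /asboolP [N gN]; apply/asboolP.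
exists (2 * cmod a ^+ 2 * M + 2 * N) => s.
apply: le_trans (@psq_le f g (2 * cmod a ^+ 2) 2 _ s _) _.
  move=> i; apply: le_trans (sqr_cmodD_le _ _) _.
  rewrite lerD2r -mulrA; apply: ler_wpM2l => //.
  by rewrite [X in cmod X](_ : _ = a * f i) // cmodM exprMn.
exact: lerD (ler_wpM2l (mulr_ge0 (ler0n R 2) (sqr_ge0 _)) (fM s)) (ler_wpM2l (ler0n R 2) (gN s)).
Qed.

HB.instance Definition _ := GRing.isSubmodClosed.Build C (I -> C) is_ell2 is_ell2_submod.
HB.instance Definition _ := [SubChoice_isSubLmodule of ell2 by <:].

Lemma ell2_eq (f g : ell2) : f =1 g -> f = g.
Proof. by move=> fg; apply/val_inj/funext. Qed.

Lemma ell2_bound (f : ell2) : exists M, forall s, psq f s <= M.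
Proof. exact/asboolP/(ell2P f). Qed.

Definition ell2_dot (f g : ell2) : C := lsum (fun i => f i * Num.conj (g i)).

Lemma ell2_dot_sum (f g : ell2) : sum_to (fun i => f i * Num.conj (g i)) (ell2_dot f g).
Proof.
have [M fM] := ell2_bound f; have [N gN] := ell2_bound g.
have [||l Hl] := @sum_dominated R I (fun i => f i * Num.conj (g i))
  (fun i => cmod (f i) ^+ 2 + cmod (g i) ^+ 2) (M + N).
- move=> i; rewrite cmodM cmodJ.
  have := sqr_ge0 (cmod (f i) - cmod (g i)); have := sqr_ge0 (cmod (f i)).
  by have := sqr_ge0 (cmod (g i)); nra.
- by move=> s; rewrite /psum big_split /=; apply: lerD; [exact: fM|exact: gN].
by rewrite /ell2_dot (lsumE Hl).
Qed.

Lemma sum_to_ext (u v : I -> C) l : u =1 v -> sum_to u l -> sum_to v l.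
Proof. by move=> /funext ->. Qed.

Lemma ell2_dot_linearl (g : ell2) : linear_for *%R (ell2_dot^~ g).
Proof.
move=> a f f' /=; apply: lsumE.
apply: sum_to_ext (sum_toD (sum_toZ a (ell2_dot_sum f g)) (ell2_dot_sum f' g)) => i /=.
by rewrite mulrA -mulrDl.
Qed.

Lemma ell2_dotC (f g : ell2) : ell2_dot f g = Num.conj (ell2_dot g f).
Proof.
apply: lsumE; apply: sum_to_ext (sum_toJ (ell2_dot_sum g f)) => i /=.
by rewrite rmorphM /= conjCK mulrC.
Qed.

Lemma ell2_dot_linearr (f : ell2) : linear_for (Num.conj \; *%R) (ell2_dot f).
Proof.
move=> a g g' /=; rewrite ell2_dotC ell2_dot_linearl rmorphD rmorphM /=.
by rewrite -!ell2_dotC.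
Qed.

HB.instance Definition _ := bilinear_isBilinear.Build C ell2 ell2 C
  ( *%R ) (Num.conj \; *%R) ell2_dot (pair ell2_dot_linearl ell2_dot_linearr).

Lemma ell2_dot_hermitian (f g : ell2) :
  ell2_dot f g = (-1) ^+ false * Num.conj (ell2_dot g f).
Proof. by rewrite expr0 mul1r ell2_dotC. Qed.

HB.instance Definition _ := isHermitianSesquilinear.Build C ell2 false Num.conj ell2_dot
  ell2_dot_hermitian.

Lemma psum_sqrE (f : I -> C) s : psum (fun i => f i * Num.conj (f i)) s = (psq f s)%:C%C.
Proof.
rewrite /psum rmorph_sum; apply: eq_bigr => i _; exact/esym/cmod_sqrE.
Qed.

Lemma ell2_dot_self (f : ell2) :
  ell2_dot f f = (sup (range (psum (fun i => cmod (f i) ^+ 2))))%:C%C.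
Proof.
have [M fM] := ell2_bound f; apply: lsumE => e e0.
have [s Hs] := real_sum_nneg (fun i => sqr_ge0 (cmod (f i))) fM e0.
by exists s => t /Hs; rewrite psum_sqrE -rmorphB cmodR.
Qed.

Lemma psq_le_dot (f : ell2) s : psq f s <= complex.Re (ell2_dot f f).
Proof.
rewrite ell2_dot_self /=; have [M fM] := ell2_bound f.
by apply: ub_le_sup; [exists M => _ [t _ <-]|exists s].
Qed.

Lemma ell2_dot_le (f : ell2) M : 0 <= M -> (forall s, psq f s <= M) -> complex.Re (ell2_dot f f) <= M.
Proof. by move=> M0 fM; rewrite ell2_dot_self /=; apply: sup_le_nneg => // _ [s _ <-]. Qed.

Lemma psq1 (f : I -> C) i : psq f [fset i]%fset = cmod (f i) ^+ 2.
Proof. by rewrite /psum big_seq_fset1. Qed.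

Lemma ell2_dot_gt0 (f : ell2) : f != 0 -> 0 < ell2_dot f f.
Proof.
move=> f0; have [i fi] : exists i, f i != 0.
  apply: contrapT => /forallNP h; move/eqP: f0; apply; apply: ell2_eq => i.
  by have /negP := h i; rewrite negbK => /eqP.
rewrite ell2_dot_self ltcR.
have := psq_le_dot f [fset i]%fset; rewrite psq1 ell2_dot_self /=; apply: lt_le_trans.
rewrite exprn_gt0 // lt_neqAle cmod_ge0 andbT eq_sym.
by apply: contra fi => /eqP h; rewrite -normr_eq0 cmodE h.
Qed.

HB.instance Definition _ := isDotProduct.Build C ell2 ell2_dot ell2_dot_gt0.

Definition ell2_form : {dot ell2 for Num.conj} := ell2_dot.

Local Notation norm2 := (dot_norm ell2_form).

Lemma norm2_sqr (f : ell2) : norm2 f ^+ 2 = complex.Re (ell2_dot f f).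
Proof.
rewrite sqr_sqrtr // ; apply: le_trans (psq_le_dot f fset0); rewrite /psum.
by rewrite sumr_ge0 // => i _; exact: sqr_ge0.
Qed.

Lemma cmod_le_norm2 (f : ell2) i : cmod (f i) <= norm2 f.
Proof.
rewrite -(@ler_sqr R) ?nnegrE ?cmod_ge0 ?sqrtr_ge0 // norm2_sqr -psq1.
exact: psq_le_dot.
Qed.

Lemma real_cauchy_limit (u : nat -> R) :
  (forall e, 0 < e -> exists n, forall i j, (n <= i)%N -> (n <= j)%N -> `|u i - u j| < e) ->
  exists l, forall e, 0 < e -> exists n, forall i, (n <= i)%N -> `|u i - l| < e.
Proof.
move=> cu; have /cvg_ex [l ul] : cvgn (u : nat -> R^o).
  apply/cauchy_cvgP/cauchy_exP => e /cu [n Hn].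
  by exists (u n), n => // k /= nk; rewrite /ball /=; exact: Hn.
exists l => e e0; have /(@cvgrPdist_lt _ R^o _ \oo _) /(_ _ e0) [n _ Hn] := ul.
by exists n => i ni; rewrite distrC; exact: Hn.
Qed.

Lemma cmod_cauchy_limit (u : nat -> C) :
  (forall e : R, 0 < e -> exists n, forall i j, (n <= i)%N -> (n <= j)%N -> cmod (u i - u j) < e) ->
  exists l, forall e : R, 0 < e -> exists n, forall i, (n <= i)%N -> cmod (u i - l) < e.
Proof.
move=> cu.
have [|a Ha] := @real_cauchy_limit (fun k => complex.Re (u k)).
  move=> e /cu [n Hn]; exists n => i j ni nj; apply: le_lt_trans (Hn i j ni nj).
  by apply: le_trans (Re_le_cmod _); case: (u i); case: (u j).
have [|b Hb] := @real_cauchy_limit (fun k => complex.Im (u k)).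
  move=> e /cu [n Hn]; exists n => i j ni nj; apply: le_lt_trans (Hn i j ni nj).
  by apply: le_trans (Im_le_cmod _); case: (u i); case: (u j).
exists (a +i* b)%C => e e0; have e2 : 0 < e / 2 by rewrite divr_gt0.
have [n1 H1] := Ha _ e2; have [n2 H2] := Hb _ e2.
exists (maxn n1 n2) => i; rewrite geq_max => /andP[/H1 h1 /H2 h2].
apply: le_lt_trans (cmod_le_Re_Im _) _; rewrite [ltRHS]splitr; apply: ltrD.
  by move: h1; case: (u i).
by move: h2; case: (u i).
Qed.

(** The limit is taken pointwise; its distance to u_i is controlled on every finite set,
    hence altogether. *)
Lemma ell2_complete (u : nat -> ell2) :
  (forall eps : R, 0 < eps -> exists n, forall i j, (n <= i)%N -> (n <= j)%N ->
     norm2 (u i - u j) < eps) ->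
  exists l, forall eps : R, 0 < eps -> exists n, forall i, (n <= i)%N ->
     norm2 (u i - l) < eps.
Proof.
move=> cu.
have /choice [l Hl] : forall x, exists l : C, forall e : R, 0 < e ->
    exists n, forall i, (n <= i)%N -> cmod (u i x - l) < e.
  move=> x; apply: cmod_cauchy_limit => e /cu [n Hn]; exists n => i j ni nj.
  apply: le_lt_trans (Hn i j ni nj); exact: (cmod_le_norm2 (u i - u j) x).
have key (e : R) : 0 < e -> exists n, forall i, (n <= i)%N -> forall s,
    psq (fun x => u i x - l x) s <= e ^+ 2.
  move=> e0; have e4 : 0 < e / 2 by rewrite divr_gt0.
  have [n Hn] := cu _ e4; exists n => i ni s.
  (* On the finite set s, u m is replaced by l at the cost d. *)
  apply/ler_addgt0Pr => d d0.
  have d1 : 0 < d / 2 / (#|` s|%:R + 1) by rewrite !divr_gt0 // ltr_wpDl.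
  have sd0 : 0 < Num.sqrt (d / 2 / (#|` s|%:R + 1)) by rewrite sqrtr_gt0.
  have [m [nm Hm]] : exists m, (n <= m)%N /\ forall x, x \in s ->
      cmod (u m x - l x) ^+ 2 <= d / 2 / (#|` s|%:R + 1).
    have /choice [N HN] := fun x => Hl x _ sd0.
    exists (maxn n (\max_(x <- enum_fset s) N x)); split; first exact: leq_maxl.
    move=> x xs; rewrite -[leRHS](sqr_sqrtr (ltW d1)) ler_sqr ?nnegrE ?cmod_ge0 ?sqrtr_ge0 //.
    apply/ltW/HN; apply: leq_trans (leq_maxr _ _); exact: leq_bigmax_seq.
  apply: (@le_trans _ _ (2 * psq (u i - u m) s + 2 * psq (fun x => u m x - l x) s)).
    apply: psq_le => x; apply: le_trans (sqr_cmodD_le _ _).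
    rewrite le_eqVlt; apply/orP; left; apply/eqP; congr (cmod _ ^+ 2).
    exact/esym/subrKA.
  have h1 : psq (u i - u m) s <= (e / 2) ^+ 2.
    apply: le_trans (psq_le_dot _ _) _; rewrite -norm2_sqr ler_sqr ?nnegrE ?sqrtr_ge0 ?(ltW e4) //.
    by apply: ltW; exact: Hn.
  have h2 : psq (fun x => u m x - l x) s <= d / 2.
    apply: (@le_trans _ _ (\sum_(x <- enum_fset s) d / 2 / (#|` s|%:R + 1))).
      rewrite /psum big_seq [leRHS]big_seq; apply: ler_sum => x xs; exact: Hm.
    rewrite big_const_seq count_predT iter_addr_0 -[_ *+ _]mulr_natr mulrAC.
    rewrite ler_pdivrMr ?ltr_wpDl // ler_wpM2l ?lerDl ?divr_ge0 // ltW //.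
  have h3 : 0 < e ^+ 2 by rewrite exprn_gt0.
  rewrite exprMn exprVn in h1; move: h1 h2 h3.
  have -> : (2 : R) ^- 2 = 4^-1 by rewrite -natrX.
  lra.
have ul2 n0 : (forall s, psq (fun x => u n0 x - l x) s <= 1) -> l \in is_ell2.
  move=> h; have [M HM] := ell2_bound (u n0); apply/asboolP; exists (2 * M + 2 * 1) => s.
  apply: le_trans (@psq_le (u n0) (fun x => u n0 x - l x) 2 2 l s _) _.
    move=> x; rewrite -[cmod (u n0 x - l x)]cmodN; apply: le_trans (sqr_cmodD_le _ _).
    by rewrite opprB addrC subrK.
  by apply: lerD; rewrite ler_wpM2l.
have [n0 Hn0] := key 1 ltr01.
have l2 : l \in is_ell2.
  by apply: (ul2 n0) => s; have := Hn0 n0 (leqnn _) s; rewrite expr1n.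
exists (MkEll2 l2) => e e0; have e2 : 0 < e / 2 by rewrite divr_gt0.
have [n Hn] := key _ e2; exists n => i ni.
apply: (@le_lt_trans _ _ (e / 2)); last by rewrite ltr_pdivrMr // ltr_pMr // ltr1n.
rewrite -(@ler_sqr R) ?nnegrE ?sqrtr_ge0 ?(ltW e2) // norm2_sqr.
by apply: ell2_dot_le => [|s]; [exact: sqr_ge0|exact: Hn].
Qed.

Definition ell2_hilbert : hilbert R := @Hilbert R ell2 ell2_form ell2_complete.

End SquareSummable.

(** * C_0(Y) as an operator module over itself *)

Section MultiplicationModule.
Variables (R : realType) (Y : topologicalType).
Local Notation C := (Cplx R).
Local Notation H := (ell2_hilbert R Y).

Lemma is_ell2_mul (a : C0 R Y) (f : ell2 R Y) : (fun y => a y * f y) \in @is_ell2 R Y.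
Proof.
have [M M0 aM] := is_C0_bounded (C0P a); have [N fN] := ell2_bound f.
apply/asboolP; exists (M ^+ 2 * N) => s.
apply: le_trans (ler_wpM2l (sqr_ge0 M) (fN s)); rewrite /psum mulr_sumr.
apply: ler_sum => y _; rewrite cmodM exprMn ler_wpM2r ?sqr_ge0 //.
by rewrite ler_sqr ?nnegrE ?cmod_ge0.
Qed.

Definition ell2_mul (a : C0 R Y) (f : H) : H := MkEll2 (is_ell2_mul a f).

Lemma ell2_norm_le (f g : H) (M : R) : 0 <= M ->
  (forall y, cmod ((f : ell2 R Y) y) <= M * cmod ((g : ell2 R Y) y)) -> hnorm f <= M * hnorm g.
Proof.
move=> M0 fg.
rewrite -(@ler_sqr R) ?nnegrE ?mulr_ge0 ?hnorm_ge0 // exprMn !hnorm_sqr.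
apply: ell2_dot_le; first by rewrite mulr_ge0 ?sqr_ge0 ?rdot_ge0.
move=> s; apply: le_trans (ler_wpM2l (sqr_ge0 M) (psq_le_dot g s)).
rewrite /psum mulr_sumr; apply: ler_sum => y _; rewrite -exprMn.
by rewrite ler_sqr ?nnegrE ?mulr_ge0 ?cmod_ge0.
Qed.

Lemma ell2_mul_bounded a : bounded_linear (@hnorm R H) (ell2_mul a).
Proof.
split.
  move=> z f g; apply: ell2_eq => y /=.
  change (a y * (z * (f : ell2 R Y) y + (g : ell2 R Y) y) =
    z * (a y * (f : ell2 R Y) y) + a y * (g : ell2 R Y) y); ring.
have [M M0 aM] := is_C0_bounded (C0P a); exists M => f.
by apply: ell2_norm_le => // y /=; rewrite cmodM ler_wpM2r ?cmod_ge0.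
Qed.

Lemma ell2_mul_linear : linear ell2_mul.
Proof.
move=> z a b; apply/funext => f; apply: ell2_eq => y /=.
change ((z * a y + b y) * (f : ell2 R Y) y =
  z * (a y * (f : ell2 R Y) y) + b y * (f : ell2 R Y) y); ring.
Qed.

Lemma ell2_mul_rep : star_representation ell2_mul.
Proof.
split=> [a| |a b f|a f g].
- exact: ell2_mul_bounded.
- exact: ell2_mul_linear.
- by apply: ell2_eq => y /=; exact/esym/mulrA.
- congr lsum; apply/funext => y /=; rewrite rmorphM /= conjCK.
  change (a y * (f : ell2 R Y) y * Num.conj ((g : ell2 R Y) y) =
    (f : ell2 R Y) y * (a y * Num.conj ((g : ell2 R Y) y))); ring.
Qed.

Lemma psum_delta_le (y : Y) s :
  psum (fun y' => cmod (if y' == y then 1 else 0 : C) ^+ 2) s <= 1.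
Proof.
rewrite /psum; have [ys|ys] := boolP (y \in s).
  rewrite (big_fsetD1 y ys) /= eqxx cmod1 expr1n big_seq big1 ?addr0 // => y'.
  by rewrite !inE => /andP[/negbTE -> _]; rewrite cmod0 expr0n.
rewrite big_seq big1 // => y' y's; case: eqP => [E|_]; last by rewrite cmod0 expr0n.
by move: ys; rewrite -E y's.
Qed.

Lemma is_ell2_delta (y : Y) : (fun y' : Y => if y' == y then 1 else 0 : C) \in @is_ell2 R Y.
Proof. by apply/asboolP; exists 1 => s; exact: psum_delta_le. Qed.

Definition ell2_delta (y : Y) : H := MkEll2 (is_ell2_delta y).

Lemma ell2_delta_norm y : hnorm (ell2_delta y) <= 1.
Proof.
rewrite -(@ler_sqr R) ?nnegrE ?hnorm_ge0 // hnorm_sqr expr1n; apply: ell2_dot_le => // s.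
exact: psum_delta_le.
Qed.

Lemma cmod_le_hnorm (f : H) y : cmod ((f : ell2 R Y) y) <= hnorm f.
Proof. exact: cmod_le_norm2. Qed.

Lemma ell2_mul_inj : injective ell2_mul.
Proof.
move=> a b ab; apply: C0_eq => y.
have := congr1 (fun T : H -> H => (T (ell2_delta y) : ell2 R Y) y) ab.
by rewrite /= eqxx !mulr1.
Qed.

Lemma uniform_limit_C0 (g : Y -> C) :
  (forall e : R, 0 < e -> exists a : C0 R Y, forall y, cmod (a y - g y) <= e) ->
  g \in @is_C0 R Y.
Proof.
move=> ag; apply/is_C0P; split.
  move=> y; apply/cvg_cmodP => e e0.
  have e3 : 0 < e / 3 by rewrite divr_gt0.
  have [a Ha] := ag _ e3; have /is_C0P [ac _] := C0P a.
  have /cvg_cmodP /(_ _ e3) := ac y.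
  apply: filterS => z h.
  have -> : g y - g z = (a y - a z) + (a z - g z) - (a y - g y) by ring.
  have h1 := cmodD ((a y - a z) + (a z - g z)) (- (a y - g y)).
  have h2 := cmodD (a y - a z) (a z - g z).
  rewrite cmodN in h1; have h3 := Ha y; have h4 := Ha z; lra.
move=> e e0; have e2 : 0 < e / 2 by rewrite divr_gt0.
have [a Ha] := ag _ e2; have /is_C0P [_ /(_ _ e2) [K cK HK]] := C0P a.
exists K => // y /HK h.
have -> : g y = a y - (a y - g y) by ring.
apply: le_lt_trans (cmodD _ _) _; rewrite cmodN [ltRHS]splitr; exact: ltr_leD.
Qed.

(** A limit T of multiplication operators is multiplication by y |-> (T delta_y)(y), a
    uniform limit of functions in C_0(Y). *)
Lemma ell2_mul_closed (T : H -> H) : bounded_linear (@hnorm R H) T ->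
  (forall eps : R, 0 < eps ->
     exists a, forall x, hnorm (ell2_mul a x - T x) <= eps * hnorm x) ->
  exists a, ell2_mul a = T.
Proof.
move=> _ aT; pose g y := (T (ell2_delta y) : ell2 R Y) y.
have close e a : 0 < e -> (forall x, hnorm (ell2_mul a x - T x) <= e * hnorm x) ->
    forall y, cmod (a y - g y) <= e.
  move=> e0 Ha y; have := Ha (ell2_delta y).
  have := cmod_le_hnorm (ell2_mul a (ell2_delta y) - T (ell2_delta y)) y.
  have -> : (ell2_mul a (ell2_delta y) - T (ell2_delta y) : ell2 R Y) y = a y - g y.
    rewrite -[LHS]/(a y * (if y == y then 1 else 0) - g y); by rewrite eqxx mulr1.
  have := ell2_delta_norm y; move=> h1 h2 h3; apply: le_trans h2 _; apply: le_trans h3 _.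
  by rewrite ler_piMr // ltW.
have Cg : g \in @is_C0 R Y.
  apply: uniform_limit_C0 => e e0; have [a Ha] := aT e e0; exists a; exact: close.
exists (MkC0 Cg); apply/funext => x; apply/eqP; rewrite -subr_eq0; apply/eqP.
set d := _ - _; suff d0 : hnorm d = 0.
  apply: ell2_eq => y; apply/eqP; rewrite -normr_eq0 cmodE.
  have := cmod_le_hnorm d y; rewrite d0 => h; apply/eqP; congr (_%:C%C).
  by apply/eqP; rewrite eq_le cmod_ge0 andbT.
apply/eqP; rewrite eq_le hnorm_ge0 andbT; apply/ler_addgt0Pr => e e0; rewrite add0r.
have x1 : 0 < hnorm x + 1 by rewrite ltr_wpDl ?hnorm_ge0.
pose eta := e / 2 / (hnorm x + 1); have eta0 : 0 < eta by rewrite !divr_gt0.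
have [a Ha] := aT _ eta0.
have -> : d = (ell2_mul (MkC0 Cg) x - ell2_mul a x) + (ell2_mul a x - T x) by rewrite subrKA.
apply: le_trans (Defs.hnormD _ _) _.
have h1 : hnorm (ell2_mul (MkC0 Cg) x - ell2_mul a x) <= eta * hnorm x.
  apply: ell2_norm_le; first exact: ltW.
  move=> y; rewrite [X in cmod X](_ : _ = - (a y - g y) * (x : ell2 R Y) y); last first.
    rewrite -[LHS]/(g y * (x : ell2 R Y) y - a y * (x : ell2 R Y) y); ring.
  rewrite cmodM cmodN; apply: ler_wpM2r; first exact: cmod_ge0.
  exact: close.
apply: le_trans (lerD h1 (Ha x)) _.
have h2 : eta * hnorm x <= e / 2.
  by rewrite /eta mulrAC ler_pdivrMr // ler_wpM2l ?lerDl // ltW // divr_gt0.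
lra.
Qed.

(** f is the product of f / sqrt |f| and sqrt |f|; the quotient has modulus sqrt |f|, so
    it is continuous also at the zeros of f. *)
Lemma C0_factor (f : C0 R Y) : exists f' a : C0 R Y, f = C0_mul f' a.
Proof.
have /is_C0P [fc fv] := C0P f.
pose s y := Num.sqrt (cmod (f y)).
have s2 y : s y ^+ 2 = cmod (f y) by rewrite sqr_sqrtr ?cmod_ge0.
have s0 y : 0 <= s y by exact: sqrtr_ge0.
have fs y : (s y == 0) = (f y == 0).
  by rewrite -[LHS](expf_eq0 (s y) 2) s2 -[RHS]normr_eq0 cmodE fmorph_eq0.
have sc : continuous (s : Y -> R).
  move=> y; apply: (@continuous_comp _ _ _ (fun y => cmod (f y)) Num.sqrt).
    by apply: continuous_comp; [exact: fc|exact: cmod_continuous].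
  exact: sqrt_continuous.
have Cs : is_C0r s.
  split=> // e e0; have [K cK HK] := fv (e ^+ 2) (exprn_gt0 _ e0); exists K => // y /HK.
  by rewrite ger0_norm // -s2 ltr_sqr ?nnegrE ?(ltW e0).
pose g y : C := f y / (s y)%:C%C.
have gs y : cmod (g y) = s y.
  have [f0|f0] := eqVneq (f y) 0.
    have /eqP := fs y; rewrite f0 eqxx => /eqP/eqP sy0.
    by rewrite /g f0 mul0r cmod0 sy0.
  have sn0 : s y != 0 by rewrite fs.
  rewrite /g cmodM -fmorphV cmodR ger0_norm ?invr_ge0 // -s2 expr2 mulfK //.
have gC0 : g \in @is_C0 R Y.
  apply/is_C0P; split; last first.
    move=> e /(Cs.2) [K cK HK]; exists K => // y /HK; by rewrite gs ger0_norm.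
  move=> y; have [f0|f0] := eqVneq (f y) 0; last first.
    apply: cvgM; first exact: fc.
    apply: (@cvgV C); first by rewrite fmorph_eq0 fs.
    by apply: (continuous_comp (sc y)); exact: realC_continuous.
  have sy0 : s y = 0 by apply/eqP; rewrite fs f0.
  have gy0 : g y = 0 by rewrite /g f0 mul0r.
  apply/cvg_cmodP => e e0.
  have /(@cvgrPdist_lt _ R^o _ (nbhs y) _) /(_ _ e0) := sc y.
  by apply: filterS => z; rewrite gy0 sy0 !sub0r normrN cmodN gs ger0_norm.
exists (MkC0 gC0), (C0_real Cs); apply: C0_eq => y /=.
rewrite -[RHS]/(f y / (s y)%:C%C * (s y)%:C%C).
have [f0|f0] := eqVneq (f y) 0; first by rewrite f0 !mul0r.
by rewrite mulfVK // fmorph_eq0 fs.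
Qed.

Lemma ell2_mulA (a b : C0 R Y) (x : H) : ell2_mul (C0_mul a b) x = ell2_mul a (ell2_mul b x).
Proof. by apply: ell2_eq => y; exact/esym/mulrA. Qed.

Definition C0_opModule : opModule R Y := @OpModule R Y (C0 R Y) H ell2_mul ell2_mul (@C0_mul R Y)
  ell2_mul_rep ell2_mul_bounded ell2_mul_linear ell2_mul_inj ell2_mul_closed
  ell2_mulA C0_factor.

(** Test D on vectors supported at the point y. *)
Lemma mxev_le_om_norm m n (D : 'M[C0_opModule]_(m, n)) (y : Y) :
  mxopnorm (mxev y (D : 'M[C0 R Y]_(m, n))) <= om_norm D.
Proof.
apply: mxopnorm_le => [|xi]; first exact: opnorm_ge0.
pose eta : 'I_n -> H := fun j => (xi j : C) *: ell2_delta y.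
have h := le_opnorm (@hnorm_ge0 R H) (@Defs.hnormD R H) (@hnormZ R H)
  (fun i j => om_bounded (D i j)) eta.
have h1 : vnorm (@hnorm R H) eta <= vnorm (@cmod R) xi.
  rewrite /vnorm ler_sqrt ?sumr_ge0 // => [|i _]; last exact: sqr_ge0.
  apply: ler_sum => j _; rewrite ler_sqr ?nnegrE ?hnorm_ge0 ?cmod_ge0 // hnormZ.
  by rewrite ler_piMr ?cmod_ge0 // ell2_delta_norm.
apply: le_trans (ler_wpM2l _ h1); last exact: opnorm_ge0.
apply: le_trans h; rewrite /vnorm ler_sqrt ?sumr_ge0 // => [|i _]; last exact: sqr_ge0.
apply: ler_sum => i _; rewrite ler_sqr ?nnegrE ?hnorm_ge0 ?cmod_ge0 //.
apply: le_trans (cmod_le_hnorm _ y); rewrite le_eqVlt; apply/orP; left; apply/eqP.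
congr cmod; rewrite /mxapp.
have sumE (r : seq 'I_n) (F : 'I_n -> ell2 R Y) :
    (\sum_(j <- r) F j : ell2 R Y) y = \sum_(j <- r) F j y.
  by elim/big_rec2: _ => // j a b _ <-.
rewrite [RHS]sumE; apply: eq_bigr => j _; rewrite mxE.
rewrite -[RHS]/((D i j : C0 R Y) y * (xi j * (if y == y then 1 else 0))).
by rewrite eqxx mulr1.
Qed.

Lemma om_norm_const_le (a : C0_opModule) : (forall y, cmod ((a : C0 R Y) y) <= 1) ->
  om_norm (const_mx a : 'M[C0_opModule]_(1, 1)) <= 1.
Proof.
move=> a1; apply: opnorm_le => // xi; rewrite mul1r /vnorm !big_ord1.
rewrite ler_sqrt ?sqr_ge0 // ler_sqr ?nnegrE ?hnorm_ge0 // /mxapp big_ord1 mxE.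
rewrite -[leRHS]mul1r; apply: ell2_norm_le => // y /=.
by rewrite cmodM ler_wpM2r ?cmod_ge0.
Qed.

End MultiplicationModule.

(** * Factorizations of Hadamard matrices *)

Section Hadamard.
Variable R : realType.
Local Notation C := (Cplx R).

Fixpoint hadamard_dim k : nat := if k is k'.+1 then (hadamard_dim k' + hadamard_dim k')%N else 1%N.

(** Sylvester's construction. *)
Fixpoint hadamard k : 'M[C]_(hadamard_dim k) :=
  if k is k'.+1 then block_mx (hadamard k') (hadamard k') (hadamard k') (- hadamard k')
  else 1%:M.

Lemma hadamard_dim_gt k : (k < hadamard_dim k)%N.
Proof.
elim: k => // k IH; apply: (leq_ltn_trans IH) => /=.
by rewrite -[ltnLHS]addn0 ltn_add2l (leq_ltn_trans (leq0n _) IH).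
Qed.

Lemma hadamard_sign k i j : hadamard k i j = 1 \/ hadamard k i j = -1.
Proof.
elim: k i j => [|k IH] i j; first by left; rewrite !ord1 mxE.
rewrite /= -(@fintype.splitK _ (hadamard_dim k) i) -(@fintype.splitK _ (hadamard_dim k) j).
by case: (fintype.split i) => i'; case: (fintype.split j) => j' /=;
  rewrite ?block_mxEul ?block_mxEur ?block_mxEdl ?block_mxEdr //;
  rewrite mxE; case: (IH i' j') => ->; rewrite ?opprK; [right|left].
Qed.

Lemma hadamard_orthogonal k : hadamard k *m (hadamard k)^T = ((hadamard_dim k)%:R)%:M.
Proof.
elim: k => [|k IH]; first by rewrite /= trmx1 mul1mx.
rewrite /= tr_block_mx mulmx_block linearN /= !mulmxN !mulNmx opprK !IH subrr natrD.
by rewrite -!raddfD /= -scalar_mx_block.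
Qed.

(** The rows of a Hadamard matrix are orthogonal of norm sqrt n. *)
Lemma hadamard_energy k (p : 'I_(hadamard_dim k) -> C) :
  \sum_j cmod (\sum_i hadamard k i j * p i) ^+ 2 = (hadamard_dim k)%:R * \sum_i cmod (p i) ^+ 2.
Proof.
set A := hadamard k; set n := hadamard_dim k.
have AJ i j : Num.conj (A i j) = A i j.
  by case: (hadamard_sign i j) => ->; rewrite ?rmorphN rmorph1.
have AA i i' : \sum_j A i j * A i' j = n%:R *+ (i == i').
  have /matrixP/(_ i i') := hadamard_orthogonal k; rewrite !mxE => <-.
  by apply: eq_bigr => j _; rewrite !mxE.
apply: (@complexI R); rewrite rmorph_sum rmorphM rmorph_nat rmorph_sum.
transitivity (\sum_j \sum_i \sum_i' (A i j * A i' j) * (p i * Num.conj (p i')) : C).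
  apply: eq_bigr => j _; rewrite /= cmod_sqrE rmorph_sum mulr_suml; apply: eq_bigr => i _.
  rewrite mulr_sumr; apply: eq_bigr => i' _; rewrite rmorphM /= AJ.
  change (A i j * p i * (A i' j * Num.conj (p i')) = A i j * A i' j * (p i * Num.conj (p i')) :> C).
  ring.
rewrite exchange_big mulr_sumr /=; apply: eq_bigr => i _.
rewrite exchange_big /= (bigD1 i) //= -mulr_suml AA eqxx mulr1n big1 ?addr0 ?cmod_sqrE //.
by move=> i' ii; rewrite -mulr_suml AA eq_sym (negbTE ii) mulr0n mul0r.
Qed.

(** With A = P Q of size n, pair A with itself: n^2 is the sum of the products of the
    entries of the transpose of A times P with those of Q. The squares of these entries sum
    to at most n^2 m and n m respectively, whence n^2 <= n^(3/2) m. *)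
Lemma hadamard_factorization k q (P : 'M[C]_(hadamard_dim k, q)) (Q : 'M[C]_(q, hadamard_dim k)) m :
  0 <= m -> hadamard k = P *m Q ->
  (forall i, \sum_l cmod (P i l) ^+ 2 <= m) -> (forall j, \sum_l cmod (Q l j) ^+ 2 <= m) ->
  (hadamard_dim k)%:R <= m ^+ 2.
Proof.
set A := hadamard k; set n := hadamard_dim k => m0 APQ Pm Qm.
have n0 : 0 < n%:R :> R by rewrite ltr0n (leq_ltn_trans (leq0n _) (hadamard_dim_gt k)).
(* The weight r = sqrt n balances the two sums of squares. *)
pose r := Num.sqrt (n%:R : R); have r0 : 0 < r by rewrite sqrtr_gt0.
have r2 : r ^+ 2 = n%:R by rewrite sqr_sqrtr // ltW.
pose B l j := \sum_i A i j * P i l.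
have E : (n%:R * n%:R : C) = \sum_l \sum_j B l j * Q l j.
  transitivity (\sum_i \sum_j A i j * A i j).
    rewrite (eq_bigr (fun=> n%:R)) => [|i _].
      by rewrite sumr_const card_ord mulr_natl.
    rewrite (eq_bigr (fun=> 1)) => [|j _]; first by rewrite sumr_const card_ord.
    by rewrite /A; case: (hadamard_sign i j) => ->; rewrite ?mulrNN mulr1.
  under eq_bigr => i _ do under eq_bigr => j _ do rewrite {2}APQ mxE mulr_sumr.
  rewrite /B; under [RHS]eq_bigr => l _ do under eq_bigr => j _ do rewrite mulr_suml.
  under [RHS]eq_bigr => l _ do rewrite exchange_big.
  rewrite [RHS]exchange_big /=; apply: eq_bigr => i _.
  rewrite [RHS]exchange_big /=; apply: eq_bigr => j _.
  by apply: eq_bigr => l _; rewrite mulrA.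
have h1 : n%:R * n%:R <= \sum_l \sum_j (cmod (B l j) ^+ 2 / r + r * cmod (Q l j) ^+ 2) / 2.
  have -> : n%:R * n%:R = cmod (n%:R * n%:R : C) :> R.
    have -> : (n%:R * n%:R : C) = (n%:R * n%:R : R)%:C%C by rewrite rmorphM rmorph_nat.
    by rewrite cmodR ger0_norm // mulr_ge0.
  rewrite E; apply: le_trans (csum_le _ _ _) _; apply: ler_sum => l _.
  apply: le_trans (csum_le _ _ _) _; apply: ler_sum => j _.
  rewrite cmodM -subr_ge0.
  have -> : (cmod (B l j) ^+ 2 / r + r * cmod (Q l j) ^+ 2) / 2 - cmod (B l j) * cmod (Q l j) =
      (cmod (B l j) - r * cmod (Q l j)) ^+ 2 / r / 2 by field; rewrite gt_eqF.
  by rewrite !divr_ge0 ?sqr_ge0 ?(ltW r0).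
have h2 : \sum_l \sum_j cmod (B l j) ^+ 2 <= n%:R * (n%:R * m).
  under eq_bigr => l _ do rewrite hadamard_energy.
  rewrite -mulr_sumr exchange_big /= ler_pM2l //.
  apply: (@le_trans _ _ (\sum_(i < n) m)); first by apply: ler_sum.
  by rewrite sumr_const card_ord -[m *+ n]mulr_natl.
have h3 : \sum_l \sum_j cmod (Q l j) ^+ 2 <= n%:R * m.
  rewrite exchange_big /=; apply: (@le_trans _ _ (\sum_(i < n) m)); first by apply: ler_sum.
  by rewrite sumr_const card_ord -[m *+ n]mulr_natl.
have h4 : \sum_l \sum_j (cmod (B l j) ^+ 2 / r + r * cmod (Q l j) ^+ 2) / 2 =
    ((\sum_l \sum_j cmod (B l j) ^+ 2) / r + r * \sum_l \sum_j cmod (Q l j) ^+ 2) / 2.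
  rewrite mulr_suml mulr_sumr -big_split mulr_suml; apply: eq_bigr => l _ /=.
  by rewrite mulr_suml mulr_sumr -big_split mulr_suml.
have rm : r <= m.
  rewrite h4 in h1.
  have h5 : (\sum_l \sum_j cmod (B l j) ^+ 2) / r <= r ^+ 3 * m.
    rewrite ler_pdivrMr //; apply: le_trans h2 _; rewrite -r2.
    by rewrite (_ : r ^+ 3 * m * r = r ^+ 2 * (r ^+ 2 * m)) //; ring.
  have h6 : r * \sum_l \sum_j cmod (Q l j) ^+ 2 <= r ^+ 3 * m.
    apply: le_trans (ler_wpM2l (ltW r0) h3) _; rewrite -r2.
    by rewrite (_ : r ^+ 3 * m = r * (r ^+ 2 * m)) //; ring.
  have h7 : r ^+ 3 * r <= r ^+ 3 * m.
    have -> : r ^+ 3 * r = n%:R * n%:R by rewrite -r2; ring.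
    lra.
  by move: h7; rewrite ler_pM2l // exprn_gt0.
by rewrite -r2 ler_sqr ?nnegrE ?(ltW r0).
Qed.

Lemma row_sum_le_mxopnorm n (a : 'M[C]_(1, n)) : \sum_l cmod (a ord0 l) ^+ 2 <= mxopnorm a ^+ 2.
Proof.
set S := \sum_l _; have S0 : 0 <= S by apply: sumr_ge0 => l _; exact: sqr_ge0.
have := mxopnorm_app a (fun l => Num.conj (a ord0 l) : C^o).
rewrite vnorm_conj {1}/vnorm big_ord1 sqrtr_sqr ger0_norm ?cmod_ge0 // /mxapp.
have -> : \sum_j a ord0 j * Num.conj (a ord0 j) = S%:C%C :> C.
  by rewrite /S rmorph_sum; apply: eq_bigr => l _; rewrite /= cmod_sqrE.
rewrite cmodR ger0_norm // /vnorm -/S => h.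
have [S00|Sn0] := eqVneq S 0; first by rewrite S00 sqr_ge0.
have Sp : 0 < Num.sqrt S by rewrite sqrtr_gt0 lt_neqAle eq_sym Sn0.
rewrite -[leLHS](sqr_sqrtr S0) ler_sqr ?nnegrE ?mxopnorm_ge0 ?(ltW Sp) //.
by move: h; rewrite -{1}(sqr_sqrtr S0) expr2 ler_pM2r.
Qed.

Lemma col_sum_le_mxopnorm n (a : 'M[C]_(n, 1)) : \sum_l cmod (a l ord0) ^+ 2 <= mxopnorm a ^+ 2.
Proof.
set S := \sum_l _; have S0 : 0 <= S by apply: sumr_ge0 => l _; exact: sqr_ge0.
have := mxopnorm_app a (fun l => 1 : C^o).
have -> : vnorm (@cmod R) (fun _ : 'I_1 => 1 : C^o) = 1.
  by rewrite /vnorm big_ord1 cmod1 expr1n sqrtr1.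
have -> : mxapp (fun i j (z : C^o) => a i j * z) (fun=> 1 : C^o) = fun i => a i ord0.
  by apply/funext => i; rewrite /mxapp big_ord1 mulr1.
rewrite mulr1 /vnorm -/S => h.
by rewrite -[leLHS](sqr_sqrtr S0) ler_sqr ?nnegrE ?mxopnorm_ge0 ?sqrtr_ge0.
Qed.

End Hadamard.

(** * Large fibres obstruct the isomorphism *)

Section CompletionIn.
Context {R : realType} {X Y : topologicalType}.
Local Notation C := (Cplx R).
Variables (nu : properMap Y X) (V : mnModule R X).
Hypothesis hV : is_matrix_norm (@mn_norm R X V).
Hypothesis hU : row_embedding_le V.
Local Notation hsn := (haagerup_is_seminorm nu hV).

Lemma completion_inD v w : completion_in hsn (v + w) = completion_in hsn v + completion_in hsn w.
Proof. by rewrite [RHS]completion_classD; apply/completion_classP/(cs_eq_pw hsn). Qed.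

Lemma completion_inZ a v : completion_in hsn (a *: v) = a *: completion_in hsn v.
Proof. by rewrite [RHS]completion_classZ; apply/completion_classP/(cs_eq_pw hsn). Qed.

Lemma completion_in_sum (I : Type) (s : seq I) (P : pred I) (f : I -> tensor nu V) :
  completion_in hsn (\sum_(i <- s | P i) f i) = \sum_(i <- s | P i) completion_in hsn (f i).
Proof. exact: (big_morph _ completion_inD). Qed.

Lemma haagerup_tensor_norm_in w :
  haagerup_tensor_norm (const_mx (completion_in hsn w) : 'M[haagerup_tensor nu hV]_(1, 1)) =
  haagerup_seminorm w.
Proof.
have := @haagerup_tensor_norm_cvg R X Y nu V hV hU 1 1
  (const_mx (completion_in hsn w)) (fun _ _ => cs_cst hsn w).
have -> : (fun k : nat => haagerup_norm (\matrix_(i < 1, j < 1) cs_cst hsn w k)) =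
    (fun=> haagerup_seminorm w).
  by apply/funext => k; congr haagerup_norm; apply/matrixP => i j; rewrite !mxE.
move=> H; have {}H := H (fun i j => mxE _ _ _ _).
apply: (@cvg_unique R^o _ _ _ _ _ H); last exact: cvg_cst.
exact: norm_hausdorff.
Qed.

End CompletionIn.

Section LowerBound.
Variables (R : realType) (X Y1 Y2 : topologicalType).
Hypotheses (hX : hausdorff_space X).
Hypotheses (hY1 : hausdorff_space Y1) (lY1 : locally_compact [set: Y1]).
Hypotheses (hY2 : hausdorff_space Y2) (lY2 : locally_compact [set: Y2]).
Variables (mu1 : properMap Y1 X) (mu2 : properMap Y2 X).
Local Notation C := (Cplx R).
Local Notation Z := (fibre_product mu1 mu2).
Local Notation pi1 := (fibre_fst hX mu1 mu2).
Local Notation pi2 := (fibre_snd hX mu1 mu2).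
Local Notation E := (C0_opModule R Y1).
Local Notation E1 := (Defs.restrict mu1 (om_module E)).
Local Notation S := (tensor mu2 E1).
Local Notation S' := (tensor pi1 (om_module E)).
Let hE : is_matrix_norm (@mn_norm R X E1) := om_matrix_norm E.
Let hE' : is_matrix_norm (@mn_norm R Y1 (om_module E)) := om_matrix_norm E.
Let hU : row_embedding_le E1 := @om_row_embedding R Y1 E.
Let hU' : row_embedding_le (om_module E) := @om_row_embedding R Y1 E.

Lemma C0_eval_balanced (y : Y1) (z : Y2) : mu1 y = mu2 z ->
  balanced mu2 (fun (e : E1) (c : C0 R Y2) => ((e : C0 R Y1) y * c z : C^o)).
Proof.
move=> yz; split=> *.
- exact: mulrDl.
- exact: mulrDr.
- exact/esym/mulrA.
- exact: mulrCA.
- by rewrite /= -yz -mulrA.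
Qed.

(** Bumps b_i at y_i and v_j at z_j turn A into w = sum_ij A_ij chi b_i (x) v_j, where
    chi = sum_i b_i. Base change maps w to chi (x) G with |G| <= 1, so a bounded inverse
    bounds w by a constant. Evaluating a nearly optimal factorization of w at the points
    (y_i, z_j) factors A. *)
Lemma iso_bounded_factorization :
  beck_chevalley R hX mu1 mu2 ->
  exists2 m : R, 0 <= m & forall n (x : X) (y : 'I_n -> Y1) (z : 'I_n -> Y2) (A : 'M[C]_n),
    injective y -> injective z -> (forall i, mu1 (y i) = x) -> (forall j, mu2 (z j) = x) ->
    (forall i j, cmod (A i j) <= 1) ->
    exists q (P : 'M[C]_(n, q)) (Q : 'M[C]_(q, n)), [/\ A = P *m Q,
      forall i, \sum_l cmod (P i l) ^+ 2 <= m & forall j, \sum_l cmod (Q l j) ^+ 2 <= m].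
Proof.
move=> /(_ E) [t [[[[tlin _] _] tE] [_ [s [[_ [M sM]] tK _]]]]].
exists (`|M| + 1); first by rewrite addr_ge0.
move=> n x y z A yi zi yx zx A1.
have [b [Cb b0 b1 by1]] := @bump_functions R Y1 hY1 lY1 n y yi.
have [v [Cv v0 v1 vz]] := @bump_functions R Y2 hY2 lY2 n z zi.
pose B i := C0_real (Cb i); pose V j := C0_real (Cv j).
(* The element of E on which the b_i act; it stands in for the constant 1, which need not
   be in C_0(Y1). *)
pose chi : C0 R Y1 := \sum_i B i.
have chiE y' : chi y' = (\sum_i b i y')%:C%C by rewrite /chi C0_sum rmorph_sum.
pose w : S := \sum_i \sum_j A i j *: tens mu2 (om_act (chi : E) (B i) : E1) (V j).
pose G : C0 R Z := \sum_i \sum_j A i j *: C0_mul (C0_pull pi1 (B i)) (C0_pull pi2 (V j)).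
have tD a a' : t (a + a') = t a + t a' by have := tlin 1 a a'; rewrite !scale1r.
have t0 : t 0 = 0 by apply: (@addIr _ (t 0)); rewrite -tD !add0r.
have tZ a c : t (a *: c) = a *: t c by have := tlin a c 0; rewrite t0 !addr0.
have tw : t (completion_in (haagerup_is_seminorm mu2 hE) w) =
    completion_in (haagerup_is_seminorm pi1 hE') (tens pi1 (chi : om_module E) G).
  rewrite /w /G completion_in_sum (big_morph _ tD t0) tens_sumr completion_in_sum.
  apply: eq_bigr => i _.
  rewrite completion_in_sum (big_morph _ tD t0) tens_sumr completion_in_sum.
  apply: eq_bigr => j _; rewrite completion_inZ tZ.
  by rewrite -tensZ tensZl completion_inZ; congr (_ *: _); exact: tE.
have Gle (p : Z) : cmod (G p) <= 1.
  rewrite /G C0_sum; apply: le_trans (csum_le _ _ _) _.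
  apply: le_trans (b1 (pi1 p)); apply: ler_sum => i _.
  rewrite C0_sum; apply: le_trans (csum_le _ _ _) _.
  apply: (@le_trans _ _ (\sum_j b i (pi1 p) * v j (pi2 p))).
    apply: ler_sum => j _; rewrite C0Z cmodM.
    apply: le_trans (ler_wpM2r (cmod_ge0 _) (A1 i j)) _; rewrite mul1r.
    rewrite -[X in cmod X]/((b i (pi1 p))%:C%C * (v j (pi2 p))%:C%C) cmodM !cmodR !ger0_norm //.
  by rewrite -mulr_sumr ler_piMr.
have semi1 : haagerup_seminorm (tens pi1 (chi : om_module E) G) <= 1.
  have E0 : const_mx (tens pi1 (chi : om_module E) G) =
      odot pi1 (const_mx chi : 'M[om_module E]_(1, 1)) (const_mx G) :> 'M_(1, 1).
    by apply/matrixP => i j; rewrite !mxE big_ord1 !mxE.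
  apply: le_trans (haagerup_le hE' E0) _; rewrite -[leRHS]mulr1; apply: ler_pM.
  - exact: (mxn_ge0 hE').
  - exact: C0_norm_ge0.
  - apply: om_norm_const_le => y'; rewrite chiE cmodR ger0_norm //.
    by apply: sumr_ge0.
  - apply: C0_norm_lub => // p; apply: le_trans (Gle p).
    have -> : mxev p (const_mx G) = const_mx (G p) :> 'M[C]_(1, 1).
      by apply/matrixP => i j; rewrite !mxE.
    exact: mxopnorm_const.
have wM : haagerup_seminorm w <= `|M|.
  rewrite -(haagerup_tensor_norm_in hE hU w).
  have := sM 1%N (const_mx (t (completion_in (haagerup_is_seminorm mu2 hE) w))).
  have -> : map_mx s (const_mx (t (completion_in (haagerup_is_seminorm mu2 hE) w))) =
      const_mx (completion_in (haagerup_is_seminorm mu2 hE) w) :> 'M_(1, 1).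
    by apply/matrixP => i j; rewrite !mxE tK.
  move=> h; apply: le_trans h _; rewrite tw.
  have h2 : 0 <= haagerup_seminorm (tens pi1 (chi : om_module E) G) by exact: (haagerup_ge0 hE').
  have -> : mn_norm (const_mx (completion_in (haagerup_is_seminorm pi1 hE')
      (tens pi1 (chi : om_module E) G)) : 'M[bc_target hX mu1 mu2 E]_1) =
      haagerup_seminorm (tens pi1 (chi : om_module E) G).
    exact: (haagerup_tensor_norm_in hE' hU' _).
  apply: (@le_trans _ _ (`|M| * haagerup_seminorm (tens pi1 (chi : om_module E) G))).
    by rewrite ler_wpM2r // ler_norm.
  by rewrite ler_piMr.
have wM1 : haagerup_seminorm w < `|M| + 1 by rewrite (le_lt_trans wM) // ltrDl.
have [q [D [F [wDF hD hF]]]] := haagerup_balanced hE wM1.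
exists q, (\matrix_(i, l) (D ord0 l : C0 R Y1) (y i)), (\matrix_(l, j) (F l ord0 : C0 R Y2) (z j)).
split=> [|i|j].
- apply/matrixP => i j; rewrite !mxE.
  have yz : mu1 (y i) = mu2 (z j) by rewrite yx zx.
  have P := C0_eval_balanced yz.
  pose ev : S -> C^o :=
    tensor_lift (fun (e : E1) (c : C0 R Y2) => ((e : C0 R Y1) (y i) * c (z j) : C^o)).
  have : ev w = \sum_l (D ord0 l : C0 R Y1) (y i) * (F l ord0 : C0 R Y2) (z j).
    move/matrixP/(_ ord0 ord0): wDF; rewrite !mxE => ->.
    rewrite /ev (tensor_lift_sum P); apply: eq_bigr => l _.
    by rewrite (tensor_lift_tens P).
  have -> : ev w = A i j.
    rewrite /ev /w (tensor_lift_sum P) (bigD1 i) //= [X in _ + X]big1 ?addr0.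
      rewrite (tensor_lift_sum P) (bigD1 j) //= [X in _ + X]big1 ?addr0.
        rewrite (tensor_liftZ P) (tensor_lift_tens P).
        rewrite -[LHS]/(A i j * (chi (y i) * (b i (y i))%:C%C * (v j (z j))%:C%C)).
        rewrite chiE by1 vz !eqxx (bigD1 i) //= by1 eqxx big1 ?addr0; last first.
          by move=> k ki; rewrite by1 (negbTE ki).
        by rewrite !mulr1.
      move=> k kj; rewrite (tensor_liftZ P) (tensor_lift_tens P).
      rewrite -[LHS]/(A i k * (chi (y i) * (b i (y i))%:C%C * (v k (z j))%:C%C)).
      by rewrite vz (negbTE kj) !mulr0.
    move=> k ki; rewrite (tensor_lift_sum P) big1 // => l _.
    rewrite (tensor_liftZ P) (tensor_lift_tens P).
    rewrite -[LHS]/(A k l * (chi (y i) * (b k (y i))%:C%C * (v l (z j))%:C%C)).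
    by rewrite by1 (negbTE ki) mulr0 mul0r mulr0.
  by move=> ->; apply: eq_bigr => l _; rewrite !mxE.
- apply: le_trans hD.
  apply: (@le_trans _ _ (mxopnorm (mxev (y i) (D : 'M[C0 R Y1]_(1, q))) ^+ 2)).
    apply: le_trans (row_sum_le_mxopnorm _); apply: ler_sum => l _; by rewrite !mxE.
  rewrite ler_sqr ?nnegrE ?mxopnorm_ge0 ?(mxn_ge0 hE) //; exact: mxev_le_om_norm.
- apply: le_trans hF.
  apply: (@le_trans _ _ (mxopnorm (mxev (z j) F) ^+ 2)).
    apply: le_trans (col_sum_le_mxopnorm _); apply: ler_sum => l _; by rewrite !mxE.
  rewrite ler_sqr ?nnegrE ?mxopnorm_ge0 ?C0_norm_ge0 //; exact: mxev_le_C0_norm.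
Qed.

(** The constant of [iso_bounded_factorization] does not depend on n, whereas Hadamard
    matrices of size n have no factorization better than sqrt n. *)
Theorem beck_chevalley_fibres_bounded : beck_chevalley R hX mu1 mu2 ->
  exists N : nat, forall n (x : X) (y : 'I_n -> Y1) (z : 'I_n -> Y2),
    injective y -> injective z -> (forall i, mu1 (y i) = x) -> (forall j, mu2 (z j) = x) ->
    (n < N)%N.
Proof.
move=> /iso_bounded_factorization [m m0 H].
pose k := Num.bound (m ^+ 2); exists (hadamard_dim k) => n x y z yi zi yx zx.
rewrite ltnNge; apply/negP => kn.
pose w := widen_ord kn.
have wi : injective w by move=> i j /(congr1 val) /= ij; exact: val_inj.
have A1 i j : cmod (hadamard R k i j) <= 1.
  by case: (hadamard_sign R i j) => ->; rewrite ?cmodN cmod1.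
have [q [P [Q [APQ Pm Qm]]]] := H _ x (y \o w) (z \o w) (hadamard R k)
  (inj_comp yi wi) (inj_comp zi wi) (fun i => yx (w i)) (fun j => zx (w j)) A1.
have := hadamard_factorization m0 APQ Pm Qm; rewrite leNgt => /negP; apply.
apply: lt_le_trans (archi_boundP (sqr_ge0 m)) _.
by rewrite ler_nat ltnW // hadamard_dim_gt.
Qed.

End LowerBound.

Section Counting.
Variables (R : realType) (T : choiceType).

Lemma counting_gt_inj (A : set T) (n : nat) : (n%:R%:E < counting A :> \bar R)%E ->
  exists2 y : 'I_n -> T, injective y & forall i, A (y i).
Proof.
move=> nA; have [B BA nB] : exists2 B : {fset T}, [set` B] `<=` A & (n <= #|` B|)%N.
  have [fA|iA] := pselect (finite_set A); last exact: infinite_set_fset.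
  exists (fset_set A); first by rewrite fset_setK.
  by move: nA; rewrite /counting asboolT // lte_fin ltr_nat => /ltnW.
pose y (i : 'I_n) := tnth (in_tuple (enum_fset B)) (widen_ord nB i).
exists y => [i j|i]; last by apply: BA => /=; exact: mem_tnth.
have /tuple_uniqP yi : uniq (in_tuple (enum_fset B)) by exact: fset_uniq.
by move=> /yi /(congr1 val) /= ij; exact: val_inj.
Qed.

End Counting.

Lemma counting_fibre_card_le (R : realType) (Y X : topologicalType) (mu : Y -> X) (x : X)
    (N : nat) :
  (counting (mu @^-1` [set x]) <= N%:R%:E :> \bar R)%E -> fibre_card_le mu x N.
Proof.
rewrite /counting; case: asboolP => [fA|_]; last by rewrite leye_eq.
rewrite lee_fin ler_nat => AN; set B := fset_set _ in AN.
exists (size (enum_fset B)), (tnth (in_tuple (enum_fset B))); split=> //.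
- by apply/tuple_uniqP; exact: fset_uniq.
- move=> i; have : tnth (in_tuple (enum_fset B)) i \in B by exact: mem_tnth.
  by rewrite in_fset_set // inE.
- move=> y' y'x; have : y' \in in_tuple (enum_fset B).
    by rewrite -[_ \in _]/(y' \in B) in_fset_set // inE.
  by move=> /tnthP [i ->]; exists i.
Qed.

Theorem corollary2 (R : realType) (X Y1 Y2 : topologicalType)
    (hX : hausdorff_space X) (lX : locally_compact [set: X]%classic)
    (hY1 : hausdorff_space Y1) (lY1 : locally_compact [set: Y1]%classic)
    (hY2 : hausdorff_space Y2) (lY2 : locally_compact [set: Y2]%classic)
    (mu1 : properMap Y1 X) (mu2 : properMap Y2 X) :
  beck_chevalley R hX mu1 mu2 <->
  (ereal_sup (range (fun x : X =>
     Order.min (counting (mu1 @^-1` [set x]) : \bar R)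
               (counting (mu2 @^-1` [set x]) : \bar R)))%classic < +oo)%E.
Proof.
set f := fun x : X => Order.min _ _.
split=> [bc|supf].
  have [N HN] := beck_chevalley_fibres_bounded hY1 lY1 hY2 lY2 bc.
  apply: (@le_lt_trans _ _ (N%:R%:E)); last exact: ltry.
  apply: ge_ereal_sup => _ [x _ <-]; rewrite leNgt; apply/negP.
  rewrite /f lt_min => /andP[/counting_gt_inj [y yi yx] /counting_gt_inj [z zi zx]].
  by have := HN N x y z yi zi yx zx; rewrite ltnn.
move=> E.
have [N HN] : exists N : nat, forall x, (f x <= N%:R%:E)%E.
  have fsup x : (f x <= ereal_sup (range f))%E by apply: ereal_sup_ubound; exists x.
  move: supf fsup; case: (ereal_sup (range f)) => [r _ fr|//|_ fr].
    exists (Num.bound `|r|) => x; apply: le_trans (fr x) _; rewrite lee_fin.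
    by apply: le_trans (ler_norm r) _; apply: ltW; exact: archi_boundP.
  by exists 0%N => x; apply: le_trans (fr x) _; exact: leNye.
apply: (@base_change_isomorphism R X Y1 Y2 hX lX hY1 lY1 hY2 lY2 mu1 mu2 E N) => x.
have := HN x; rewrite /f ge_min.
by move=> /orP[/counting_fibre_card_le h|/counting_fibre_card_le h]; [left|right].
Qed.
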